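(* Let $\nu>-1/2$, $p_0=\frac{4(\nu+1)}{2\nu+3+2\delta}$ and $p_1=\frac{4(\nu+1)}{2\nu+1-2\delta}$. If $0<\delta<\nu+1/2$, there is $C>0$ such that for all sufficiently large $R$, $$\sup_{\|f\|_{L^{p_1}((0,1),d\mu_\nu)}=1}\|\mathcal{B}_R^\delta f\|_{L^{p_1,\infty}((0,1),d\mu_\nu)}\ge C(\log R)^{1/p_0};$$ and if $\delta=\nu+1/2$, there is $C>0$ such that for all sufficiently large $R$, $$\sup_{\|f\|_{L^{\infty}((0,1),d\mu_\nu)}=1}\|\mathcal{B}_R^\delta f\|_{L^{\infty}((0,1),d\mu_\nu)}\ge C\log R.$$
   Context: Let $J_\nu$ be the Bessel function of order $\nu$, $0<s_1<s_2<\dots$ its successive positive zeros, $d\mu_\nu(x)=x^{2\nu+1}dx$ on $(0,1)$, $\psi_j(x)=\frac{\sqrt2}{|J_{\nu+1}(s_j)|}x^{-\nu}J_\nu(s_jx)$, $a_j(f)=\int_0^1 f\psi_j\,d\mu_\nu$. For $\delta>0$, $R>0$, $\mathcal{B}_R^\delta f(x)=\sum_{j\ge1}(1-s_j^2/R^2)_+^\delta a_j(f)\psi_j(x)$ with $(1-s^2)_+=\max\{1-s^2,0\}$. $\|g\|_{L^{q,\infty}((0,1),d\mu_\nu)}=\sup_{\lambda>0}\lambda\,\mu_\nu(\{|g|>\lambda\})^{1/q}$. *)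

(* Defs.v *)
From HB Require Import structures.
From mathcomp Require Import all_boot all_order all_algebra.
From mathcomp Require Import all_classical all_reals all_analysis.
From mathcomp Require Import measurable_realfun.
Set Implicit Arguments. Unset Strict Implicit. Unset Printing Implicit Defensive.
Import Order.TTheory GRing.Theory Num.Theory.
Import numFieldNormedType.Exports.
Local Open Scope classical_set_scope.
Local Open Scope ring_scope.

Section fourier_bessel.
Context {R : realType}.

Definition Gamma (a : R) : R :=
  Rintegral lebesgue_measure `]0%R, +oo[%classic
    (fun t => t `^ (a - 1) * expR (- t)).

Definition besselJ (nu x : R) : R :=
  \big[+%R/0%R]_(0 <= k <oo) ((-1) ^+ k * (x / 2) `^ (2 * k%:R + nu)
                      / (k`!%:R * Gamma (k%:R + nu + 1))).

(* s enumerates the successive positive zeros of J_nu: s 0 = s_1 < s 1 = s_2 < ... *)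
Definition bessel_zeros (nu : R) (s : nat -> R) : Prop :=
  [/\ forall j, 0 < s j,
      forall j, s j < s j.+1,
      forall j, besselJ nu (s j) = 0
    & forall x, 0 < x -> besselJ nu x = 0 -> exists j, s j = x].

(* psi_j (with j shifted by one: psi nu s j = psi_{j+1}) *)
Definition psi (nu : R) (s : nat -> R) (j : nat) (x : R) : R :=
  Num.sqrt 2 / `|besselJ (nu + 1) (s j)| * x `^ (- nu) * besselJ nu (s j * x).

Definition mu_density (nu : R) (x : R) : R :=
  \1_(`]0%R, 1%R[%classic : set R) x * x `^ (2 * nu + 1).

Definition mu_nu (nu : R) (A : set R) : \bar R :=
  (\int[lebesgue_measure]_(x in A) (mu_density nu x)%:E)%E.

Section mu_nu_measure.
Variable nu : R.

Let mu_density_ge0 x : 0 <= mu_density nu x.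
Proof. by rewrite /mu_density mulr_ge0 // powR_ge0. Qed.

Let mu_density_meas : measurable_fun setT (mu_density nu).
Proof.
apply: measurable_funM.
  by apply: measurable_indic; exact: measurable_itv.
exact: measurable_powR.
Qed.

Let mu0 : mu_nu nu set0 = 0%E.
Proof. by rewrite /mu_nu integral_set0. Qed.

Let mu_ge0 A : (0 <= mu_nu nu A)%E.
Proof. by apply: integral_ge0 => x _; rewrite lee_fin. Qed.

Let mu_sigma_additive : semi_sigma_additive (mu_nu nu).
Proof.
move=> /= A mA tA mUA; rewrite /mu_nu ge0_integral_bigcup//=.
- apply: is_cvg_ereal_nneg_natsum_cond => n _ _.
  by apply: integral_ge0 => x _; rewrite lee_fin.
- apply/measurable_EFinP; exact: measurable_funS mu_density_meas.
- by move=> x _; rewrite lee_fin.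
Qed.

HB.instance Definition _ := isMeasure.Build _ _ _
  (mu_nu nu) mu0 mu_ge0 mu_sigma_additive.

End mu_nu_measure.

Definition coef (nu : R) (s : nat -> R) (f : R -> R) (j : nat) : R :=
  Rintegral (mu_nu nu) `]0%R, 1%R[%classic (fun x => f x * psi nu s j x).

Definition bochner_riesz (nu : R) (s : nat -> R) (delta Rr : R) (f : R -> R)
    (x : R) : R :=
  \big[+%R/0%R]_(0 <= j <oo) ((Num.max (1 - s j ^+ 2 / Rr ^+ 2) 0) `^ delta
                      * coef nu s f j * psi nu s j x).

Definition weak_Lnorm (mu : {measure set R -> \bar R}) (q : R) (g : R -> R)
  : \bar R :=
  ereal_sup [set ((l : R)%:E * (mu [set x : R | (l < `|g x|)%R]) `^ q^-1)%E
            | l in `]0%R, +oo[%classic].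

End fourier_bessel.

(* Main.v *)
(** Write u_a(x) = x^(1/2) J_a(x) up to a constant, a solution of
    u'' = -(1 + (1/4 - a^2)/x^2) u, and e = nu + 1/2 - delta. The test function is
    f(y) = y^(-e) u_(nu+delta+1)(R y) on [2/R, R^(eta-1)] with a small eta > 0; since
    e p_1 = 2 nu + 2 and u_a is bounded on [1, oo[, its L^(p_1)-norm is
    O((log R)^(1/p_1)), and it is bounded if e = 0.

    For x <= eps/R the kernel sum_j (1 - s_j^2/R^2)_+^delta psi_j(x) psi_j(y) is a
    Riemann sum over the zeros s_j, whose gaps tend to pi. The corresponding integral is,
    at x = 0, Sonine's integral, which is a multiple of J_(nu+delta+1)(R y) (R y)^(-nu-delta-1);
    so B_R f(x) is at least c R^e times the integral of u_(nu+delta+1)(Y)^2 / Y over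
    2 <= Y <= R^eta, that is c' R^e log R. As mu_nu([eps/2R, eps/R]) >= (eps/2R)^(2 nu + 2),
    the weak norm of B_R f is at least c'' log R, and dividing by the norm of f gives
    (log R)^(1 - 1/p_1) = (log R)^(1/p_0). *)

Require Import Defs.
From HB Require Import structures.
From mathcomp Require Import all_boot all_order all_algebra.
From mathcomp Require Import all_classical all_reals all_analysis.
From mathcomp Require Import measurable_realfun.
From mathcomp Require Import ess_sup_inf.
From mathcomp Require Import ring lra.
Set Implicit Arguments. Unset Strict Implicit. Unset Printing Implicit Defensive.
Import Order.TTheory GRing.Theory Num.Theory.
Import numFieldNormedType.Exports.
Local Open Scope classical_set_scope.
Local Open Scope ring_scope.

(** * Derivatives *)

(** No asymptotic expansion of J_nu is used: size and zeros are read off from the energy E = u^2 +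
    u'^2 of u'' = -(1 + k / x^2) u, which equals its limit up to factors exp(|k| / x) and exp(-|k| /
    x). The squared norming constant of psi_j is 2 s_j^(2 nu + 1) / E(s_j), and 1 / E(s_j) is a
    fixed multiple of the gap s_(j+1) - s_j up to O(1 / s_j): this is why the kernel is a Riemann
    sum.

    The difficulty is uniformity in Y = R y. The main term has size Y^(-q), q = nu + delta + 3/2, so
    passing from x = 0 to x <= eps / R may cost only a small multiple of Y^(-q), which continuity in
    x does not give. Hence the kernel integral is expanded in powers of (R x)^2, and t^2 = 1 - (1 -
    t^2) reduces each coefficient to Sonine integrals with delta, delta + 1, ..., all O(Y^(-q)). The
    error of the Riemann sum, O(sqrt R + Y^2) against R Y^(-q), does not decay in Y; this confines Y
    to R^eta, with eta (q + 2) = 1/4. *)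

Section derivation.
Context {R : realType}.
Implicit Types (f g : R -> R) (x a b : R).

(** Lets the rules below produce a derivative in whatever form they give, to be brought to the
    desired one by [ring] or [field]. *)
Lemma der_eq f x a b : is_derive x 1 f a -> a = b -> is_derive x 1 f b.
Proof. by move=> ? <-. Qed.

Lemma derC x a : is_derive x 1 (fun=> a : R) 0.
Proof. exact: is_derive_cst. Qed.

Lemma derI x : is_derive x 1 (fun t : R => t) 1.
Proof. exact: is_derive_id. Qed.

Lemma derD f g x a b : is_derive x 1 f a -> is_derive x 1 g b ->
  is_derive x 1 (fun t => f t + g t) (a + b).
Proof. by move=> ? ?; exact: is_deriveD. Qed.

Lemma derN f x a : is_derive x 1 f a -> is_derive x 1 (fun t => - f t) (- a).
Proof. by move=> ?; exact: is_deriveN. Qed.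

Lemma derB f g x a b : is_derive x 1 f a -> is_derive x 1 g b ->
  is_derive x 1 (fun t => f t - g t) (a - b).
Proof. by move=> ? ?; exact: is_deriveB. Qed.

Lemma derM f g x a b : is_derive x 1 f a -> is_derive x 1 g b ->
  is_derive x 1 (fun t => f t * g t) (f x * b + a * g x).
Proof.
move=> fa gb; apply: der_eq (@is_deriveM _ _ f g x 1 a b fa gb) _.
by congr (_ + _); rewrite [LHS]mulrC.
Qed.

Lemma derZ k f x a : is_derive x 1 f a -> is_derive x 1 (fun t => k * f t) (k * a).
Proof. by move=> fa; apply: der_eq (derM (derC x k) fa) _; rewrite mul0r addr0. Qed.

Lemma derV f x a : f x != 0 -> is_derive x 1 f a ->
  is_derive x 1 (fun t => (f t)^-1) (- a / f x ^+ 2).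
Proof.
move=> f0 fa; apply: der_eq (@is_deriveV _ f x a 1 f0 fa) _.
by rewrite /GRing.scale /= mulrC mulrN mulNr.
Qed.

Lemma derX n f x a : is_derive x 1 f a ->
  is_derive x 1 (fun t => f t ^+ n) (n%:R * f x ^+ n.-1 * a).
Proof.
move=> fa; elim: n => [|n ih]; first by rewrite !mul0r; exact: derC.
have -> : (fun t => f t ^+ n.+1) = (fun t => f t * f t ^+ n).
  by apply/funext => t; rewrite exprS.
apply: der_eq (derM fa ih) _; case: n {ih} => [|n] /=; first by rewrite !expr0 !mul0r; ring.
by rewrite -[n.+2%:R]natr1 exprS; ring.
Qed.

Lemma der_comp f g x a b : is_derive (g x) 1 f a -> is_derive x 1 g b ->
  is_derive x 1 (fun t => f (g t)) (a * b).
Proof. by move=> fa gb; exact: (@is_derive1_comp _ f g x a b fa gb). Qed.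

Lemma der_powR p x : 0 < x -> is_derive x 1 (fun t => t `^ p) (p / x * x `^ p).
Proof.
move=> x0; apply: der_eq (is_derive1_powR p x0) _.
by rewrite powRB ?(gt_eqF x0) ?implybT// powRr1 ?ltW// [x `^ p / x]mulrC mulrA.
Qed.

Lemma der_cts f x a : is_derive x 1 f a -> {for x, continuous f}.
Proof. by move=> [fx _]; apply/differentiable_continuous/derivable1_diffP. Qed.

Lemma der_cts_within f df a b :
  (forall x, a <= x <= b -> is_derive x 1 f (df x)) -> {within `[a, b], continuous f}.
Proof.
move=> fd; apply: continuous_in_subspaceT => x.
by rewrite inE /= in_itv /= => /fd /der_cts.
Qed.

Lemma der_MVT f df a b : a <= b ->
  (forall x, a <= x <= b -> is_derive x 1 f (df x)) ->
  exists2 c, a <= c <= b & f b - f a = df c * (b - a).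
Proof.
move=> ab fd; have [||c + cE] := @MVT_segment _ f df a b ab.
- by move=> x; rewrite in_itv /= => /andP[ax xb]; apply: fd; rewrite !ltW.
- exact: der_cts_within fd.
- by rewrite in_itv /= => ?; exists c.
Qed.

Lemma der_ge0_le f df a b : a <= b ->
  (forall x, a <= x <= b -> is_derive x 1 f (df x)) ->
  (forall x, a <= x <= b -> 0 <= df x) -> f a <= f b.
Proof.
move=> ab fd df0; have [c cab fE] := der_MVT ab fd.
by rewrite -subr_ge0 fE mulr_ge0 ?df0 ?subr_ge0.
Qed.

Lemma der_lipschitz f df a b M : a <= b ->
  (forall x, a <= x <= b -> is_derive x 1 f (df x)) ->
  (forall x, a <= x <= b -> `|df x| <= M) -> `|f b - f a| <= M * (b - a).
Proof.
move=> ab fd dfM; have [c cab ->] := der_MVT ab fd.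
by rewrite normrM (ger0_norm (x := b - a)) ?subr_ge0// ler_wpM2r ?subr_ge0 ?dfM.
Qed.

End derivation.

Lemma cvg_mull {R : realType} {T : Type} {F : set_system T} {FF : Filter F}
  (u : T -> R) (k l : R) :
  u n @[n --> F] --> l -> k * u n @[n --> F] --> k * l.
Proof. by move=> ul; apply: cvgM ul; exact: cvg_cst. Qed.

(** * Bessel functions as oscillators *)

Section bessel_series.
Context {R : realType}.
Implicit Types (a w : R).

(** The Pochhammer symbol Gamma(a + k) / Gamma(a). It keeps the power series free of [Gamma], which
    enters only when [besselJ] itself is treated. *)
Definition poch a k : R := \prod_(i < k) (a + i%:R).

Definition bcoef a k : R := (-1) ^+ k / (k`!%:R * poch (a + 1) k).

(* J_a(x) = (x / 2)^a / Gamma(a + 1) * Phi a (x^2 / 4). *)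
Definition Phi a w : R := limn (pseries (bcoef a) w).

Lemma pochS a k : poch a k.+1 = poch a k * (a + k%:R).
Proof. by rewrite /poch big_ord_recr. Qed.

Lemma pochSl a k : poch a k.+1 = a * poch (a + 1) k.
Proof.
rewrite /poch big_ord_recl addr0; congr (_ * _); apply: eq_bigr => i _.
by rewrite /bump /= natrD addrA.
Qed.

Lemma poch_gt0 a k : 0 < a -> 0 < poch a k.
Proof. by move=> a0; apply: prodr_gt0 => i _; rewrite ltr_wpDr. Qed.

Lemma poch_ge a p k : 0 < p -> p <= a -> p ^+ k <= poch a k.
Proof.
move=> p0 pa; elim: k => [|k ih]; first by rewrite /poch big_ord0.
rewrite pochS exprSr ler_pM ?exprn_ge0 ?(ltW p0)//.
by rewrite (le_trans pa)// lerDl.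
Qed.

(** Domination by the series of exp(|w| / (a + 1)): for a > -1 the function [Phi a] is entire. *)
Lemma bcoef_le a k : 0 < a + 1 -> `|bcoef a k| <= (a + 1)^-1 ^+ k / k`!%:R.
Proof.
move=> a1; rewrite /bcoef normrM normrX normrN1 expr1n mul1r.
have p0 := poch_gt0 k a1.
rewrite ger0_norm; last by rewrite invr_ge0 mulr_ge0// ltW.
rewrite invfM mulrC; apply: ler_wpM2r; first by rewrite invr_ge0.
rewrite exprVn lef_pV2 ?posrE ?exprn_gt0 ?poch_gt0//.
exact: poch_ge.
Qed.

Lemma cvg_norm_bcoef a w : 0 < a + 1 -> cvgn (series (fun k => `|bcoef a k * w ^+ k|)).
Proof.
move=> a1; apply: (@series_le_cvg _ _ (exp_coeff (`|w| / (a + 1)))).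
- by [].
- by move=> k; apply: exp_coeff_ge0; rewrite divr_ge0// ltW.
- move=> k; rewrite normrM normrX /exp_coeff /= exprMn.
  have -> : `|w| ^+ k * (a + 1)^-1 ^+ k / k`!%:R = (a + 1)^-1 ^+ k / k`!%:R * `|w| ^+ k by ring.
  by rewrite ler_wpM2r ?exprn_ge0// bcoef_le.
- exact: is_cvg_series_exp_coeff.
Qed.

Lemma cvg_bcoef a w : 0 < a + 1 -> cvgn (pseries (bcoef a) w).
Proof. by move=> a1; apply: normed_cvg; exact: cvg_norm_bcoef. Qed.

Lemma cvg_Phi a w : 0 < a + 1 -> pseries (bcoef a) w n @[n --> \oo] --> Phi a w.
Proof. exact: cvg_bcoef. Qed.

(** The coefficient form of (z^(-a) J_a)' = - z^(-a) J_(a+1). *)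
Lemma bcoef_diffs a k : 0 < a + 1 ->
  pseries_diffs (bcoef a) k = - (a + 1)^-1 * bcoef (a + 1) k.
Proof.
move=> a1; rewrite /pseries_diffs /bcoef pochSl factS natrM exprS.
have a2 : 0 < a + 1 + 1 by rewrite addr_gt0.
have p0 := poch_gt0 k a2.
have f0 : 0 < k`!%:R :> R by rewrite ltr0n fact_gt0.
have k0 : 0 <= k%:R :> R by [].
field.
by rewrite (gt_eqF p0) (gt_eqF a1) (gt_eqF f0) /= gt_eqF// ltr_pwDl.
Qed.

Lemma pseries_diffsZ k (c : nat -> R) :
  pseries_diffs (fun i => k * c i) = (fun i => k * pseries_diffs c i).
Proof. by apply/funext => i; rewrite /pseries_diffs mulrCA. Qed.

Lemma pseriesZ k (c : nat -> R) w :
  pseries (fun i => k * c i) w = (fun n => k * pseries c w n).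
Proof.
apply/funext => n; rewrite /pseries /series /= mulr_sumr.
by apply: eq_bigr => i _; rewrite mulrA.
Qed.

Lemma is_derive_Phi a w : 0 < a + 1 ->
  is_derive w 1 (Phi a) (- Phi (a + 1) w / (a + 1)).
Proof.
move=> a1; have a2 : 0 < a + 1 + 1 by rewrite addr_gt0.
have a3 : 0 < a + 1 + 1 + 1 by rewrite addr_gt0.
have d1 : pseries_diffs (bcoef a) = fun k => - (a + 1)^-1 * bcoef (a + 1) k.
  by apply/funext => k; exact: bcoef_diffs.
have d2 : pseries_diffs (bcoef (a + 1)) = fun k => - (a + 1 + 1)^-1 * bcoef (a + 1 + 1) k.
  by apply/funext => k; exact: bcoef_diffs.
apply: der_eq (@pseries_snd_diffs _ (bcoef a) (`|w| + 1) w _ _ _ _) _.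
- exact: cvg_bcoef.
- by rewrite d1 pseriesZ; apply: cvgP; apply: cvg_mull; exact: cvg_Phi.
- rewrite d1 pseries_diffsZ d2 !pseriesZ.
  by apply: cvgP; apply: cvg_mull; apply: cvg_mull; exact: cvg_Phi.
- by rewrite [ltRHS]ger0_norm ?addr_ge0// ltrDl.
- rewrite d1 pseriesZ; apply/cvg_lim => //.
  by rewrite mulNr mulrC -mulNr; apply: cvg_mull; exact: cvg_Phi.
Qed.

Lemma Phi0 a : Phi a 0 = 1.
Proof.
apply/cvg_lim => //; rewrite -(cvg_shiftS _) /=; apply: cvg_near_cst.
apply: nearW => n; rewrite /pseries /series /= big_nat_recl//= expr0 mulr1 big1.
  by rewrite addr0 /bcoef /poch big_ord0 fact0 mulr1 divr1.
by move=> i _; rewrite expr0n mulr0.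
Qed.

Lemma bcoef_contig a k : 0 < a ->
  bcoef (a + 1) k = a * (a + 1) * (bcoef a k.+1 - bcoef (a - 1) k.+1).
Proof.
move=> a0; have a1 : 0 < a + 1 by rewrite addr_gt0.
have a2 : 0 < a + 1 + 1 by rewrite addr_gt0.
rewrite /bcoef subrK.
have qE : poch (a + 1 + 1) k = poch (a + 1) k * (a + 1 + k%:R) / (a + 1).
  by rewrite -pochS pochSl mulrAC mulfV ?mul1r// gt_eqF.
rewrite qE pochS [poch a _]pochSl factS natrM exprS.
have p1 := poch_gt0 k a1.
have := fact_gt0 k; rewrite -(ltr0n R) => f0.
have n1 : 0 < a + 1 + k%:R by rewrite ltr_wpDr.
field.
have : (k.+1%:R : R) = 1 + k%:R by rewrite -natr1 addrC.
have k0 : (0 : R) <= k%:R by [].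
move=> ke.
by rewrite ?ke !gt_eqF// ?addr_gt0//; lra.
Qed.

(* The three-term recurrence z^2 L_{a+1} = 2a L_a - L_{a-1} of L_a(z) = z^-a J_a(z). *)
Lemma Phi_contig a w : 0 < a -> w * Phi (a + 1) w = a * (a + 1) * (Phi a w - Phi (a - 1) w).
Proof.
move=> a0; have a1 : 0 < a + 1 by rewrite addr_gt0.
have a2 : 0 < a + 1 + 1 by rewrite addr_gt0.
have aa : 0 < a - 1 + 1 by rewrite subrK.
have c1 : pseries (bcoef a) w n - pseries (bcoef (a - 1)) w n @[n --> \oo] -->
    Phi a w - Phi (a - 1) w by apply: cvgB; exact: cvg_Phi.
have c2 : a * (a + 1) * (pseries (bcoef a) w n.+1 - pseries (bcoef (a - 1)) w n.+1)
    @[n --> \oo] --> a * (a + 1) * (Phi a w - Phi (a - 1) w).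
  by rewrite (cvg_shiftS (fun n => a * (a + 1) * (pseries (bcoef a) w n -
    pseries (bcoef (a - 1)) w n))); exact: cvg_mull.
have E : (fun n => w * pseries (bcoef (a + 1)) w n) =
    (fun n => a * (a + 1) * (pseries (bcoef a) w n.+1 - pseries (bcoef (a - 1)) w n.+1)).
  apply/funext => n.
  rewrite /pseries /series /= -sumrB [in RHS]big_nat_recl//= !expr0 !mulr1.
  (* The constant terms of [Phi a] and [Phi (a - 1)] are both 1 and cancel, which leaves a factor w
     on the right. *)
  rewrite {2 3}/bcoef /poch !big_ord0 subrr add0r !mulr_sumr; apply: eq_bigr => i _.
  by rewrite -mulrBl exprS bcoef_contig//; ring.
have c3 : w * pseries (bcoef (a + 1)) w n @[n --> \oo] --> w * Phi (a + 1) w.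
  by apply: cvg_mull; exact: cvg_Phi.
rewrite E in c3.
by rewrite -(cvg_lim _ c3)// (cvg_lim _ c2).
Qed.

End bessel_series.

(** * The phase of a solution next to one of its zeros *)

Section cot_phase.
Context {R : realType}.
Implicit Types (q : R -> R) (a : R).

Let ratio_near q a : q a = 0 -> is_derive a 1 q 1 ->
  \forall z \near a, z != a -> 0 < q z / (z - a).
Proof.
move=> qa /is_derive1_caratheodory[g [qE cg ga]].
have g0 : \forall z \near a, 0 < g z.
  by apply: (cvgr_gt _ cg); rewrite ga ltr01.
apply: filterS g0 => z gz za.
by have := qE z; rewrite qa subr0 => ->; rewrite mulfK// subr_eq0.
Qed.

(** For q = u / u' at a zero of u, the slope is 1, so 1 / q tends to +oo on the right of the zero
    and to -oo on the left. These one-sided limits of the phase are what makes pi appear in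
    [zero_gap]. *)
Lemma cvg_atan_inv_right q a : q a = 0 -> is_derive a 1 q 1 ->
  atan (q x)^-1 @[x --> a^'+] --> pi / 2.
Proof.
move=> qa qd; apply: (cvg_comp _ _ _ (@cvgy_atan R)).
apply/cvgrVy.
  have := ratio_near qa qd.
  rewrite near_withinE; apply: filterS => z qz az.
  by have := qz (negbT (gt_eqF az)); rewrite pmulr_lgt0// invr_gt0 subr_gt0.
by rewrite -qa; apply: cvg_at_right_filter; exact: (der_cts qd).
Qed.

Lemma cvg_atan_inv_left q a : q a = 0 -> is_derive a 1 q 1 ->
  atan (q x)^-1 @[x --> a^'-] --> - (pi / 2).
Proof.
move=> qa qd.
have -> : (fun x => atan (q x)^-1) = (fun x => - atan (- q x)^-1).
  by apply/funext => x; rewrite invrN atanN opprK.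
apply: cvgN; apply: (cvg_comp _ _ _ (@cvgy_atan R)).
apply/cvgrVy.
  have := ratio_near qa qd.
  rewrite near_withinE; apply: filterS => z qz za.
  by have := qz (negbT (lt_eqF za)); rewrite nmulr_lgt0 ?oppr_gt0// invr_lt0 subr_lt0.
by rewrite -oppr0 -qa; apply: cvgN; apply: cvg_at_left_filter; exact: (der_cts qd).
Qed.

End cot_phase.

Section oscillator.
Context {R : realType}.
Variables (u u1 : R -> R) (k : R).
Implicit Types (x y : R).
Hypothesis du : forall x : R, 0 < x -> is_derive x 1 u (u1 x).
Hypothesis du1 : forall x : R, 0 < x -> is_derive x 1 u1 (- (1 + k / x ^+ 2) * u x).

Definition energy (x : R) := u x ^+ 2 + u1 x ^+ 2.

Let E := energy.

Lemma energy_ge0 x : 0 <= E x.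
Proof. by rewrite addr_ge0 ?sqr_ge0. Qed.

Lemma sqr_le_energy x : u x ^+ 2 <= E x.
Proof. by rewrite lerDl sqr_ge0. Qed.

Lemma mul_le_energy x : `|u x * u1 x| <= E x.
Proof.
rewrite normrM /E /energy -(real_normK (num_real (u x))) -(real_normK (num_real (u1 x))).
by have := sqr_ge0 (`|u x| - `|u1 x|); have := normr_ge0 (u x); have := normr_ge0 (u1 x); nra.
Qed.

Lemma is_derive_energy x : 0 < x -> is_derive x 1 E (- 2 * k / x ^+ 2 * (u x * u1 x)).
Proof.
move=> x0; apply: der_eq (derD (derX 2 (du x0)) (derX 2 (du1 x0))) _.
by rewrite /= !expr1; field; rewrite gt_eqF.
Qed.

Lemma is_derive_exp_inv c x : 0 < x ->
  is_derive x 1 (fun t => expR (c / t)) (- c / x ^+ 2 * expR (c / x)).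
Proof.
move=> x0; have x0' : (x != 0) by rewrite gt_eqF.
apply: der_eq (der_comp (is_derive_expR _) (derZ c (derV x0' (derI x)))) _.
by field.
Qed.

(** Because 2 |u u'| <= E, the derivative of E is at most |k| E / x^2 in absolute value, and |k| /
    x^2 is the logarithmic derivative of exp(-|k| / x). The same bound gives [energy_decr] with the
    opposite sign. *)
Lemma energy_incr x y : 0 < x -> x <= y ->
  E x * expR (- `|k| / x) <= E y * expR (- `|k| / y).
Proof.
move=> x0 xy.
have d t (t0 : 0 < t) := derM (is_derive_energy t0) (is_derive_exp_inv (- `|k|) t0).
apply: (@der_ge0_le _ (fun t => E t * expR (- `|k| / t)) _ x y xy) => [t /andP[xt _]|t /andP[xt _]]; first exact: d (lt_le_trans x0 xt).
have t0 := lt_le_trans x0 xt.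
rewrite opprK mulrA -mulrDl mulr_ge0 ?expR_ge0//.
rewrite [E t * _]mulrC -!mulrA ![_ * (_^-1 * _)]mulrCA -mulrDr mulr_ge0 ?invr_ge0 ?sqr_ge0//.
have : `|k * (u t * u1 t) *+ 2| <= `|k| * E t.
  rewrite normrMn normrM -mulrnAr ler_wpM2l// normrM /E /energy.
  rewrite -(real_normK (num_real (u t))) -(real_normK (num_real (u1 t))).
  by have := sqr_ge0 (`|u t| - `|u1 t|); nra.
by rewrite ler_norml => /andP[_]; rewrite mulr2n; lra.
Qed.

Lemma energy_decr x y : 0 < x -> x <= y ->
  E y * expR (`|k| / y) <= E x * expR (`|k| / x).
Proof.
move=> x0 xy.
have d t (t0 : 0 < t) := derN (derM (is_derive_energy t0) (is_derive_exp_inv `|k| t0)).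
rewrite -lerN2.
apply: (@der_ge0_le _ (fun t => - (E t * expR (`|k| / t))) _ x y xy) => [t /andP[xt _]|t /andP[xt _]]; first exact: d (lt_le_trans x0 xt).
have t0 := lt_le_trans x0 xt.
rewrite mulrA -mulrDl -mulNr mulr_ge0 ?expR_ge0//.
rewrite [E t * _]mulrC -!mulrA ![_ * (_^-1 * _)]mulrCA -mulrDr -mulrN mulr_ge0 ?invr_ge0 ?sqr_ge0//.
have : `|k * (u t * u1 t) *+ 2| <= `|k| * E t.
  rewrite normrMn normrM -mulrnAr ler_wpM2l// normrM /E /energy.
  rewrite -(real_normK (num_real (u t))) -(real_normK (num_real (u1 t))).
  by have := sqr_ge0 (`|u t| - `|u1 t|); nra.
by rewrite ler_norml => /andP[+ _]; rewrite mulr2n; lra.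
Qed.

Lemma energy_upper x : 1 <= x -> E x <= E 1 * expR `|k|.
Proof.
move=> x1; have := energy_decr ltr01 x1; rewrite divr1; apply: le_trans.
rewrite ler_peMr ?energy_ge0// -expR0 ler_expR divr_ge0// (le_trans _ x1)//.
Qed.

Lemma energy_lower x : 1 <= x -> E 1 * expR (- `|k|) <= E x.
Proof.
move=> x1; have := energy_incr ltr01 x1; rewrite divr1 => /le_trans; apply.
rewrite ler_piMr ?energy_ge0// -expR0 ler_expR mulNr oppr_le0 divr_ge0// (le_trans _ x1)//.
Qed.

Hypothesis u_neq0 : forall x : R, 0 < x -> exists2 y, 0 < y <= x & u y != 0.

(* By [energy_incr], a solution with vanishing energy somewhere vanishes at all earlier times. *)
Lemma energy_gt0 x : 0 < x -> 0 < E x.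
Proof.
move=> x0; rewrite lt_def energy_ge0 andbT; apply/eqP => Ex.
have [y /andP[y0 yx] /eqP uy] := u_neq0 x0; apply: uy.
have := energy_incr y0 yx; rewrite Ex mul0r pmulr_lle0 ?expR_gt0// => Ey.
apply/eqP; rewrite -sqrf_eq0 eq_le sqr_ge0 andbT.
exact: le_trans (sqr_le_energy y) Ey.
Qed.

(** The limit of E at infinity is taken as the supremum of the increasing quantity of [energy_incr];
    every value of the decreasing one in [energy_decr] bounds it from above. The two monotonicities
    thus give the limit together with its rate. *)
Lemma energy_lim : exists2 Einf, 0 < Einf & forall x : R, 0 < x ->
  Einf * expR (- `|k| / x) <= E x <= Einf * expR (`|k| / x).
Proof.
pose A := [set E x * expR (- `|k| / x) | x in [set x : R | 0 < x]].
have A0 : A !=set0 by exists (E 1 * expR (- `|k| / 1)); exists 1 => //=.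
have ub y : 0 < y -> ubound A (E y * expR (`|k| / y)).
  move=> y0 _ [x /= x0 <-]; have [yx|xy] := leP y x.
    apply: le_trans (energy_decr y0 yx); rewrite ler_wpM2l ?energy_ge0// ler_expR.
    by rewrite ler_wpM2r ?invr_ge0 ?(ltW x0)// (@le_trans _ _ 0)// oppr_le0.
  apply: le_trans (energy_incr x0 (ltW xy)) _; rewrite ler_wpM2l ?energy_ge0// ler_expR.
  by rewrite ler_wpM2r ?invr_ge0 ?(ltW y0)// (@le_trans _ _ 0)// oppr_le0.
have hA : has_sup A by split => //; exists (E 1 * expR (`|k| / 1)); exact: ub.
exists (sup A) => [|x x0].
  apply: (@lt_le_trans _ _ (E 1 * expR (- `|k| / 1))).
    by rewrite mulr_gt0 ?expR_gt0 ?energy_gt0.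
  by apply: sup_upper_bound => //; exists 1 => //=.
have ee : expR (- `|k| / x) * expR (`|k| / x) = 1.
  by rewrite -expRD mulNr addNr expR0.
apply/andP; split.
  rewrite -[leRHS]mulr1 -ee [_ * expR (`|k| / x)]mulrC mulrA ler_wpM2r ?expR_ge0//.
  by apply: sup_le_ub => //; exact: ub.
rewrite -[leLHS]mulr1 -ee mulrA ler_wpM2r ?expR_ge0//.
by apply: sup_upper_bound => //; exists x.
Qed.

(* The phase atan (u' / u) + x would be constant for k = 0, and drops by pi - (b - a)
   between consecutive zeros. *)
Lemma zero_gap (a b : R) : 0 < a -> a < b -> u a = 0 -> u b = 0 ->
  (forall x, a < x < b -> u x != 0) ->
  `|b - a - pi| <= `|k| / a ^+ 2 * (b - a).
Proof.
move=> a0 ab ua ub une0.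
have b0 := lt_trans a0 ab.
have u1ne0 x : 0 < x -> u x = 0 -> u1 x != 0.
  move=> x0 ux; have := energy_gt0 x0.
  by rewrite /E /energy ux expr0n add0r /=; apply: contraTneq => ->; rewrite expr0n ltxx.
pose q x := u x / u1 x.
have qd x : 0 < x -> u x = 0 -> is_derive x 1 q 1.
  move=> x0 ux; have n0 := u1ne0 _ x0 ux.
  by apply: der_eq (derM (du x0) (derV n0 (du1 x0))) _; rewrite ux mulfV//; ring.
have qa : q a = 0 by rewrite /q ua mul0r.
have qb : q b = 0 by rewrite /q ub mul0r.
(* Its derivative is - k u^2 / (x^2 E), at most |k| / a^2 in absolute value. At a and b the
   convention 0^-1 = 0 gives [th] a meaningless value, so the bound is carried to the ends by
   one-sided limits. *)
pose th x := atan (q x)^-1 + x.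
have thE : th = fun x => atan (u1 x / u x) + x.
  by apply/funext => x; rewrite /th /q invf_div.
have thd x : a < x < b -> is_derive x 1 th (- k / x ^+ 2 * (u x ^+ 2 / E x)).
  move=> /andP[ax xb]; have x0 := lt_trans a0 ax; have un : u x != 0 by apply: une0; rewrite ax.
  rewrite thE.
  apply: der_eq (derD (der_comp (is_derive1_atan _) (derM (du1 x0) (derV un (du x0)))) (derI x)) _.
  rewrite /E; have := energy_gt0 x0; rewrite /E /energy => e0; field.
  by rewrite un gt_eqF//= gt_eqF//= addrC gt_eqF.
have thL x y : a < x -> x <= y -> y < b -> `|th y - th x| <= `|k| / a ^+ 2 * (b - a).
  move=> ax xy yb; apply: (@le_trans _ _ (`|k| / a ^+ 2 * (y - x))); last first.
    by rewrite ler_wpM2l ?divr_ge0 ?sqr_ge0//; lra.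
  apply: (@der_lipschitz _ th (fun z => - k / z ^+ 2 * (u z ^+ 2 / E z)) x y _ xy) => [z /andP[xz zy]|z /andP[xz zy]].
    by apply: thd; rewrite (lt_le_trans ax)//= (le_lt_trans zy).
  have az := lt_le_trans ax xz; have z0 := lt_trans a0 az.
  have e0 := energy_gt0 z0.
  rewrite normrM -[leRHS]mulr1; apply: ler_pM => //.
    rewrite normrM normrN (ger0_norm (x := (z ^+ 2)^-1)) ?invr_ge0 ?sqr_ge0//.
    rewrite ler_wpM2l// lef_pV2 ?posrE ?exprn_gt0//.
    by rewrite lerXn2r ?nnegrE ?ltW.
  rewrite ger0_norm; last by rewrite divr_ge0 ?sqr_ge0 ?energy_ge0.
  by rewrite ler_pdivrMr// mul1r sqr_le_energy.
(* The midpoint separates the two limits: the right end is first sent to b for x <= m, then x is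
   sent to a. *)
pose m := (a + b) / 2.
have am : a < m by rewrite /m; lra.
have mb : m < b by rewrite /m; lra.
have lim_a : th x @[x --> a^'+] --> pi / 2 + a.
  apply: cvgD; first exact: cvg_atan_inv_right (qd _ a0 ua).
  by apply: cvg_at_right_filter; exact: cvg_id.
have lim_b : th x @[x --> b^'-] --> - (pi / 2) + b.
  apply: cvgD; first exact: cvg_atan_inv_left (qd _ b0 ub).
  by apply: cvg_at_left_filter; exact: cvg_id.
have thm x : a < x -> x <= m -> `|- (pi / 2) + b - th x| <= `|k| / a ^+ 2 * (b - a).
  move=> ax xm; apply: (@cvgr_to_le _ (b^'-) _ _ (fun y => `|th y - th x|)).
    by apply: cvg_norm; apply: cvgB lim_b _; exact: cvg_cst.
  near=> y; apply: thL => //.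
  by apply: (le_trans xm); near: y; exact: nbhs_left_ge.
rewrite (_ : b - a - pi = - (pi / 2) + b - (pi / 2 + a)); last by field.
apply: (@cvgr_to_le _ (a^'+) _ _ (fun x => `|- (pi / 2) + b - th x|)).
  by apply: cvg_norm; apply: cvgB lim_a; exact: cvg_cst.
near=> x; apply: thm => //.
by near: x; exact: nbhs_right_le.
Unshelve. all: by end_near.
Qed.

End oscillator.

Section bessel_oscillator.
Context {R : realType}.
Implicit Types (a x w : R).

(* A constant multiple of x^(1/2) J_a(x), and below its derivative. *)
Definition bu a x : R := x `^ (a + 1 / 2) * Phi a (x ^+ 2 / 4).

Definition bu1 a x : R := x `^ (a + 1 / 2) *
  ((a + 1 / 2) / x * Phi a (x ^+ 2 / 4) - x / (2 * (a + 1)) * Phi (a + 1) (x ^+ 2 / 4)).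

Lemma is_derive_Phi_sqr a x : 0 < a + 1 ->
  is_derive x 1 (fun t => Phi a (t ^+ 2 / 4)) (- x / (2 * (a + 1)) * Phi (a + 1) (x ^+ 2 / 4)).
Proof.
move=> a1.
apply: der_eq (der_comp (is_derive_Phi _ a1) (derM (derX 2 (derI x)) (derC x 4^-1))) _.
by rewrite /= expr1; field; rewrite gt_eqF.
Qed.

Lemma is_derive_bu a x : 0 < a + 1 -> 0 < x -> is_derive x 1 (bu a) (bu1 a x).
Proof.
move=> a1 x0; apply: der_eq (derM (der_powR _ x0) (is_derive_Phi_sqr x a1)) _.
by rewrite /bu1; field; rewrite !gt_eqF.
Qed.

Lemma is_derive_bu1 a x : 0 < a + 1 -> 0 < x ->
  is_derive x 1 (bu1 a) (- (1 + (1 / 4 - a ^+ 2) / x ^+ 2) * bu a x).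
Proof.
move=> a1 x0; have xn : x != 0 by rewrite gt_eqF.
have a2 : 0 < a + 1 + 1 by rewrite addr_gt0.
have d1 := derM (derM (derC x (a + 1 / 2)) (derV xn (derI x))) (is_derive_Phi_sqr x a1).
have d2 := derM (derM (derI x) (derC x (2 * (a + 1))^-1)) (is_derive_Phi_sqr x a2).
apply: der_eq (derM (der_powR _ x0) (derB d1 d2)) _.
rewrite /bu; set P := x `^ _; set P0 := Phi a _; set P1 := Phi (a + 1) _; set P2 := Phi _ _.
(* Differentiating twice brings in order a + 2; the recurrence at order a + 1 eliminates it, and
   Bessel's equation in normal form remains. *)
have : x ^+ 2 / 4 * P2 = (a + 1) * (a + 1 + 1) * (P1 - P0).
  by rewrite /P2 Phi_contig// addrK.
move=> E; have -> : P2 = (a + 1) * (a + 1 + 1) * (P1 - P0) * 4 / x ^+ 2.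
  by rewrite -E; field.
by field; rewrite ?xn (gt_eqF a1) /= (gt_eqF a2).
Qed.

Lemma cts_Phi a w : 0 < a + 1 -> {for w, continuous (Phi a)}.
Proof. by move=> a1; exact: der_cts (is_derive_Phi w a1). Qed.

Lemma Phi_near0 a : 0 < a + 1 -> exists2 e, 0 < e & forall w, 0 <= w <= e -> 1 / 2 <= Phi a w.
Proof.
move=> a1.
have : \forall w \near (0 : R), 1 / 2 < Phi a w.
  by apply: (cvgr_gt _ (@cts_Phi a 0 a1)); rewrite Phi0; lra.
move=> [e /= e0 he]; exists (e / 2) => [|w /andP[w0 we]]; first by rewrite divr_gt0.
by apply/ltW/he => /=; rewrite sub0r normrN ger0_norm//; lra.
Qed.

Lemma bu_neq0 a x : 0 < a + 1 -> 0 < x -> exists2 y, 0 < y <= x & bu a y != 0.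
Proof.
move=> a1 x0; have [e e0 he] := Phi_near0 a1.
(* The bound by 1 ensures y^2 / 4 <= y <= e. *)
exists (Num.min x (Num.min 1 e)).
  by rewrite lt_min x0 lt_min ltr01 e0 ge_min lexx.
set y := Num.min _ _; have y0 : 0 < y by rewrite lt_min x0 lt_min ltr01 e0.
have y1 : y <= 1 by rewrite /y !ge_min lexx /= orbT.
have ye : y <= e by rewrite /y !ge_min lexx /= !orbT.
rewrite mulf_neq0//; first by rewrite gt_eqF ?powR_gt0.
rewrite gt_eqF//; apply: lt_le_trans (he _ _); first lra.
by rewrite divr_ge0 ?sqr_ge0//=; nra.
Qed.

Definition bE a := energy (bu a) (bu1 a).

Section order.
Variable a : R.
Hypothesis a1 : 0 < a + 1.

Let du x (x0 : 0 < x) := is_derive_bu a1 x0.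
Let du1 x (x0 : 0 < x) := is_derive_bu1 a1 x0.
Let une x (x0 : 0 < x) := bu_neq0 a1 x0.

Lemma bE_gt0 x : 0 < x -> 0 < bE a x.
Proof. exact: energy_gt0 du du1 une x. Qed.

Lemma bE_upper : exists2 M, 0 < M & forall x, 1 <= x -> bE a x <= M.
Proof.
exists (bE a 1 * expR `|1 / 4 - a ^+ 2|); first by rewrite mulr_gt0 ?expR_gt0 ?bE_gt0.
exact: energy_upper du du1.
Qed.

Lemma bE_lower : exists2 m, 0 < m & forall x, 1 <= x -> m <= bE a x.
Proof.
exists (bE a 1 * expR (- `|1 / 4 - a ^+ 2|)); first by rewrite mulr_gt0 ?expR_gt0 ?bE_gt0.
exact: energy_lower du du1.
Qed.

Lemma bE_lim : exists2 Einf, 0 < Einf & forall x, 0 < x ->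
  Einf * expR (- `|1 / 4 - a ^+ 2| / x) <= bE a x <= Einf * expR (`|1 / 4 - a ^+ 2| / x).
Proof. exact: energy_lim du du1 une. Qed.

Lemma bu_zero_gap (x y : R) : 0 < x -> x < y -> bu a x = 0 -> bu a y = 0 ->
  (forall z, x < z < y -> bu a z != 0) ->
  `|y - x - pi| <= `|1 / 4 - a ^+ 2| / x ^+ 2 * (y - x).
Proof. exact: zero_gap du du1 une x y. Qed.

Lemma bu_bounded : exists2 V, 0 < V & forall x, 1 <= x -> `|bu a x| <= V.
Proof.
have [M M0 hM] := bE_upper; exists (M + 1) => [|x x1]; first by rewrite addr_gt0.
have := le_trans (sqr_le_energy (bu a) (bu1 a) x) (hM x x1).
rewrite -(real_normK (num_real (bu a x))); have := normr_ge0 (bu a x); nra.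
Qed.

Lemma Phi_decay : exists2 C, 0 < C &
  forall x, 1 <= x -> `|Phi a (x ^+ 2 / 4)| <= C * x `^ (- (a + 1 / 2)).
Proof.
have [V V0 hV] := bu_bounded; exists V => // x x1; have x0 : 0 < x by rewrite (lt_le_trans _ x1).
rewrite powRN ler_pdivlMr ?powR_gt0// mulrC -{1}(ger0_norm (powR_ge0 x _)) -normrM.
exact: hV.
Qed.

(** For a >= -1/2 the exponent in [Phi_decay] is nonpositive, so [Phi a] is bounded for w > 1; on
    [0, 1] compactness is enough. *)
Lemma Phi_bounded : - 1 / 2 <= a -> exists2 C, 0 < C & forall w, 0 <= w -> `|Phi a w| <= C.
Proof.
move=> ah; have [C C0 hC] := Phi_decay.
have [c _ hc] : exists2 c, c \in `[0, 1]%R & forall t, t \in `[0, 1]%R -> `|Phi a t| <= `|Phi a c|.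
  apply: (@EVT_max _ (fun t => `|Phi a t|)) => //.
  apply: continuous_subspaceT => t; apply: continuous_comp; last exact: norm_continuous.
  exact: cts_Phi.
exists (C + `|Phi a c|) => [|w w0]; first by rewrite ltr_wpDr.
have [w1|w1] := leP w 1.
  by rewrite (le_trans (hc w _)) ?in_itv /= ?w0 ?w1// lerDr ltW.
rewrite (@le_trans _ _ C)// ?lerDl//.
have x0 : 0 <= 2 * Num.sqrt w by rewrite mulr_ge0 ?sqrtr_ge0.
have wE : w = (2 * Num.sqrt w) ^+ 2 / 4 by rewrite exprMn sqr_sqrtr//; field.
have x1 : 1 <= 2 * Num.sqrt w.
  by rewrite -(ler_pXn2r (n := 2)) ?nnegrE// expr1n; lra.
rewrite wE (le_trans (hC _ x1))// ler_piMr ?(ltW C0)// powRN.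
rewrite invf_le1 ?powR_gt0 ?(lt_le_trans _ x1)//.
by rewrite -[leLHS](powRr0 (2 * Num.sqrt w)) ler_powR//; lra.
Qed.

End order.
End bessel_oscillator.

(** * Zeros and Riemann sums *)

Section zeros.
Context {R : realType}.
Variables (a : R) (s : nat -> R).
Hypothesis a1 : 0 < a + 1.
Hypothesis s_gt0 : forall j, 0 < s j.
Hypothesis s_incr : forall j, s j < s j.+1.
Hypothesis s_zero : forall j, bu a (s j) = 0.
Hypothesis s_all : forall x, 0 < x -> bu a x = 0 -> exists j, s j = x.

Let K : R := `|1 / 4 - a ^+ 2|.

Lemma zeros_mono : {homo s : i j / (i <= j)%N >-> i <= j}.
Proof. by apply: homo_leq => [x|y x z|i]; [exact: lexx|exact: le_trans|exact: ltW]. Qed.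

Let gap_bound j : `|s j.+1 - s j - pi| <= K / s j ^+ 2 * (s j.+1 - s j).
Proof.
apply: bu_zero_gap => // z /andP[jz zj]; apply/eqP => uz.
have [i si] := s_all (lt_trans (s_gt0 j) jz) uz; rewrite -si in jz zj.
have [ij|ji] := leqP i j; first by have := zeros_mono ij; rewrite leNgt jz.
by have := zeros_mono ji; rewrite leNgt zj.
Qed.

Lemma zeros_lower : exists2 c, 0 < c & forall j, c * j.+1%:R <= s j.
Proof.
have p0 := pi_gt0 R; have s0 := s_gt0 0.
have K0 : 0 <= K := normr_ge0 _.
(* From |gap - pi| <= (K / s_0^2) gap follows pi <= (1 + K / s_0^2) gap. *)
pose c := pi / (1 + K / s 0 ^+ 2).
have q0 : 0 < 1 + K / s 0 ^+ 2 by rewrite ltr_wpDr ?divr_ge0 ?sqr_ge0.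
have c0 : 0 < c by rewrite divr_gt0.
have gc j : c <= s j.+1 - s j.
  rewrite ler_pdivrMr//.
  have := gap_bound j; rewrite ler_norml => /andP[+ _].
  have sj : s 0 <= s j by exact: zeros_mono.
  have : K / s j ^+ 2 <= K / s 0 ^+ 2.
    rewrite ler_wpM2l// lef_pV2 ?posrE ?exprn_gt0//.
    by rewrite lerXn2r// nnegrE ltW.
  have gp : 0 <= s j.+1 - s j by rewrite subr_ge0 ltW.
  move=> /(ler_wpM2r gp); have := s_incr j.
  by rewrite [(s j.+1 - s j) * _]mulrC mulrDl mul1r; lra.
exists (Num.min c (s 0)) => [|j]; first by rewrite lt_min c0 s0.
elim: j => [|j ih]; first by rewrite mulr1 ge_min lexx orbT.
rewrite -natr1 mulrDr mulr1; have := gc j.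
have : Num.min c (s 0) <= c by rewrite ge_min lexx.
by move: ih; set q := Num.min _ _ * _; lra.
Qed.

Lemma zeros_unbounded x : exists j, x <= s j.
Proof.
have [c c0 hc] := zeros_lower.
exists (Num.truncn (x / c)); apply: le_trans (hc _); rewrite mulrC -ler_pdivrMr//.
by apply/ltW/truncnS_gt.
Qed.

Lemma zeros_gap_le : exists2 G, 0 < G & forall j, s j.+1 - s j <= G.
Proof.
have p0 := pi_gt0 R; have K0 : 0 <= K := normr_ge0 _.
have [J hJ] := zeros_unbounded (2 * K + 1).
have gp j : 0 <= s j.+1 - s j by rewrite subr_ge0 ltW.
(* Once s_j >= 2 K + 1, the relative error K / s_j^2 is at most 1/2 and the gap at most 2 pi; the
   sum covers the finitely many earlier gaps. *)
exists (2 * pi + \sum_(i < J) (s i.+1 - s i)) => [|j].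
  by rewrite ltr_wpDr ?mulr_gt0// sumr_ge0.
have [jJ|Jj] := ltnP j J.
  rewrite (bigD1 (Ordinal jJ))//= addrCA lerDl addr_ge0 ?sumr_ge0// mulr_ge0 ?pi_ge0//.
rewrite ler_wpDr ?sumr_ge0//.
have sJ : 2 * K + 1 <= s j by rewrite (le_trans hJ)// zeros_mono.
have := gap_bound j; rewrite ler_norml => /andP[_].
have : K / s j ^+ 2 <= 1 / 2.
  by rewrite ler_pdivrMr ?exprn_gt0//; nra.
by move=> /(ler_wpM2r (gp j)); lra.
Qed.

(** The weight 1 / E(s_j) tends to 1 / E_inf and the gap tends to pi, both with error O(1 / s_j), so
    that lam = 1 / (pi E_inf). This turns a sum over the zeros into a Riemann sum. *)
Lemma zeros_weight : exists lam C, [/\ 0 < lam, 0 < C &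
  forall j, `|(bE a (s j))^-1 - lam * (s j.+1 - s j)| <= C / s j].
Proof.
have p0 := pi_gt0 R; have s0 := s_gt0 0; have K0 : 0 <= K := normr_ge0 _.
have [G G0 hG] := zeros_gap_le.
have [E E0 hE] := bE_lim a1.
(* The summand 1 keeps C positive when K = 0, that is for a = 1/2 or a = -1/2. *)
exists (pi * E)^-1, (E^-1 * (K * expR (K / s 0)) + (pi * E)^-1 * (K * G / s 0) + 1).
have L0 : 0 < (pi * E)^-1 by rewrite invr_gt0 mulr_gt0.
split => //.
  have t1 : 0 <= E^-1 * (K * expR (K / s 0)).
    by rewrite mulr_ge0 ?invr_ge0 ?(ltW E0)// mulr_ge0 ?expR_ge0.
  have t2 : 0 <= (pi * E)^-1 * (K * G / s 0).
    by rewrite mulr_ge0 ?(ltW L0)// divr_ge0 ?(ltW s0)// mulr_ge0 ?(ltW G0).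
  lra.
move=> j; have sj := s_gt0 j; have sj0 : s 0 <= s j by exact: zeros_mono.
have Ej := bE_gt0 a1 sj.
have h1 : `|(bE a (s j))^-1 - E^-1| <= E^-1 * (K * expR (K / s 0)) / s j.
  have /andP[lo hi] := hE _ sj; rewrite -/K in lo hi.
  have ee : expR (- K / s j) * expR (K / s j) = 1 by rewrite -expRD mulNr addNr expR0.
  have e1 := expR_ge1Dx (- K / s j); have e2 := expR_ge1Dx (K / s j).
  have eg := expR_gt0 (K / s j); have el := expR_gt0 (- K / s j).
  have eK : expR (K / s j) <= expR (K / s 0).
    by rewrite ler_expR ler_wpM2l// lef_pV2 ?posrE.
  have k0 : 0 <= K / s j by rewrite divr_ge0// ltW.
  have up : (bE a (s j))^-1 <= E^-1 * expR (K / s j).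
    rewrite -[leLHS]mul1r ler_pdivrMr// -mulrA ler_pdivlMl//; nra.
  have dn : E^-1 * expR (- K / s j) <= (bE a (s j))^-1.
    by rewrite -[leRHS]mul1r ler_pdivlMr// -mulrA ler_pdivrMl//; nra.
  have iE : 0 < E^-1 by rewrite invr_gt0.
  have -> : E^-1 * (K * expR (K / s 0)) / s j = E^-1 * (K / s j * expR (K / s 0)) by ring.
  have eq : - K / s j = - (K / s j) by rewrite mulNr.
  rewrite eq in e1 ee el dn; move: (K / s j) e1 e2 ee eg el eK k0 up dn => x e1 e2 ee eg el eK k0 up dn.
  rewrite ler_norml; apply/andP; split.
    have : E^-1 * (1 - x * expR (K / s 0)) <= (bE a (s j))^-1.
      apply: le_trans dn; rewrite ler_wpM2l ?(ltW iE)//.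
      by have : 1 <= expR (K / s 0); [apply: le_trans eK; lra|nra].
    by lra.
  have : (bE a (s j))^-1 <= E^-1 * (1 + x * expR (K / s 0)).
    apply: (le_trans up); rewrite ler_wpM2l ?(ltW iE)//; nra.
  by lra.
have h2 : `|(pi * E)^-1 * (s j.+1 - s j - pi)| <= (pi * E)^-1 * (K * G / s 0) / s j.
  rewrite normrM (ger0_norm (ltW L0)) -[leRHS]mulrA ler_wpM2l ?(ltW L0)//.
  apply: le_trans (gap_bound j) _.
  have -> : K * G / s 0 / s j = K / (s 0 * s j) * G by field; rewrite (gt_eqF s0) (gt_eqF sj).
  apply: ler_pM => //; rewrite ?divr_ge0 ?sqr_ge0 ?subr_ge0 ?(ltW (s_incr _))//.
  by rewrite ler_wpM2l// lef_pV2 ?posrE ?mulr_gt0 ?exprn_gt0// expr2 ler_pM2r.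
have alg (i p g : R) : 0 < p -> i - (p * E)^-1 * g = (i - E^-1) - (p * E)^-1 * (g - p).
  by move=> q0; field; rewrite (gt_eqF E0) (gt_eqF q0).
rewrite (alg _ _ _ p0).
apply: le_trans (ler_normB _ _) _; rewrite [leRHS]mulrDl [X in _ <= X + _]mulrDl.
by rewrite ler_wpDr ?lerD// mul1r invr_ge0 ltW.
Qed.

(** The sum is in fact logarithmic. A square root is small enough against the main term and
    telescopes: 1 / (n + 1) <= 1 / sqrt(n + 1) <= 2 (sqrt(n + 1) - sqrt n). *)
Lemma zeros_inv_sum : exists2 C, 0 < C & forall n, \sum_(j < n) (s j)^-1 <= C * Num.sqrt (s n).
Proof.
have [c c0 hc] := zeros_lower.
have sq n : \sum_(j < n) (j.+1%:R : R)^-1 <= 2 * Num.sqrt n%:R.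
  elim: n => [|n ih]; first by rewrite big_ord0 sqrtr0 mulr0.
  rewrite big_ord_recr /=; apply: le_trans (lerD ih (lexx _)) _.
  have r0 : 0 <= Num.sqrt n%:R :> R by exact: sqrtr_ge0.
  have r1 : 1 <= Num.sqrt n.+1%:R :> R by rewrite -[leLHS]sqrtr1 ler_sqrt ?ler1n.
  have : Num.sqrt n.+1%:R ^+ 2 - Num.sqrt n%:R ^+ 2 = 1 :> R.
    by rewrite !sqr_sqrtr// -natr1; ring.
  have : Num.sqrt n%:R <= Num.sqrt n.+1%:R :> R by rewrite ler_sqrt// ler_nat.
  rewrite -[n.+1%:R^-1](_ : Num.sqrt n.+1%:R^-1 ^+ 2 = _); last first.
    by rewrite sqr_sqrtr// invr_ge0.
  rewrite sqrtrV//.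
  move: (Num.sqrt n%:R) (Num.sqrt n.+1%:R) r0 r1 => x y x0 y1 xy yx.
  have iy : y^-1 <= 1 by rewrite invf_le1//; lra.
  have : y^-1 ^+ 2 <= y^-1 by rewrite expr2 ler_piMl ?invr_ge0//; lra.
  have yy : y * y^-1 = 1 by rewrite mulfV// gt_eqF//; lra.
  have : y^-1 <= 2 * (y - x).
    have i0 : 0 <= y^-1 by rewrite invr_ge0; lra.
    have : (y - x) * (y + x) * y^-1 = y^-1 by rewrite -subr_sqr yx mul1r.
    have : (y - x) * (y + x) * y^-1 <= (y - x) * (2 * y) * y^-1.
      by rewrite ler_wpM2r// ler_wpM2l ?subr_ge0//; lra.
    rewrite -!mulrA yy; lra.
  lra.
exists (2 / c * (Num.sqrt c)^-1) => [|n].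
  by rewrite mulr_gt0 ?divr_gt0// invr_gt0 sqrtr_gt0.
apply: (@le_trans _ _ (c^-1 * \sum_(j < n) (j.+1%:R)^-1)).
  rewrite mulr_sumr; apply: ler_sum => j _.
  by rewrite -invfM lef_pV2 ?posrE ?mulr_gt0.
rewrite [2 / c]mulrC -!mulrA ler_wpM2l ?invr_ge0 ?(ltW c0)//.
apply: (le_trans (sq n)); rewrite ler_wpM2l// -sqrtrV ?(ltW c0)// -sqrtrM ?invr_ge0 ?(ltW c0)//.
rewrite ler_sqrt ?mulr_ge0 ?invr_ge0 ?(ltW c0) ?(ltW (s_gt0 _))//.
rewrite ler_pdivlMl//; apply: le_trans (hc n).
by rewrite ler_pM2l// ler_nat.
Qed.

End zeros.

Section riemann_sum.
Context {R : realType}.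

(** The error is measured by a majorant V of the variation and not by a Lipschitz constant, because
    (1 - t^2)_+^d is not Lipschitz at 1 for d < 1, nor t^(2 nu + 1) at 0 for nu < 0. The term t_0 B
    stands for [0, t_0], which has no sample point. *)
Lemma riemann_sum (t : nat -> R) (Q P V : R -> R) (B h : R) (n : nat) :
  0 <= t 0 -> (forall j, t j <= t j.+1) -> (forall j, t j.+1 - t j <= h) ->
  (forall x, 0 <= x <= t n -> is_derive x 1 P (Q x)) ->
  (forall x, 0 <= x <= t n -> `|Q x| <= B) ->
  (forall x y, 0 <= x -> x <= y -> y <= t n -> `|Q x - Q y| <= V y - V x) ->
  `|P (t n) - P 0 - \sum_(j < n) (t j.+1 - t j) * Q (t j)| <= t 0 * B + h * (V (t n) - V (t 0)).
Proof.
move=> t0 tS th PQ QB QV.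
have tm : {homo t : i j / (i <= j)%N >-> i <= j}.
  by apply: homo_leq => [x|y x z|i]; [exact: lexx|exact: le_trans|exact: tS].
have tp j : 0 <= t j by rewrite (le_trans t0)// tm.
have hh : 0 <= h by apply: le_trans (th 0); rewrite subr_ge0.
suff : forall k, (k <= n)%N ->
    `|P (t k) - P 0 - \sum_(j < k) (t j.+1 - t j) * Q (t j)| <= t 0 * B + h * (V (t k) - V (t 0)).
  by apply.
elim=> [_|k ih kn].
  rewrite big_ord0 !subrr mulr0 subr0 addr0 mulrC.
  have -> : B * t 0 = B * (t 0 - 0) by rewrite subr0.
  apply: (@der_lipschitz _ P Q 0 (t 0) B t0) => [x /andP[x0 xt]|x /andP[x0 xt]].
    by apply: PQ; rewrite x0 (le_trans xt)// tm.
  by apply: QB; rewrite x0 (le_trans xt)// tm.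
rewrite big_ord_recr /=.
have [c /andP[kc cS] cE] : exists2 c, t k <= c <= t k.+1 &
    P (t k.+1) - P (t k) = Q c * (t k.+1 - t k).
  apply: (@der_MVT _ P Q _ _ (tS k)) => x /andP[kx xk].
  by apply: PQ; rewrite (le_trans (tp k) kx) (le_trans xk)// tm.
set S := \sum_(_ < _) _ in ih *.
have -> : P (t k.+1) - P 0 - (S + (t k.+1 - t k) * Q (t k)) =
    (P (t k) - P 0 - S) + (t k.+1 - t k) * (Q c - Q (t k)).
  by rewrite mulrBr [_ * Q c]mulrC -cE; ring.
apply: le_trans (ler_normD _ _) _.
have := ih (ltnW kn); set A := `|_ - S| => hA.
have : `|(t k.+1 - t k) * (Q c - Q (t k))| <= h * (V (t k.+1) - V (t k)).
  rewrite normrM ger0_norm ?subr_ge0// ler_pM ?subr_ge0//.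
  have tk : t k.+1 <= t n by exact: tm.
  have h1 := QV _ _ (tp k) kc (le_trans cS tk).
  have h2 := QV _ _ (le_trans (tp k) kc) cS tk.
  by rewrite distrC; have := normr_ge0 (Q c - Q (t k.+1)); lra.
lra.
Qed.

End riemann_sum.

(** * Sonine's integral *)

Section positive_power.
Context {R : realType}.
Implicit Types (p x : R).

(* Unlike [x `^ p], which is [1] for [x < 0], [ppow p] is continuous. *)
Definition ppow p x : R := (Num.max x 0) `^ p.

Lemma ppowE p x : 0 <= x -> ppow p x = x `^ p.
Proof. by move=> x0; rewrite /ppow max_l. Qed.

Lemma ppow0 p x : 0 < p -> x <= 0 -> ppow p x = 0.
Proof. by move=> p0 x0; rewrite /ppow max_r// powR0// gt_eqF. Qed.

Lemma ppow_ge0 p x : 0 <= ppow p x.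
Proof. exact: powR_ge0. Qed.

Lemma ppow_mono p : 0 <= p -> {homo ppow p : x y / x <= y}.
Proof.
move=> p0 x y xy; apply: ge0_ler_powR => //.
- by rewrite nnegrE le_max lexx orbT.
- by rewrite nnegrE le_max lexx orbT.
- by rewrite ge_max !le_max xy lexx orbT.
Qed.

Lemma ppowS p x : 0 < p -> ppow (p + 1) x = x * ppow p x.
Proof.
move=> p0; have [x0|x0] := leP x 0; first by rewrite !ppow0 ?addr_gt0// mulr0.
by rewrite !ppowE ?(ltW x0)// powRD ?(gt_eqF x0) ?implybT// powRr1 ?(ltW x0)// mulrC.
Qed.

Lemma cts_ppow p : 0 < p -> continuous (ppow p).
Proof.
move=> p0 x; apply/cvgrPdist_lt => e e0; have [x0|x0|x0] := ltgtP x 0.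
- near=> z; rewrite !ppow0 ?subrr ?normr0 ?(ltW x0)//.
  by apply/ltW; near: z; exact: lt_nbhsl.
- have : {for x, continuous (fun t : R => t `^ p)} by exact: der_cts (der_powR p x0).
  move=> /cvgrPdist_lt /(_ _ e0) h; near=> z.
  by rewrite !ppowE ?(ltW x0)//; [near: z|apply/ltW; near: z; exact: lt_nbhsr].
- rewrite x0 [ppow p 0]ppow0// ; near=> z.
  rewrite sub0r normrN ger0_norm ?ppow_ge0//.
  have -> : e = (e `^ p^-1) `^ p by rewrite -powRrM mulVf ?gt_eqF// powRr1 ?ltW.
  apply: gt0_ltr_powR => //; rewrite ?nnegrE ?powR_ge0 ?le_max ?lexx ?orbT//.
  rewrite gt_max powR_gt0// andbT; apply: le_lt_trans (ler_norm _) _.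
  near: z; have := @cvgr0_norm_lt _ _ _ (nbhs (0 : R)) _ id cvg_id (e `^ p^-1).
  by apply; exact: powR_gt0.
Unshelve. all: by end_near.
Qed.

Lemma der_ppow p x : 0 < p -> is_derive x 1 (ppow (p + 1)) ((p + 1) * ppow p x).
Proof.
move=> p0; have p1 : 0 < p + 1 by rewrite addr_gt0.
have [x0|x0|x0] := ltgtP x 0.
- rewrite [ppow p x]ppow0 ?(ltW x0)// mulr0.
  apply: (@near_eq_is_derive _ R R (fun=> 0) _ x 1 0 _ (derC x 0)).
  by near=> z; rewrite ppow0//; apply/ltW; near: z; exact: lt_nbhsl.
- rewrite ppowE ?(ltW x0)//.
  have dd : is_derive x 1 (fun t => t `^ (p + 1)) ((p + 1) * x `^ p).
    apply: der_eq (der_powR _ x0) _.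
    by rewrite powRD ?(gt_eqF x0) ?implybT// powRr1 ?(ltW x0)//; field; rewrite gt_eqF.
  apply: (@near_eq_is_derive _ R R _ _ x 1 _ _ dd).
  by near=> z; rewrite ppowE//; apply/ltW; near: z; exact: lt_nbhsr.
(* As [ppow (p + 1)] is z times [ppow p], the latter is itself the slope function at 0, continuous
   with value 0. *)
- rewrite x0 [ppow p 0]ppow0// mulr0; apply/is_derive1_caratheodory.
  exists (ppow p); split; [|exact: cts_ppow|by rewrite ppow0].
  by move=> z; rewrite [ppow _ 0]ppow0// !subr0 ppowS// mulrC.
Unshelve. all: by end_near.
Qed.

End positive_power.

(** * Integration over [0, 1] through antiderivatives *)

Section primitive.
Context {R : realType}.
Implicit Types (f g F : R -> R) (x : R).

(* Based at [-1] so that [0] is an interior point. *)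
Definition prim f (x : R) : R := Rintegral lebesgue_measure `[-1, x] f.

Lemma is_derive_prim f (x : R) : continuous f -> -1 < x -> is_derive x 1 (prim f) (f x).
Proof.
move=> cf x1; have xx : x < x + 1 by rewrite ltrDl.
have fi : lebesgue_measure.-integrable `[-1, x + 1] (EFin \o f).
  apply: continuous_compact_integrable; first exact: segment_compact.
  exact: continuous_subspaceT.
have [d1 d2] := continuous_FTC1_closed xx fi x1 (cf x).
by apply: DeriveDef; [exact: d1|rewrite -derive1E d2].
Qed.

(** A difference of values of a primitive, so that linearity and comparison reduce to the mean value
    theorem. *)
Definition int01 f : R := prim f 1 - prim f 0.

Lemma int01_eq f F : continuous f ->
  (forall x : R, 0 <= x <= 1 -> is_derive x 1 F (f x)) -> int01 f = F 1 - F 0.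
Proof.
move=> cf Ff; rewrite /int01.
have [|c _] := @der_MVT _ (fun x => prim f x - F x) (fun x => f x - f x) 0 1 ler01.
  move=> x /andP[x0 x1]; apply: derB; last by apply: Ff; rewrite x0.
  by apply: is_derive_prim => //; rewrite (lt_le_trans _ x0)// ltrN10.
by rewrite subrr mul0r; lra.
Qed.

Lemma int01D f g : continuous f -> continuous g ->
  int01 (fun x => f x + g x) = int01 f + int01 g.
Proof.
move=> cf cg; apply: etrans (@int01_eq _ (fun x => prim f x + prim g x) _ _) _; last by rewrite /int01; ring.
- by move=> x; apply: cvgD; [exact: cf|exact: cg].
- move=> x /andP[x0 _]; apply: derD; apply: is_derive_prim => //;
  by rewrite (lt_le_trans _ x0)// ltrN10.
Qed.

Lemma int01Z (k : R) f : continuous f -> int01 (fun x => k * f x) = k * int01 f.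
Proof.
move=> cf; apply: etrans (@int01_eq _ (fun x => k * prim f x) _ _) _; last by rewrite /int01; ring.
- by move=> x; apply: cvg_mull; exact: cf.
- move=> x /andP[x0 _]; apply: derZ; apply: is_derive_prim => //.
  by rewrite (lt_le_trans _ x0)// ltrN10.
Qed.

Lemma int01B f g : continuous f -> continuous g ->
  int01 (fun x => f x - g x) = int01 f - int01 g.
Proof.
move=> cf cg; have -> : (fun x => f x - g x) = (fun x => f x + -1 * g x).
  by apply/funext => x; rewrite mulN1r.
by rewrite int01D// ?int01Z ?mulN1r// => x; apply: cvg_mull; exact: cg.
Qed.

Lemma cts_sum n (f : nat -> R -> R) : (forall i, continuous (f i)) ->
  continuous (fun x => \sum_(i < n) f i x).
Proof.
move=> cf; elim: n => [|n ih] x.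
  by under eq_fun do rewrite big_ord0; exact: cvg_cst.
have -> : (fun x => \sum_(i < n.+1) f i x) = (fun x => \sum_(i < n) f i x + f n x).
  by apply/funext => y; rewrite big_ord_recr.
by apply: cvgD; [exact: ih|exact: cf].
Qed.

Lemma int01_sum n (f : nat -> R -> R) : (forall i, continuous (f i)) ->
  int01 (fun x => \sum_(i < n) f i x) = \sum_(i < n) int01 (f i).
Proof.
move=> cf; elim: n => [|n ih].
  have -> : (fun x => \sum_(i < 0) f i x) = (fun=> 0) by apply/funext => y; rewrite big_ord0.
  rewrite big_ord0; apply: etrans (@int01_eq _ (fun=> 0) _ _) _; last by rewrite subrr.
  by move=> x; exact: cvg_cst.
have -> : (fun x => \sum_(i < n.+1) f i x) = (fun x => \sum_(i < n) f i x + f n x).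
  by apply/funext => y; rewrite big_ord_recr.
by rewrite big_ord_recr /= -ih int01D//; exact: cts_sum.
Qed.

Lemma int01_le f g : continuous f -> continuous g ->
  (forall x : R, 0 <= x <= 1 -> f x <= g x) -> int01 f <= int01 g.
Proof.
move=> cf cg fg; rewrite -subr_ge0 -int01B// /int01 subr_ge0.
have cfg : continuous (fun x => g x - f x) by move=> x; apply: cvgB; [exact: cg|exact: cf].
apply: (@der_ge0_le _ _ (fun x => g x - f x) 0 1 ler01) => x /andP[x0 x1].
  by apply: is_derive_prim => //; rewrite (lt_le_trans _ x0)// ltrN10.
by rewrite subr_ge0 fg// x0.
Qed.

Lemma int01_norm_le f g : continuous f -> continuous g ->
  (forall x : R, 0 <= x <= 1 -> `|f x| <= g x) -> `|int01 f| <= int01 g.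
Proof.
move=> cf cg fg; rewrite ler_norml; apply/andP; split; last first.
  by apply: int01_le => // x hx; apply: le_trans (ler_norm _) (fg x hx).
rewrite -mulN1r -int01Z//; apply: int01_le => // [x|x hx].
  by apply: cvg_mull; exact: cg.
by rewrite mulN1r lerNl (le_trans _ (fg x hx))// -normrN ler_norm.
Qed.

Lemma int01_gt0 f (c a b : R) : continuous f -> 0 <= a -> a < b -> b <= 1 -> 0 < c ->
  (forall x : R, 0 <= x <= 1 -> 0 <= f x) -> (forall x : R, a <= x <= b -> c <= f x) -> 0 < int01 f.
Proof.
move=> cf a0 ab b1 c0 f0 fc; rewrite /int01.
have d x : 0 <= x -> is_derive x 1 (prim f) (f x).
  by move=> x0; apply: is_derive_prim => //; rewrite (lt_le_trans _ x0)// ltrN10.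
have h1 : prim f 0 <= prim f a.
  apply: (@der_ge0_le _ _ f _ _ a0) => x /andP[x0 xa]; first exact: d.
  by apply: f0; rewrite x0/=; lra.
have h3 : prim f b <= prim f 1.
  apply: (@der_ge0_le _ _ f _ _ b1) => x /andP[bx x1]; first by apply: d; lra.
  by apply: f0; rewrite x1 andbT; lra.
have [|x hx xE] := @der_MVT _ (prim f) f a b (ltW ab).
  by move=> x /andP[ax _]; apply: d; lra.
have := fc x hx; have : 0 < b - a by lra.
nra.
Qed.

End primitive.

Section Phi_remainder.
Context {R : realType}.

(** The tail of the absolutely convergent series at w dominates the remainder at every t w with t in
    [0, 1]; this uniformity allows integration in t term by term. *)
Lemma Phi_remainder (a w : R) : 0 < a + 1 -> exists2 rho : nat -> R,
  rho n @[n --> \oo] --> 0 &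
  forall n t, 0 <= t <= 1 ->
    `|Phi a (t * w) - \sum_(i < n) bcoef a i * w ^+ i * t ^+ i| <= rho n.
Proof.
move=> a1; pose u : nat -> R := series (fun k => `|bcoef a k * w ^+ k|).
have cu : cvgn u := @cvg_norm_bcoef _ a w a1.
have um : nondecreasing_seq u.
  by apply/nondecreasing_seqP => n; rewrite /u /series /= big_nat_recr//= lerDl.
exists (fun n => limn u - u n) => [|n t /andP[t0 t1]].
  by rewrite -[X in _ --> X](subrr (limn u)); apply: cvgB => //; exact: cvg_cst.
have Sc : `|pseries (bcoef a) (t * w) N - \sum_(i < n) bcoef a i * w ^+ i * t ^+ i| @[N --> \oo]
    --> `|Phi a (t * w) - \sum_(i < n) bcoef a i * w ^+ i * t ^+ i|.
  by apply: cvg_norm; apply: cvgB; [exact: cvg_Phi|exact: cvg_cst].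
apply: (cvgr_to_le Sc); near=> N.
have nN : (n <= N)%N by near: N; exact: nbhs_infty_ge.
apply: (@le_trans _ _ (u N - u n)); last by rewrite lerB// nondecreasing_cvgn_le.
have -> : u N - u n = \sum_(n <= i < N) `|bcoef a i * w ^+ i|.
  by rewrite /u /series /= (@big_cat_nat _ _ _ n 0 N)//= addrAC subrr add0r.
have -> : pseries (bcoef a) (t * w) N - \sum_(i < n) bcoef a i * w ^+ i * t ^+ i =
    \sum_(n <= i < N) bcoef a i * (t * w) ^+ i.
  rewrite /pseries /series /= (@big_cat_nat _ _ _ n 0 N)//= big_mkord.
  rewrite (eq_bigr (fun i : 'I_n => bcoef a i * w ^+ i * t ^+ i)) => [|i _].
    by rewrite addrAC subrr add0r.
  by rewrite exprMn mulrA mulrAC.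
apply: le_trans (ler_norm_sum _ _ _) _.
apply: ler_sum => i _; rewrite exprMn mulrCA normrM ler_piMl//.
by rewrite ger0_norm ?exprn_ge0// exprn_ile1.
Unshelve. all: by end_near.
Qed.

End Phi_remainder.

Section continuity.
Context {R : realType}.
Implicit Types f g : R -> R.

Lemma ctsM f g : continuous f -> continuous g -> continuous (fun x => f x * g x).
Proof. by move=> cf cg x; apply: cvgM; [exact: cf|exact: cg]. Qed.

Lemma ctsB f g : continuous f -> continuous g -> continuous (fun x => f x - g x).
Proof. by move=> cf cg x; apply: cvgB; [exact: cf|exact: cg]. Qed.

Lemma ctsC (c : R) : continuous (fun _ : R => c).
Proof. by move=> x; exact: cvg_cst. Qed.

Lemma cts_sqrX k : continuous (fun x : R => (x ^+ 2) ^+ k).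
Proof. by move=> x; exact: der_cts (derX k (derX 2 (derI x))). Qed.

Lemma cts_Phi_sqr (a w : R) : 0 < a + 1 -> continuous (fun x : R => Phi a (x ^+ 2 * w)).
Proof.
by move=> a1 x; exact: der_cts (der_comp (is_derive_Phi _ a1) (derM (derX 2 (derI x)) (derC x w))).
Qed.

End continuity.

Section sonine.
Context {R : realType}.
Variable nu : R.
Hypothesis hnu : - 1 / 2 < nu.
Implicit Types (d w t z : R).

Let nu1 : 0 < nu + 1. Proof. by move: hnu; lra. Qed.
Let p0 : 0 < 2 * nu + 1. Proof. by move: hnu; lra. Qed.

(** The Bochner-Riesz multiplier at the frequency t r, times the power which comes from the norming
    constants of [psi]. For d > 0 it vanishes beyond t = 1. *)
Definition wt d t : R := ppow (2 * nu + 1) t * ppow d (1 - t ^+ 2).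

Lemma wt_ge0 d t : 0 <= wt d t.
Proof. by rewrite mulr_ge0 ?ppow_ge0. Qed.

Lemma cts_wt d : 0 < d -> continuous (wt d).
Proof.
move=> d0; apply: ctsM; first exact: cts_ppow.
move=> x; apply: (@continuous_comp _ _ _ (fun t => 1 - t ^+ 2) (ppow d)).
  exact: der_cts (derB (derC x 1) (derX 2 (derI x))).
exact: cts_ppow.
Qed.

Lemma wtS d t : 0 < d -> wt (d + 1) t = (1 - t ^+ 2) * wt d t.
Proof. by move=> d0; rewrite /wt ppowS// mulrCA. Qed.

Lemma wt_le d t : 0 < d -> wt (d + 1) t <= wt d t.
Proof. by move=> d0; rewrite wtS// ler_piMl ?wt_ge0// lerBlDr lerDl sqr_ge0. Qed.

(** Half of Euler's B(nu + 1 + k, d + 1), by the substitution of t for t^2. *)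
Definition beta d k : R := int01 (fun t => wt d t * (t ^+ 2) ^+ k).

Lemma cts_beta d k : 0 < d -> continuous (fun t => wt d t * (t ^+ 2) ^+ k).
Proof. by move=> d0; apply: ctsM; [exact: cts_wt|exact: cts_sqrX]. Qed.

Lemma beta_rec d k : 0 < d ->
  (nu + d + 2 + k%:R) * beta d k.+1 = (nu + 1 + k%:R) * beta d k.
Proof.
move=> d0.
(* Integration by parts: F vanishes at 0 and at 1, so the integral of its derivative, a combination
   of the two moments, is zero. *)
pose F t := ppow (2 * nu + 1 + 1) t * (t ^+ 2) ^+ k * ppow (d + 1) (1 - t ^+ 2).
have dF t : is_derive t 1 F ((2 * (nu + 1 + k%:R)) * (wt d t * (t ^+ 2) ^+ k) -
    (2 * (nu + d + 2 + k%:R)) * (wt d t * (t ^+ 2) ^+ k.+1)).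
  have dX : is_derive t 1 (fun t => (t ^+ 2) ^+ k) (k%:R * (t ^+ 2) ^+ k.-1 * (2 * t)).
    by apply: der_eq (derX k (derX 2 (derI t))) _; rewrite /= expr1 mulr1.
  have dQ : is_derive t 1 (fun t => ppow (d + 1) (1 - t ^+ 2)) ((d + 1) * ppow d (1 - t ^+ 2) * (- 2 * t)).
    apply: der_eq (der_comp (der_ppow _ d0) (derB (derC t 1) (derX 2 (derI t)))) _.
    by rewrite /= expr1; ring.
  apply: der_eq (derM (derM (der_ppow t p0) dX) dQ) _.
  have XS j : (t ^+ 2) ^+ j.+1 = t ^+ 2 * (t ^+ 2) ^+ j by rewrite exprS.
  rewrite (ppowS t p0) (ppowS (1 - t ^+ 2) d0) /wt XS.
  clear F dX; case: k => [|k] /=; first by rewrite !expr0; ring.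
  by rewrite XS -[k.+1%:R]natr1; ring.
have cF : continuous (fun t => (2 * (nu + 1 + k%:R)) * (wt d t * (t ^+ 2) ^+ k) -
    (2 * (nu + d + 2 + k%:R)) * (wt d t * (t ^+ 2) ^+ k.+1)).
  by apply: ctsB; apply: ctsM; [exact: ctsC|exact: cts_beta|exact: ctsC|exact: cts_beta].
have /esym := int01_eq cF (fun t _ => dF t).
have F0 : F 0 = 0.
  by rewrite /F [ppow _ 0]ppow0 ?mul0r//; move: p0; lra.
have F1 : F 1 = 0.
  by rewrite /F [X in 1 - X]expr1n subrr [ppow _ 0]ppow0 ?mulr0//; lra.
rewrite F0 F1 subrr int01B; [|by apply: ctsM; [exact: ctsC|exact: cts_beta]..].
rewrite !int01Z; [|exact: cts_beta..].
rewrite -/(beta d k) -/(beta d k.+1); lra.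
Qed.

Lemma beta_ge0 d k : 0 < d -> 0 <= beta d k.
Proof.
move=> d0; have -> : 0 = int01 (fun=> 0) :> R.
  by rewrite (int01_eq (@ctsC R 0) (fun x _ => derC x 0)) subrr.
apply: int01_le; [exact: ctsC|exact: cts_beta|move=> t _].
by rewrite mulr_ge0 ?wt_ge0// exprn_ge0// sqr_ge0.
Qed.

Lemma beta_gt0 d : 0 < d -> 0 < beta d 0.
Proof.
move=> d0; pose c : R := (1 / 4) `^ (2 * nu + 1) * (3 / 4) `^ d.
apply: (@int01_gt0 _ _ c (1 / 4) (1 / 2)); try lra.
- exact: cts_beta.
- by rewrite /c mulr_gt0 ?powR_gt0//; lra.
- by move=> t _; rewrite mulr_ge0 ?wt_ge0// exprn_ge0// sqr_ge0.
- move=> t /andP[t1 t2]; rewrite expr0 mulr1 /wt /c.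
  apply: ler_pM; rewrite ?powR_ge0//.
    by rewrite -ppowE; [apply: ppow_mono; [exact: ltW|lra]|lra].
  by rewrite -ppowE; [apply: ppow_mono; [exact: ltW|nra]|lra].
Qed.

(** Makes the bounds on the Sonine integrals uniform in the shift i of d. *)
Lemma beta_le d i : 0 < d -> beta (d + i%:R) 0 <= beta d 0.
Proof.
move=> d0; elim: i => [|i]; first by rewrite addr0.
apply: le_trans; have di : 0 < d + i%:R by rewrite ltr_wpDr.
apply: int01_le => [||t _]; [by apply: cts_beta; rewrite ltr_wpDr|exact: cts_beta|].
by rewrite !expr0 !mulr1 -natr1 addrA wt_le.
Qed.

Lemma beta_poch d k : 0 < d -> beta d k * poch (nu + d + 2) k = beta d 0 * poch (nu + 1) k.
Proof.
move=> d0; elim: k => [|k ih]; first by rewrite /poch !big_ord0.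
rewrite !pochS.
transitivity (poch (nu + d + 2) k * ((nu + d + 2 + k%:R) * beta d k.+1)); first ring.
rewrite beta_rec//; transitivity ((nu + 1 + k%:R) * (beta d k * poch (nu + d + 2) k)); first ring.
by rewrite ih; ring.
Qed.

Let nud d : 0 < d -> 0 < nu + d + 1 + 1. Proof. by move: nu1; lra. Qed.

(** Sonine's formula coefficient by coefficient: the moment replaces the Pochhammer symbol of nu + 1
    in the denominator by that of nu + d + 2. *)
Lemma beta_bcoef d k : 0 < d -> bcoef nu k * beta d k = beta d 0 * bcoef (nu + d + 1) k.
Proof.
move=> d0; have := beta_poch k d0; rewrite /bcoef (_ : nu + d + 1 + 1 = nu + d + 2); last ring.
have q0 : 0 < poch (nu + d + 2) k by apply: poch_gt0; move: (nud d0); lra.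
have q1 := poch_gt0 k nu1.
have f0 : 0 < k`!%:R :> R by rewrite ltr0n fact_gt0.
move=> E; have -> : beta d k = beta d 0 * poch (nu + 1) k / poch (nu + d + 2) k.
  by rewrite -E mulfK ?gt_eqF.
by field; rewrite (gt_eqF q0) (gt_eqF q1) (gt_eqF f0).
Qed.

Lemma sonine d w : 0 < d ->
  int01 (fun t => wt d t * Phi nu (t ^+ 2 * w)) = beta d 0 * Phi (nu + d + 1) w.
Proof.
move=> d0; have [rho rho0 hrho] := Phi_remainder w nu1.
pose S n := \sum_(i < n) bcoef nu i * w ^+ i * beta d i.
have SE n : S n = beta d 0 * pseries (bcoef (nu + d + 1)) w n.
  rewrite /S /pseries /series /= big_mkord mulr_sumr; apply: eq_bigr => i _.
  by rewrite mulrAC beta_bcoef// mulrA.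
have Sc : S n @[n --> \oo] --> beta d 0 * Phi (nu + d + 1) w.
  rewrite (_ : S = fun n => beta d 0 * pseries (bcoef (nu + d + 1)) w n); last exact/funext.
  have c1 : pseries (bcoef (nu + d + 1)) w n @[n --> \oo] --> Phi (nu + d + 1) w.
    by apply: cvg_Phi; exact: nud.
  exact: cvg_mull c1.
have cP : continuous (fun t => wt d t * Phi nu (t ^+ 2 * w)).
  by apply: ctsM; [exact: cts_wt|exact: cts_Phi_sqr].
pose g n t := \sum_(i < n) (bcoef nu i * w ^+ i) * (wt d t * (t ^+ 2) ^+ i).
have cgi i : continuous (fun t => (bcoef nu i * w ^+ i) * (wt d t * (t ^+ 2) ^+ i)).
  by apply: ctsM; [exact: ctsC|exact: cts_beta].
have cg n : continuous (g n).
  exact: (@cts_sum _ n (fun i t => (bcoef nu i * w ^+ i) * (wt d t * (t ^+ 2) ^+ i))).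
have gS n : int01 (g n) = S n.
  rewrite (@int01_sum _ n (fun i t => (bcoef nu i * w ^+ i) * (wt d t * (t ^+ 2) ^+ i)))//.
  by apply: eq_bigr => i _; rewrite int01Z//; exact: cts_beta.
set I := int01 _.
have IS n : `|I - S n| <= rho n * beta d 0.
  rewrite -gS -int01B// -int01Z; last exact: cts_beta.
  apply: int01_norm_le => [||t /andP[t0 t1]]; [exact: ctsB|by apply: ctsM; [exact: ctsC|exact: cts_beta]|].
  have -> : wt d t * Phi nu (t ^+ 2 * w) - g n t = wt d t *
      (Phi nu (t ^+ 2 * w) - \sum_(i < n) bcoef nu i * w ^+ i * (t ^+ 2) ^+ i).
    rewrite mulrBr; congr (_ - _); rewrite mulr_sumr; apply: eq_bigr => i _; ring.
  rewrite normrM ger0_norm ?wt_ge0// mulrC expr0 mulr1 ler_wpM2r ?wt_ge0// hrho//.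
  by rewrite sqr_ge0 expr_le1.
have l1 : `|I - S n| @[n --> \oo] --> `|I - beta d 0 * Phi (nu + d + 1) w|.
  by apply: cvg_norm; apply: cvgB => //; exact: cvg_cst.
have l2 : rho n * beta d 0 @[n --> \oo] --> 0 * beta d 0.
  by apply: cvgM => //; exact: cvg_cst.
have : `|I - beta d 0 * Phi (nu + d + 1) w| <= 0 * beta d 0.
  by apply: (ler_cvg_to l1 l2); exact: nearW.
by rewrite mul0r normr_le0 subr_eq0 => /eqP.
Qed.

End sonine.

(** * Growth in the order of the Bessel function *)

Section order_growth.
Context {R : realType}.

(* The factor (i!)^2 is compensated by [bcoef nu i] in the expansion of the kernel in x. *)
Lemma Phi_order_growth (a : R) : 0 < a -> exists D L, [/\ 0 < D, 1 <= L &
  forall i Y, 2 <= Y ->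
    `|Phi (a + i%:R) (Y ^+ 2 / 4)| <= D * L ^+ i * (i`!%:R) ^+ 2 * Y `^ (- (a + 1 / 2))].
Proof.
move=> a0.
have a1 : 0 < a + 1 by rewrite addr_gt0.
have a2 : 0 < a + 1 + 1 by rewrite addr_gt0.
have [C C0 hC] := Phi_decay a1; have [C' C'0 hC'] := Phi_decay a2.
(* Chosen so that 2 (a + n) (a + n + 1) <= L (n + 1)^2: one step of the recurrence then costs a
   factor L and the square of the next factor of the factorial. *)
pose L := 2 * (a + 1) * (a + 2).
have L1 : 1 <= L by rewrite /L; nra.
exists (C + C'), L; split => //; first by rewrite addr_gt0.
move=> i Y Y2; have Y1 : 1 <= Y by lra.
set N := Y `^ _; have N0 : 0 <= N by exact: powR_ge0.
set D := C + C'; have D0 : 0 <= D by rewrite addr_ge0 ?ltW.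
pose B j : R := D * L ^+ j * (j`!%:R) ^+ 2 * N.
have B0 j : 0 <= B j by rewrite !mulr_ge0 ?exprn_ge0//; lra.
have BS j : (a + j.+1%:R) * (a + j.+1%:R + 1) * (B j.+1 + B j) <= B j.+2.
  have Bm : B j <= B j.+1.
    rewrite /B ler_wpM2r// -!mulrA ler_wpM2l//.
    have f1 : (j`!%:R : R) ^+ 2 <= (j.+1)`!%:R ^+ 2.
      by rewrite lerXn2r ?nnegrE// ler_nat factS leq_pmull.
    have Lj : 0 <= L ^+ j by rewrite exprn_ge0//; lra.
    have f0 : 0 <= (j`!%:R : R) ^+ 2 by exact: sqr_ge0.
    by apply: ler_pM => //; rewrite exprS ler_peMl.
  have -> : B j.+2 = L * (j.+2%:R) ^+ 2 * B j.+1.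
    by rewrite /B factS natrM exprS; ring.
  apply: (@le_trans _ _ ((a + j.+1%:R) * (a + j.+1%:R + 1) * (2 * B j.+1))).
    by apply: ler_wpM2l; [rewrite mulr_ge0 // !addr_ge0 // ltW|lra].
  rewrite mulrA ler_wpM2r//.
  have jE : j.+2%:R = j.+1%:R + 1 :> R by rewrite natr1.
  rewrite jE; have : 0 <= j.+1%:R :> R by [].
  move: (j.+1%:R : R) => n n0; rewrite /L.
  have h1 : a + n <= (a + 1) * (n + 1) by nra.
  have h2 : a + n + 1 <= (a + 2) * (n + 1) by nra.
  have h3 : (a + n) * (a + n + 1) <= (a + 1) * (n + 1) * ((a + 2) * (n + 1)).
    by apply: ler_pM => //; lra.
  by rewrite expr2; lra.
suff : `|Phi (a + i%:R) (Y ^+ 2 / 4)| <= B i /\ `|Phi (a + i.+1%:R) (Y ^+ 2 / 4)| <= B i.+1 by case.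
elim: i => [|i [ih1 ih2]].
  rewrite addr0 /B (_ : 1`! = 1%N)// fact0 expr0 expr1 expr1n !mulr1; split.
    by apply: le_trans (hC _ Y1) _; rewrite ler_wpM2r// lerDl ltW.
  apply: le_trans (hC' _ Y1) _.
  apply: ler_pM => //; rewrite ?powR_ge0 ?(ltW C'0)//.
    by apply: (@le_trans _ _ D); [rewrite lerDr ltW|rewrite ler_peMr].
  by rewrite ler_powR//; lra.
split => //.
have ai : 0 < a + i.+1%:R by rewrite ltr_wpDr.
have := Phi_contig (Y ^+ 2 / 4) ai.
rewrite -addrA natr1 (_ : a + i.+1%:R - 1 = a + i%:R); last by rewrite -natr1; ring.
(* Here Y >= 2 enters: since w >= 1, the factor w on the left of the recurrence may be dropped. *)
set w := Y ^+ 2 / 4; have w1 : 1 <= w by rewrite /w; nra.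
move=> E; apply: le_trans (BS i).
apply: (@le_trans _ _ (w * `|Phi (a + i.+2%:R) w|)); first by rewrite ler_peMl.
rewrite -[w in w * _]ger0_norm; last by lra.
rewrite -normrM E normrM ger0_norm; last by rewrite mulr_ge0// ?addr_ge0// ltW.
rewrite -[a + i.+1%:R + 1]addrA natr1.
rewrite ler_wpM2l//; first by rewrite mulr_ge0// ?addr_ge0// ltW.
by apply: le_trans (ler_normB _ _) _; rewrite lerD.
Qed.

(** As nu + 1 > 1/2, each factor nu + 1 + i of the Pochhammer symbol is at least (i + 1) / 2. The
    denominator (k!)^2 is what offsets the growth in the order. *)
Lemma bcoef_fact_le (nu : R) k : - 1 / 2 < nu -> `|bcoef nu k| <= 2 ^+ k / (k`!%:R) ^+ 2.
Proof.
move=> hnu; have f0 j : 0 < j`!%:R :> R by rewrite ltr0n fact_gt0.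
have pk : k`!%:R / 2 ^+ k <= poch (nu + 1) k.
  elim: k => [|k ih]; first by rewrite fact0 expr0 divr1 /poch big_ord0.
  rewrite pochS factS natrM exprS.
  have -> : k.+1%:R * k`!%:R / (2 * 2 ^+ k) = k`!%:R / 2 ^+ k * (k.+1%:R / 2) :> R.
    by field; rewrite expf_neq0.
  apply: ler_pM => //; rewrite ?divr_ge0 ?exprn_ge0//.
  by rewrite -natr1; have : 0 <= k%:R :> R by []; lra.
have p0 : 0 < poch (nu + 1) k by apply: poch_gt0; lra.
have fk := f0 k.
rewrite /bcoef normrM normrX normrN1 expr1n mul1r ger0_norm; last by rewrite invr_ge0 mulr_ge0 ?ltW.
have -> : 2 ^+ k / k`!%:R ^+ 2 = (k`!%:R * (k`!%:R / 2 ^+ k))^-1 :> R.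
  by field; rewrite (gt_eqF fk) expf_neq0.
rewrite lef_pV2 ?posrE ?mulr_gt0 ?divr_gt0 ?exprn_gt0//.
by rewrite ler_pM2l.
Qed.

Lemma geom_le (q : R) n : 0 <= q <= 1 / 2 -> \sum_(i < n) q ^+ i.+1 <= 2 * q.
Proof.
move=> /andP[q0 q1].
suff : \sum_(i < n) q ^+ i.+1 <= 2 * q - 2 * q ^+ n.+1.
  by move=> /le_trans; apply; rewrite gerBl mulr_ge0// exprn_ge0.
elim: n => [|n ih]; first by rewrite big_ord0 expr1 subrr.
rewrite big_ord_recr /=; apply: le_trans (lerD ih (lexx _)) _.
have qn : 0 <= q ^+ n.+1 by rewrite exprn_ge0.
by rewrite [q ^+ n.+2]exprS; nra.
Qed.

End order_growth.

Section kernel_integral.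
Context {R : realType}.
Variable nu : R.
Hypothesis hnu : - 1 / 2 < nu.
Implicit Types (d w t z : R).

Let nu1 : 0 < nu + 1. Proof. by move: hnu; lra. Qed.

Let Ik d k w : R := int01 (fun t => wt nu d t * (t ^+ 2) ^+ k * Phi nu (t ^+ 2 * w)).

Let cts_Ik d k w : 0 < d -> continuous (fun t => wt nu d t * (t ^+ 2) ^+ k * Phi nu (t ^+ 2 * w)).
Proof.
by move=> d0; apply: ctsM; [exact: cts_beta|exact: cts_Phi_sqr].
Qed.

(** Writing t^2 = 1 - (1 - t^2) trades a power of t^2 for an increase of d by one. After k steps
    only Sonine integrals remain, at most 2^k of them, so the decay in Y survives; a bound on the
    integrand would lose it. *)
Let Ik_rec d k w : 0 < d -> Ik d k.+1 w = Ik d k w - Ik (d + 1) k w.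
Proof.
move=> d0; rewrite /Ik -int01B; [|exact: cts_Ik|by apply: cts_Ik; rewrite addr_gt0].
by congr int01; apply/funext => t; rewrite wtS// exprS; ring.
Qed.

Let Ik_bound d : 0 < d -> exists C L, [/\ 0 < C, 1 <= L &
  forall k i Y, 2 <= Y -> `|Ik (d + i%:R) k (Y ^+ 2 / 4)| <=
    C * 2 ^+ k * L ^+ (k + i) * ((k + i)`!%:R) ^+ 2 * Y `^ (- (nu + d + 3 / 2))].
Proof.
move=> d0; have a0 : 0 < nu + d + 1 by move: nu1; lra.
have [D [L [D0 L1 hD]]] := Phi_order_growth a0.
have b0 := beta_gt0 hnu d0.
exists (beta nu d 0 * D), L; split => //; first exact: mulr_gt0.
move=> k i Y Y2; have di j : 0 < d + j%:R by rewrite ltr_wpDr.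
have -> : nu + d + 3 / 2 = nu + d + 1 + 1 / 2 by field.
elim: k i => [|k ih] i.
  have -> : Ik (d + i%:R) 0 (Y ^+ 2 / 4) = beta nu (d + i%:R) 0 * Phi (nu + d + 1 + i%:R) (Y ^+ 2 / 4).
    rewrite (_ : nu + d + 1 + i%:R = nu + (d + i%:R) + 1); last by ring.
    by rewrite -sonine// /Ik; congr int01; apply/funext => t; rewrite expr0 mulr1.
  rewrite add0n; set N := Y `^ _.
  have -> : beta nu d 0 * D * 2 ^+ 0 * L ^+ i * i`!%:R ^+ 2 * N =
    beta nu d 0 * (D * L ^+ i * i`!%:R ^+ 2 * N) by ring.
  rewrite normrM; apply: ler_pM => //; last exact: hD.
  by rewrite ger0_norm ?beta_ge0//; exact: beta_le.
rewrite Ik_rec// (_ : d + i%:R + 1 = d + i.+1%:R); last by rewrite -natr1 addrA.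
apply: le_trans (ler_normB _ _) _.
apply: le_trans (lerD (ih i) (ih i.+1)) _.
rewrite addnS addSn; set m := (k + i)%N; set N := Y `^ _.
have N0 : 0 <= N by exact: powR_ge0.
set A := beta nu d 0 * D * 2 ^+ k.
have A0 : 0 <= A by rewrite !mulr_ge0 ?exprn_ge0 ?ltW.
have h : A * L ^+ m * m`!%:R ^+ 2 * N <= A * L ^+ m.+1 * (m.+1)`!%:R ^+ 2 * N.
  rewrite ler_wpM2r//; apply: ler_pM; rewrite ?mulr_ge0 ?exprn_ge0 ?sqr_ge0//; try lra.
    by rewrite ler_wpM2l// exprS ler_peMl// exprn_ge0//; lra.
  by rewrite lerXn2r ?nnegrE// ler_nat factS leq_pmull.
rewrite (exprS 2 k) [_ * (2 * 2 ^+ k)]mulrCA -/A; lra.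
Qed.

(** The continuum limit of the kernel, with z = (r x)^2 / 4 and w = (r y)^2 / 4. At z = 0 it is
    Sonine's integral. *)
Definition Sint d z w : R := int01 (fun t => wt nu d t * Phi nu (t ^+ 2 * z) * Phi nu (t ^+ 2 * w)).

Lemma cts_Sint d z w : 0 < d ->
  continuous (fun t => wt nu d t * Phi nu (t ^+ 2 * z) * Phi nu (t ^+ 2 * w)).
Proof.
move=> d0; apply: ctsM; last exact: cts_Phi_sqr.
by apply: ctsM; [exact: cts_wt|exact: cts_Phi_sqr].
Qed.

Let Sint_series d z w : 0 < d -> 0 <= w ->
  \sum_(k < n) bcoef nu k * z ^+ k * Ik d k w @[n --> \oo] --> Sint d z w.
Proof.
move=> d0 w0; have [rho rho0 hrho] := Phi_remainder z nu1.
have [M M0 hM] := Phi_bounded nu1 (ltW hnu).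
pose f i t := bcoef nu i * z ^+ i * (wt nu d t * (t ^+ 2) ^+ i * Phi nu (t ^+ 2 * w)).
have cf i : continuous (f i) by apply: ctsM; [exact: ctsC|exact: cts_Ik].
have SE n : \sum_(k < n) bcoef nu k * z ^+ k * Ik d k w = int01 (fun t => \sum_(i < n) f i t).
  rewrite int01_sum//; apply: eq_bigr => i _; rewrite /f int01Z//; exact: cts_Ik.
under eq_fun do rewrite SE.
have cb : continuous (fun t => M * (wt nu d t * (t ^+ 2) ^+ 0)).
  by apply: ctsM; [exact: ctsC|exact: cts_beta].
have IS n : `|Sint d z w - int01 (fun t => \sum_(i < n) f i t)| <= rho n * (M * beta nu d 0).
  rewrite /Sint -int01B; [|exact: cts_Sint|exact: cts_sum].
  rewrite /beta -int01Z -?int01Z//; last exact: cts_beta.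
  apply: int01_norm_le => [||t /andP[t0 t1]].
  - by apply: ctsB; [exact: cts_Sint|exact: cts_sum].
  - by apply: ctsM; [exact: ctsC|exact: cb].
  have -> : wt nu d t * Phi nu (t ^+ 2 * z) * Phi nu (t ^+ 2 * w) - \sum_(i < n) f i t =
      (Phi nu (t ^+ 2 * z) - \sum_(i < n) bcoef nu i * z ^+ i * (t ^+ 2) ^+ i) *
      (Phi nu (t ^+ 2 * w) * wt nu d t).
    rewrite mulrBl; congr (_ - _); first by ring.
    by rewrite mulr_suml; apply: eq_bigr => i _; rewrite /f; ring.
  rewrite normrM; apply: ler_pM => //.
    by apply: hrho; rewrite sqr_ge0 expr_le1.
  rewrite normrM expr0 mulr1 (ger0_norm (wt_ge0 _ _ _)) ler_wpM2r ?wt_ge0// hM//.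
  by rewrite mulr_ge0// sqr_ge0.
apply/cvgrPdist_le => e e0.
have : rho n * (M * beta nu d 0) @[n --> \oo] --> 0 * (M * beta nu d 0).
  by apply: cvgM => //; exact: cvg_cst.
rewrite mul0r => /cvgrPdist_le /(_ e e0); apply: filterS => n.
rewrite sub0r normrN => hn; apply: le_trans (IS n) _; apply: le_trans hn; exact: ler_norm.
Qed.

Lemma Sint_main d : 0 < d -> exists C e, [/\ 0 < C, 0 < e &
  forall z Y, 0 <= z <= e -> 2 <= Y ->
    `|Sint d z (Y ^+ 2 / 4) - beta nu d 0 * Phi (nu + d + 1) (Y ^+ 2 / 4)| <=
      C * z * Y `^ (- (nu + d + 3 / 2))].
Proof.
move=> d0; have [C [L [C0 L1 hC]]] := Ik_bound d0.
(* The two factors (k!)^2 cancel and the k-th term is at most C N (4 L z)^k. For z <= 1 / (8 L) the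
   ratio is at most 1/2, so all terms after the first, which is the main term, add up to at most 8 C
   L z N. *)
exists (C * 8 * L), (8 * L)^-1; split; [by rewrite !mulr_gt0//; lra|by rewrite invr_gt0; lra|].
move=> z Y /andP[z0 ze] Y2; set w := Y ^+ 2 / 4; set N := Y `^ _.
have N0 : 0 <= N by exact: powR_ge0.
have w0 : 0 <= w by rewrite divr_ge0 ?sqr_ge0.
have q1 : 0 <= 4 * L * z <= 1 / 2.
  rewrite !mulr_ge0//=; [|lra].
  have : 8 * L * z <= 1 by rewrite -ler_pdivlMl ?mulr1//; lra.
  lra.
have T1 k : `|bcoef nu k * z ^+ k * Ik d k w| <= C * N * (4 * L * z) ^+ k.
  have := hC k 0 Y Y2; rewrite addr0 addn0 -/N -/w => hk.
  have f0 : 0 < k`!%:R :> R by rewrite ltr0n fact_gt0.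
  have zk : `|z ^+ k| = z ^+ k by rewrite ger0_norm// exprn_ge0.
  rewrite normrM [`|bcoef nu k * _|]normrM zk.
  apply: le_trans (ler_pM _ _ (ler_wpM2r _ (bcoef_fact_le k hnu)) hk) _;
    rewrite ?mulr_ge0 ?exprn_ge0//.
  rewrite le_eqVlt; apply/orP; left; apply/eqP.
  have -> : (4 : R) = 2 * 2 by ring.
  by rewrite !exprMn; field; rewrite gt_eqF.
have := @Sint_series d z w d0 w0; rewrite -(cvg_shiftS _) /= => Sc.
have I0 : Ik d 0 w = beta nu d 0 * Phi (nu + d + 1) w.
  by rewrite -sonine// /Ik; congr int01; apply/funext => t; rewrite expr0 mulr1.
rewrite -I0.
have l1 : `|\sum_(k < n.+1) bcoef nu k * z ^+ k * Ik d k w - Ik d 0 w| @[n --> \oo] -->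
    `|Sint d z w - Ik d 0 w|.
  by apply: cvg_norm; apply: cvgB; [exact: Sc|exact: cvg_cst].
apply: (cvgr_to_le l1); apply: nearW => n.
rewrite big_ord_recl /= expr0 mulr1 {1}/bcoef /poch big_ord0 fact0 expr0 mulr1 divr1 mul1r.
rewrite addrAC subrr add0r; apply: le_trans (ler_norm_sum _ _ _) _.
apply: le_trans (ler_sum _ (fun i _ => T1 (lift ord0 i))) _.
rewrite -mulr_sumr.
have := geom_le n q1; have : 0 <= C * N by rewrite mulr_ge0// ltW.
move=> h1 /(ler_wpM2l h1) /le_trans; apply; rewrite le_eqVlt; apply/orP; left; apply/eqP; ring.
Qed.

End kernel_integral.

(** * The kernel as a Riemann sum *)

Section kernel_sum.
Context {R : realType}.
Variables (nu d : R) (s : nat -> R).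
Implicit Types (x y z w r : R).
Hypothesis hnu : - 1 / 2 < nu.
Hypothesis d0 : 0 < d.
Hypothesis s_gt0 : forall j, 0 < s j.
Hypothesis s_incr : forall j, s j < s j.+1.
Hypothesis s_zero : forall j, bu nu (s j) = 0.
Hypothesis s_all : forall x, 0 < x -> bu nu x = 0 -> exists j, s j = x.

Let nu1 : 0 < nu + 1. Proof. by move: hnu; lra. Qed.
Let p0 : 0 < 2 * nu + 1. Proof. by move: hnu; lra. Qed.

Lemma zeros_next : exists2 G, 0 < G & forall r, 0 < r -> exists n,
  [/\ r <= s n, s n <= r + G & forall j, (j < n)%N -> s j < r].
Proof.
have [G G0 hG] := zeros_gap_le nu1 s_gt0 s_incr s_zero s_all.
(* The summand s_0 is for the case where already the first zero is at least r. *)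
exists (G + s 0) => [|r r0]; first by rewrite addr_gt0.
have ex : exists n, r <= s n by exact: zeros_unbounded nu1 s_gt0 s_incr s_zero s_all r.
have := ex_minnP ex; case=> n rn nmin; exists n.
have lt j : (j < n)%N -> s j < r.
  by move=> jn; rewrite ltNge; apply/negP => /nmin; rewrite leqNgt jn.
split => //; case: n {rn nmin} lt => [|n] lt; first by have := s_gt0 0; lra.
by have := lt n (ltnSn n); have := hG n; have := s_gt0 0; lra.
Qed.

Let Q z w t : R := wt nu d t * Phi nu (t ^+ 2 * z) * Phi nu (t ^+ 2 * w).

Let Q_sum_int T : 1 <= T -> exists2 C, 0 < C & forall (t : nat -> R) n h z w,
  0 <= t 0 -> (forall j, t j <= t j.+1) -> (forall j, t j.+1 - t j <= h) ->
  1 <= t n <= T -> 0 <= z <= 1 -> 1 <= w ->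
  `|Sint nu d z w - \sum_(j < n) (t j.+1 - t j) * Q z w (t j)| <= C * w * (t 0 + h) /\
  forall x, 0 <= x <= T -> `|Q z w x| <= C.
Proof.
move=> T1; have [M M0 hM] := Phi_bounded nu1 (ltW hnu).
have nu2 : 0 < nu + 1 + 1 by rewrite addr_gt0.
have [M1 M10 hM1] : exists2 C : R, 0 < C & forall w, 0 <= w -> `|Phi (nu + 1) w| / (nu + 1) <= C.
  have [|C C0 hC] := Phi_bounded nu2; first by move: hnu; lra.
  exists (C / (nu + 1)) => [|w w0]; first by rewrite divr_gt0.
  by rewrite ler_wpM2r ?invr_ge0 ?(ltW nu1)// hC.
pose A : R := ppow (2 * nu + 1) T; have A0 : 0 <= A by exact: ppow_ge0.
have T0 : 0 <= T by lra.
have a_le x : 0 <= x <= T -> 0 <= ppow (2 * nu + 1) x <= A.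
  by move=> /andP[x0 xT]; rewrite ppow_ge0 /= ppow_mono// ltW.
have b_le x : 0 <= ppow d (1 - x ^+ 2) <= 1.
  have e1 : ppow d (1 : R) = 1 by rewrite ppowE// powR1.
  rewrite ppow_ge0 /= -[leRHS]e1 ppow_mono ?(ltW d0)//.
  by rewrite gerBl sqr_ge0.
have f_le x z : 0 <= z -> `|Phi nu (x ^+ 2 * z)| <= M.
  by move=> z0; apply: hM; rewrite mulr_ge0// sqr_ge0.
have f_lip x y z : 0 <= z -> 0 <= x -> x <= y -> y <= T ->
    `|Phi nu (y ^+ 2 * z) - Phi nu (x ^+ 2 * z)| <= 2 * T * M1 * z * (y - x).
  move=> z0 x0 xy yT.
  apply: (@der_lipschitz _ (fun t => Phi nu (t ^+ 2 * z))
    (fun t => - Phi (nu + 1) (t ^+ 2 * z) / (nu + 1) * (2 * t * z)) _ _ _ xy) => t /andP[xt ty].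
    apply: der_eq (der_comp (is_derive_Phi _ nu1) (derM (derX 2 (derI t)) (derC t z))) _.
    by rewrite /= expr1; ring.
  have t0 : 0 <= t by exact: le_trans xt.
  rewrite normrM [`|_ / _|]normrM normrN (ger0_norm (x := 2 * t * z)) ?mulr_ge0//.
  rewrite (ger0_norm (x := (nu + 1)^-1)) ?invr_ge0 ?(ltW nu1)//.
  have h1 : `|Phi (nu + 1) (t ^+ 2 * z)| / (nu + 1) <= M1.
    by apply: hM1; rewrite mulr_ge0// sqr_ge0.
  have h2 : 2 * t * z <= 2 * T * z by rewrite ler_wpM2r// ler_wpM2l// (le_trans ty).
  have -> : 2 * T * M1 * z = M1 * (2 * T * z) by ring.
  by apply: ler_pM => //; rewrite ?mulr_ge0 ?invr_ge0 ?(ltW nu1).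
have QB z w x : 0 <= z -> 0 <= w -> 0 <= x <= T -> `|Q z w x| <= A * M * M.
  move=> z0 w0 xT; rewrite /Q normrM [`|_ * Phi nu (_ * z)|]normrM (ger0_norm (wt_ge0 _ _ _)).
  have /andP[a0 aA] := a_le _ xT; have /andP[b0 b1] := b_le x.
  have wA : wt nu d x <= A by rewrite /wt -[A]mulr1; exact: ler_pM.
  apply: (ler_pM (mulr_ge0 (wt_ge0 _ _ _) (normr_ge0 _)) (normr_ge0 _) _ (f_le _ _ w0)).
  exact: (ler_pM (wt_ge0 _ _ _) (normr_ge0 _) wA (f_le _ _ z0)).
(* The power of t increases and the power of 1 - t^2 decreases, so their variations are differences
   of end values, whatever their regularity. The last term comes from the Lipschitz constants 2 T M1
   z and 2 T M1 w of the two [Phi] factors; it is the source of the factor w in the error. *)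
pose V z w t : R := M * M * ppow (2 * nu + 1) t - A * (M * M) * ppow d (1 - t ^+ 2) +
   A * M * (2 * T * M1 * (z + w)) * t.
have QV z w x y : 0 <= z -> 0 <= w -> 0 <= x -> x <= y -> y <= T ->
    `|Q z w x - Q z w y| <= V z w y - V z w x.
  move=> z0 w0 x0 xy yT.
  have xT : x <= T by exact: le_trans yT.
  have y0 : 0 <= y by exact: le_trans xy.
  have /andP[ax0 axA] : 0 <= ppow (2 * nu + 1) x <= A by rewrite a_le// x0.
  have /andP[ay0 ayA] : 0 <= ppow (2 * nu + 1) y <= A by rewrite a_le// y0.
  have axy : ppow (2 * nu + 1) x <= ppow (2 * nu + 1) y by rewrite ppow_mono// ltW.
  have byx : ppow d (1 - y ^+ 2) <= ppow d (1 - x ^+ 2).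
    by rewrite ppow_mono ?(ltW d0)// lerB// lerXn2r.
  have /andP[bx0 bx1] := b_le x; have /andP[by0 by1] := b_le y.
  have fx := f_le x z z0; have fy := f_le y z z0.
  have gx := f_le x w w0; have gy := f_le y w w0.
  have hf := f_lip x y z z0 x0 xy yT; have hg := f_lip x y w w0 x0 xy yT.
  rewrite /Q /V /wt.
  move: (ppow _ x) (ppow _ y) (ppow d (1 - x ^+ 2)) (ppow d (1 - y ^+ 2)) (Phi nu (x ^+ 2 * z)) (Phi nu (y ^+ 2 * z))
    (Phi nu (x ^+ 2 * w)) (Phi nu (y ^+ 2 * w)) ax0 axA ay0 ayA axy bx0 bx1 by0 by1 byx fx fy gx gy hf hg.
  move=> a a' b b' f f' g g' a0 aA a'0 a'A aa' b0 b1 b'0 b'1 bb' fM f'M gM g'M hf hg.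
  have -> : a * b * f * g - a' * b' * f' * g' = (a - a') * (b * (f * g)) + a' * ((b - b') * (f * g)) +
    a' * b' * ((f - f') * g + f' * (g - g')) by ring.
  have fg : `|f * g| <= M * M by rewrite normrM ler_pM.
  have t1 : `|(a - a') * (b * (f * g))| <= (a' - a) * (M * M).
    rewrite normrM (distrC a a') (ger0_norm (x := a' - a)) ?subr_ge0//.
    apply: ler_wpM2l; first by rewrite subr_ge0.
    rewrite normrM (ger0_norm b0) -[leRHS]mul1r; apply: ler_pM => //.
  have t2 : `|a' * ((b - b') * (f * g))| <= A * ((b - b') * (M * M)).
    rewrite !normrM (ger0_norm a'0) (ger0_norm (x := b - b')) ?subr_ge0// -normrM.
    apply: ler_pM => //; first by rewrite mulr_ge0// subr_ge0.
    by apply: ler_wpM2l => //; rewrite subr_ge0.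
  have t3 : `|a' * b' * ((f - f') * g + f' * (g - g'))| <=
      A * (2 * T * M1 * z * (y - x) * M + M * (2 * T * M1 * w * (y - x))).
    rewrite normrM; apply: ler_pM => //.
      by rewrite ger0_norm ?mulr_ge0// -[A]mulr1 ler_pM.
    apply: le_trans (ler_normD _ _) _; rewrite !normrM; apply: lerD.
      by apply: ler_pM => //; rewrite distrC.
    by apply: ler_pM => //; rewrite distrC.
  apply: le_trans (ler_normD _ _) _; apply: le_trans (lerD (ler_normD _ _) t3) _.
  apply: le_trans (lerD (lerD t1 t2) (lexx _)) _.
  by rewrite le_eqVlt; apply/orP; left; apply/eqP; ring.
have [B BE] : exists B, B = A * M * M by exists (A * M * M).
have B0 : 0 <= B by rewrite BE !mulr_ge0// ltW.
pose C2 := 2 * B + A * M * (2 * T * M1 * 2) * T.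
have M0' := ltW M0; have M10' := ltW M10.
have C20 : 0 <= C2.
  by apply: addr_ge0; [lra|rewrite !mulr_ge0].
exists (B + C2 + 1) => [|t n h z w t00 tS th /andP[tn1 tnT] /andP[z0 z1] w1].
  by rewrite ltr_wpDl// addr_ge0.
have w0 : 0 <= w by lra.
split; last by move=> x hx; apply: le_trans (QB z w x z0 w0 hx) _; rewrite -BE; lra.
have cQ : continuous (Q z w) by exact: cts_Sint.
have dP x : 0 <= x <= t n -> is_derive x 1 (prim (Q z w)) (Q z w x).
  by move=> /andP[x0 _]; apply: is_derive_prim => //; lra.
have := riemann_sum t00 tS th dP (B := B) (V := V z w).
have h0 : 0 <= h by apply: le_trans (th 0); rewrite subr_ge0.
(* Beyond 1 the weight vanishes, so overshooting to t_n >= 1 still gives the integral over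
   [0, 1]. *)
have P1 : prim (Q z w) (t n) = prim (Q z w) 1.
  apply/eqP; rewrite -subr_eq0 -normr_le0 -[leRHS](mul0r (t n - 1)).
  apply: (@der_lipschitz _ _ (Q z w) _ _ 0 tn1) => x /andP[x1 xt].
    by apply: dP; rewrite xt andbT; lra.
  rewrite /Q /wt [ppow d _]ppow0// ?mulr0 ?mul0r ?normr0//.
  by rewrite subr_le0 expr_ge1//; lra.
rewrite P1 -/(int01 _) -/(Sint nu d z w) => /(_ _ _)/le_trans; apply.
- by move=> x /andP[x0 xt]; rewrite BE; apply: QB => //; rewrite x0 (le_trans xt).
- by move=> x y x0 xy yt; apply: QV => //; exact: le_trans tnT.
have t0n : t 0 <= t n.
  by apply: (@homo_leq _ t (fun x y => x <= y)) => //; [move=> ? ? ?; exact: le_trans].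
have VV : V z w (t n) - V z w (t 0) <= C2 * w.
  rewrite /V.
  have /andP[a0 aA] : 0 <= ppow (2 * nu + 1) (t 0) <= A by rewrite a_le// t00 (le_trans t0n).
  have /andP[a'0 a'A] : 0 <= ppow (2 * nu + 1) (t n) <= A by rewrite a_le// (le_trans t00 t0n).
  have /andP[b0 b1] := b_le (t 0); have /andP[b'0 b'1] := b_le (t n).
  have MM : 0 <= M * M by rewrite mulr_ge0.
  have u1 : M * M * ppow (2 * nu + 1) (t n) - M * M * ppow (2 * nu + 1) (t 0) <= B.
    rewrite -mulrBr BE -mulrA [A * _]mulrC ler_wpM2l//; lra.
  have u2 : A * (M * M) * ppow d (1 - t 0 ^+ 2) - A * (M * M) * ppow d (1 - t n ^+ 2) <= B.
    rewrite -mulrBr BE -[A * M * M]mulr1 -[A * M * M]mulrA ler_wpM2l ?mulr_ge0//; lra.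
  have u3 : A * M * (2 * T * M1 * (z + w)) * t n - A * M * (2 * T * M1 * (z + w)) * t 0 <=
      A * M * (2 * T * M1 * 2) * T * w.
    rewrite -mulrBr.
    have -> : A * M * (2 * T * M1 * 2) * T * w = A * M * (2 * T * M1 * (w + w)) * T by ring.
    apply: ler_pM; rewrite ?mulr_ge0 ?subr_ge0 ?addr_ge0//; last by lra.
    by rewrite ler_wpM2l ?mulr_ge0// ler_wpM2l ?mulr_ge0//; lra.
  have : 2 * B <= 2 * B * w by rewrite ler_peMr// mulr_ge0.
  rewrite /C2; lra.
apply: (@le_trans _ _ (t 0 * B + h * (C2 * w))); first by rewrite lerD2l ler_wpM2l.
have e1 : t 0 * B <= B * w * t 0 by rewrite mulrC ler_wpM2r// ler_peMr.
have e2 : 0 <= (C2 + 1) * w * t 0 by rewrite !mulr_ge0// addr_ge0.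
have e3 : 0 <= (B + 1) * w * h by rewrite !mulr_ge0// addr_ge0.
lra.
Qed.

(** Two errors add up. Replacing 1 / E(s_j) by lam times the gap costs the sum of the 1 / s_j, hence
    sqrt r; the Riemann sum has mesh of order 1 / r and variation of order w, and multiplication by
    r leaves w. *)
Lemma kernel_sum_int : exists G lam C, [/\ 0 < G, 0 < lam, 0 < C &
  forall r, 1 <= r -> exists n,
   [/\ r <= s n, s n <= r + G & forall z w, 0 <= z <= 1 -> 1 <= w ->
   `|\sum_(j < n) (bE nu (s j))^-1 * (wt nu d (s j / r) * Phi nu ((s j / r) ^+ 2 * z) *
       Phi nu ((s j / r) ^+ 2 * w)) - lam * r * Sint nu d z w| <= C * (Num.sqrt r + w)]].
Proof.
have [G G0 hG] := zeros_next.
have [h h0 hh] := zeros_gap_le nu1 s_gt0 s_incr s_zero s_all.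
have [lam [Cw [lam0 Cw0 hw]]] := zeros_weight nu1 s_gt0 s_incr s_zero s_all.
have [Ci Ci0 hi] := zeros_inv_sum nu1 s_gt0 s_incr s_zero s_all.
have T1 : 1 <= 1 + G by lra.
have [CQ CQ0 hQ] := Q_sum_int T1.
have s0 := s_gt0 0.
exists G, lam, (lam * (CQ * (s 0 + h)) + Cw * CQ * (Ci * (1 + G))); split => //.
  by rewrite addr_gt0// !mulr_gt0// addr_gt0.
move=> r r1; have r0 : 0 < r by lra.
have [n [rn nr _]] := hG r r0; exists n; split => // z w z01 w1.
have [|||| hS hB] := hQ (fun j => s j / r) n (h / r) z w _ _ _ _ z01 w1.
- by rewrite divr_ge0// ltW.
- by move=> j; rewrite ler_pM2r ?invr_gt0// ltW.
- by move=> j; rewrite -mulrBl ler_pM2r ?invr_gt0.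
- rewrite ler_pdivlMr// mul1r rn /= ler_pdivrMr//; apply: (le_trans nr).
  by rewrite mulrDl mul1r lerD2l ler_peMr// ltW.
pose Qj (j : nat) := Q z w (s j / r).
rewrite -/(Q z w _).
have E1 : \sum_(j < n) (s j.+1 / r - s j / r) * Q z w (s j / r) =
    r^-1 * \sum_(j < n) (s j.+1 - s j) * Qj j.
  by rewrite mulr_sumr; apply: eq_bigr => j _; rewrite /Qj; ring.
rewrite E1 in hS; move: (Sint nu d z w) hS => I hS.
have -> : \sum_(j < n) (bE nu (s j))^-1 * Q z w (s j / r) - lam * r * I =
   \sum_(j < n) ((bE nu (s j))^-1 - lam * (s j.+1 - s j)) * Qj j -
   lam * r * (I - r^-1 * \sum_(j < n) (s j.+1 - s j) * Qj j).
  rewrite mulrBr opprB addrA; congr (_ - _).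
  have -> : lam * r * (r^-1 * \sum_(j < n) (s j.+1 - s j) * Qj j) =
      \sum_(j < n) lam * (s j.+1 - s j) * Qj j.
    rewrite mulrA -[lam * r * r^-1]mulrA mulfV ?gt_eqF// mulr1 mulr_sumr.
    by apply: eq_bigr => j _; rewrite mulrA.
  rewrite -big_split /=; apply: eq_bigr => j _; rewrite -/(Qj j); ring.
apply: le_trans (ler_normB _ _) _.
have n1 : `|\sum_(j < n) ((bE nu (s j))^-1 - lam * (s j.+1 - s j)) * Qj j| <=
    Cw * CQ * (Ci * (1 + G)) * Num.sqrt r.
  apply: le_trans (ler_norm_sum _ _ _) _.
  apply: (@le_trans _ _ (\sum_(j < n) Cw * CQ * (s j)^-1)).
    apply: ler_sum => j _; rewrite normrM mulrAC; apply: ler_pM => //.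
    apply: hB; rewrite divr_ge0 ?(ltW (s_gt0 _)) ?(ltW r0)//=.
    apply: (@le_trans _ _ (s n / r)).
      rewrite ler_pM2r ?invr_gt0//.
      by apply: (zeros_mono s_incr); exact: ltnW.
    rewrite ler_pdivrMr//; apply: (le_trans nr).
    by rewrite mulrDl mul1r lerD2l ler_peMr// ltW.
  have -> : Cw * CQ * (Ci * (1 + G)) * Num.sqrt r = Cw * CQ * (Ci * ((1 + G) * Num.sqrt r)) by ring.
  rewrite -mulr_sumr; apply: ler_wpM2l; first by rewrite mulr_ge0// ltW.
  apply: le_trans (hi n) _; apply: ler_wpM2l; first exact: ltW.
  have -> : 1 + G = Num.sqrt ((1 + G) ^+ 2) by rewrite sqrtr_sqr ger0_norm// addr_ge0// ltW.
  rewrite -sqrtrM ?sqr_ge0// ler_sqrt; last by rewrite mulr_ge0 ?sqr_ge0// ltW.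
  by apply: (le_trans nr); nra.
have n2 : `|lam * r * (I - r^-1 * \sum_(j < n) (s j.+1 - s j) * Qj j)| <=
    lam * (CQ * (s 0 + h)) * w.
  rewrite normrM ger0_norm; last by rewrite mulr_ge0// ltW.
  apply: le_trans (ler_wpM2l _ hS) _; first by rewrite mulr_ge0// ltW.
  rewrite le_eqVlt; apply/orP; left; apply/eqP; field; rewrite gt_eqF//.
have q0 := sqrtr_ge0 r.
have m1 : 0 <= lam * (CQ * (s 0 + h)) * Num.sqrt r by rewrite !mulr_ge0// ?addr_ge0// ltW.
have m2 : 0 <= Cw * CQ * (Ci * (1 + G)) * w.
  by rewrite !mulr_ge0// ?addr_ge0//; lra.
lra.
Qed.

End kernel_sum.

(** * The Gamma function and the normalisation of the eigenfunctions *)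

Section gamma.
Context {R : realType}.
Implicit Types (a b x t : R).

Lemma ppow_exp_le b : 0 < b -> exists2 C : R, 0 < C &
  forall t, 0 <= t -> ppow b t * expR (- t) <= C * expR (- t / 2).
Proof.
move=> b0; pose m := (Num.truncn b).+1.
have bm : b <= m%:R by exact/ltW/truncnS_gt.
have f0 : 0 < m`!%:R :> R by rewrite ltr0n fact_gt0.
have C0 : 0 < 2 ^+ m * m`!%:R :> R by rewrite mulr_gt0// exprn_gt0.
exists (1 + 2 ^+ m * m`!%:R) => [|t t0]; first by rewrite addr_gt0.
have e0 : 1 <= expR (t / 2) by rewrite -expR0 ler_expR divr_ge0.
have em : t ^+ m <= 2 ^+ m * m`!%:R * expR (t / 2).
  have := expR_ge1Dxn (Num.truncn b) (divr_ge0 t0 (ler0n R 2)).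
  rewrite -/m => h; have : (t / 2) ^+ m / m`!%:R <= expR (t / 2) by lra.
  rewrite ler_pdivrMr// expr_div_n ler_pdivrMr ?exprn_gt0//.
  by rewrite -mulrA mulrC [m`!%:R * _]mulrC.
have pm : ppow b t <= 1 + t ^+ m.
  rewrite ppowE//; have [t1|t1] := leP t 1.
    rewrite (@le_trans _ _ 1) ?lerDl ?exprn_ge0//.
    have e1 : 1 `^ b = 1 :> R by rewrite powR1.
    by rewrite -e1; apply: ge0_ler_powR => //; rewrite ?nnegrE// ltW.
  by rewrite (@le_trans _ _ (t ^+ m)) ?lerDr// -powR_mulrn// ler_powR// ltW.
have -> : expR (- t) = expR (- t / 2) * expR (- t / 2) by rewrite -expRD; congr expR; field.
have e1 : expR (- t / 2) * expR (t / 2) = 1 by rewrite -expRD -[RHS]expR0; congr expR; field.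
rewrite mulrA ler_wpM2r ?expR_ge0//.
have e2 := expR_gt0 (- t / 2).
apply: (@le_trans _ _ ((1 + 2 ^+ m * m`!%:R) * expR (t / 2) * expR (- t / 2))).
  by rewrite ler_wpM2r ?expR_ge0//; lra.
by rewrite -mulrA [expR (t / 2) * _]mulrC e1 mulr1.
Qed.

Let g b t : R := ppow b t * expR (- t).

Let cts_g b : 0 < b -> continuous (g b).
Proof.
move=> b0; apply: ctsM; first exact: cts_ppow.
by move=> x; exact: der_cts (der_comp (is_derive_expR _) (derN (derI x))).
Qed.

Let cvg_expN2 : expR (- t / 2) @[t --> +oo] --> (0 : R).
Proof.
have := @cvgr_expR R; move=> /cvgrPdist_le h; apply/cvgrPdist_le => e e0.
have [M [_ hM]] := h _ e0; exists (2 * M); split; first exact: num_real.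
by move=> t Mt; rewrite mulNr; apply: hM; lra.
Qed.

Let cvg_g b : 0 < b -> g b t @[t --> +oo] --> 0.
Proof.
move=> b0; have [C C0 hC] := ppow_exp_le b0.
apply: (@squeeze_cvgr _ _ _ _ (fun=> 0) (fun t => C * expR (- t / 2))).
- apply: filterS (nbhs_pinfty_ge (num_real 0)) => t t0.
  by rewrite /g mulr_ge0 ?ppow_ge0 ?expR_ge0//= hC.
- exact: cvg_cst.
- by rewrite -[X in _ --> X](mulr0 C); apply: cvg_mull; exact: cvg_expN2.
Qed.

Let cvg_prim_g b : 0 < b -> exists2 L, 0 < L & prim (g b) t @[t --> +oo] --> prim (g b) 0 + L.
Proof.
move=> b0; have [C C0 hC] := ppow_exp_le b0.
pose P t := prim (g b) (Num.max t 0).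
have dg t : 0 <= t -> is_derive t 1 (prim (g b)) (g b t).
  by move=> t0; apply: is_derive_prim; [exact: cts_g|lra].
have g0 t : 0 <= g b t by rewrite mulr_ge0 ?ppow_ge0 ?expR_ge0.
have Pm : {homo prim (g b) : x y / 0 <= x /\ x <= y >-> x <= y}.
  move=> x y [x0 xy]; apply: (@der_ge0_le _ _ (g b) _ _ xy) => // t /andP[xt _].
  by apply: dg; exact: le_trans xt.
have mx t : 0 <= Num.max t 0 by rewrite le_max lexx orbT.
have Pn : nondecreasing_fun P.
  by move=> x y xy; apply: Pm; split => //; rewrite ge_max !le_max xy lexx orbT.
have Pub : has_ubound (range P).
  exists (prim (g b) 0 + 2 * C) => _ [t _ <-]; rewrite /P.
  (* As g <= C exp(-t / 2), this F is nonincreasing on t >= 0, which bounds the primitive by its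
     value at 0 plus 2 C. *)
  pose F t := prim (g b) t + 2 * C * expR (- t / 2).
  have : F (Num.max t 0) <= F 0.
    rewrite -lerN2.
    apply: (@der_ge0_le _ (fun t => - F t) (fun t => - (g b t + 2 * C * (expR (- t / 2) * (- 1 / 2)))) _ _ (mx t)).
      move=> x /andP[x0 _]; apply: derN; apply: derD; first exact: dg.
      apply: derZ; apply: der_comp; apply: der_eq (derM (derN (derI x)) (derC x 2^-1)) _.
      by rewrite mulr0 add0r mulN1r.
    move=> x /andP[x0 _]; have := hC x x0; rewrite -/(g b x); have := expR_gt0 (- x / 2); lra.
  rewrite /F oppr0 mul0r expR0.
  have : 0 <= 2 * C * expR (- Num.max t 0 / 2) by rewrite !mulr_ge0 ?expR_ge0// ltW.
  lra.
have Pc := nondecreasing_cvgr Pn Pub.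
exists (sup (range P) - prim (g b) 0).
  rewrite subr_gt0; apply: (@lt_le_trans _ _ (P 1)); last first.
    by apply: sup_upper_bound; [split => //; exists (P 1), 1|exists 1].
  rewrite /P max_l// -subr_gt0 -/(int01 _).
  apply: (@int01_gt0 _ _ ((1 / 2) `^ b * expR (- 1)) (1 / 2) 1); try lra.
  - exact: cts_g.
  - by rewrite mulr_gt0 ?expR_gt0 ?powR_gt0//; lra.
  - by move=> x _; exact: g0.
  - move=> x /andP[x1 x2]; apply: ler_pM; rewrite ?powR_ge0 ?expR_ge0//.
      by rewrite -ppowE; [apply: ppow_mono; [exact: ltW|lra]|lra].
    by rewrite ler_expR; lra.
rewrite addrC subrK; apply: cvg_trans Pc; apply: near_eq_cvg.
by apply: filterS (nbhs_pinfty_ge (num_real 0)) => t t0; rewrite /P max_l.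
Qed.

Let meas_g b : measurable_fun setT (fun t : R => t `^ b * expR (- t)).
Proof.
apply: measurable_funM; first exact: measurable_powR.
by apply: measurableT_comp => //; exact: measurable_oppr.
Qed.

(** [Gamma] is the finite part of an extended integral, so finiteness and positivity have to come
    with the functional equation. Both sides are computed to the same L > 0, the limit of the
    primitive of t^b exp(-t). *)
Lemma Gamma_mulr b : 0 < b -> exists2 L, 0 < L & Gamma (b + 1) = L /\ b * Gamma b = L.
Proof.
move=> b0; have [L L0 PL] := cvg_prim_g b0; exists L => //.
have dg t : 0 <= t -> is_derive t 1 (prim (g b)) (g b t).
  by move=> t0; apply: is_derive_prim; [exact: cts_g|lra].
have mE c A : measurable A -> measurable_fun A (fun t : R => (t `^ c * expR (- t))%:E).
  by move=> mA; apply/measurable_EFinP; exact: measurable_funTS (meas_g c).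
split.
  rewrite /Gamma /Rintegral integral_itv_obnd_cbnd; last exact: mE.
  have -> : (\int[lebesgue_measure]_(t in `[0%R, +oo[) (t `^ (b + 1 - 1) * expR (- t))%:E =
      \int[lebesgue_measure]_(t in `[0%R, +oo[) (g b t)%:E)%E.
    apply: eq_integral => t; rewrite inE /= in_itv /= andbT => t0.
    by rewrite addrK /g ppowE.
  rewrite (@ge0_continuous_FTC2y _ _ (prim (g b)) 0 (prim (g b) 0 + L)).
  - by rewrite -EFinB /= addrC addKr.
  - by move=> x _; rewrite mulr_ge0 ?ppow_ge0 ?expR_ge0.
  - by apply: continuous_subspaceT; exact: cts_g.
  - exact: PL.
  - by move=> x x0; have [] := dg x (ltW x0).
  - by apply: cvg_at_right_filter; exact: der_cts (dg 0 (lexx _)).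
  - move=> x; rewrite in_itv /= andbT => x0.
    by rewrite derive1E; have [_ ->] := dg x (ltW x0).
pose f t : R := b * (t `^ (b - 1) * expR (- t)).
pose H t := g b t + prim (g b) t.
have dH t : 0 < t -> is_derive t 1 H (f t).
  move=> t0.
  have d1 := der_comp (is_derive_expR _) (derN (derI t)).
  have d2 := derD (derM (der_powR b t0) d1) (dg t (ltW t0)).
  have d3 : is_derive t 1 (fun t => t `^ b * expR (- t) + prim (g b) t) (f t).
    apply: der_eq d2 _; rewrite /g ppowE ?(ltW t0)// /f powRB ?(gt_eqF t0) ?implybT//.
    by rewrite powRr1 ?(ltW t0)//; field; rewrite gt_eqF.
  apply: (@near_eq_is_derive _ R R _ _ t 1 _ _ d3).
  by near=> z; rewrite /H /g ppowE//; apply/ltW; near: z; exact: lt_nbhsr.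
have f0 t : 0 <= f t by rewrite /f !mulr_ge0 ?powR_ge0 ?expR_ge0// ltW.
(* The integrand of Gamma(b) is singular at 0 when b < 1; the antiderivative H is therefore used on
   half-lines that exhaust ]0, oo[. *)
pose I n := `[n.+1%:R^-1, +oo[%classic : set R.
have II : \bigcup_n I n = `]0, +oo[%classic.
  apply/seteqP; split => x /=.
    move=> [n _]; rewrite /I /= !in_itv /= !andbT; apply: lt_le_trans.
    by rewrite invr_gt0.
  rewrite in_itv /= andbT => x0; exists (Num.truncn x^-1) => //.
  rewrite /I /= in_itv /= andbT -[leRHS]invrK lef_pV2 ?posrE ?invr_gt0//.
  exact/ltW/truncnS_gt.
have mf A : measurable A -> measurable_fun A (fun t => (f t)%:E).
  move=> mA; apply/measurable_EFinP; apply: measurable_funTS.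
  by apply: measurable_funM => //; exact: meas_g.
have cI : (\int[lebesgue_measure]_(x in I n) (f x)%:E @[n --> \oo] -->
    \int[lebesgue_measure]_(x in `]0%R, +oo[) (f x)%:E)%E.
  rewrite -II; apply: ge0_nondecreasing_set_cvg_integral.
  - apply/nondecreasing_seqP => n; rewrite subsetEset => x.
    rewrite /I /= !in_itv /= !andbT; apply: le_trans.
    by rewrite lef_pV2 ?posrE// ler_nat.
  - by move=> n; exact: measurable_itv.
  - by move=> n; apply: mf; exact: measurable_itv.
  - by move=> n x _; rewrite lee_fin.
have IE n : (\int[lebesgue_measure]_(x in I n) (f x)%:E = (prim (g b) 0 + L - H n.+1%:R^-1)%:E)%E.
  have i0 : 0 < n.+1%:R^-1 :> R by rewrite invr_gt0.
  rewrite (@ge0_continuous_FTC2y _ _ H _ (prim (g b) 0 + L)) //.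
  - apply: continuous_in_subspaceT => x; rewrite inE /= in_itv /= andbT => ix.
    have x0 : 0 < x by exact: lt_le_trans ix.
    apply: cvgM; first exact: cvg_cst.
    apply: cvgM; first exact: der_cts (der_powR _ x0).
    exact: der_cts (der_comp (is_derive_expR _) (derN (derI x))).
  - by rewrite -[X in _ --> X]add0r; apply: cvgD; [exact: cvg_g|exact: PL].
  - by move=> x ix; have [] := dH x (lt_trans i0 ix).
  - by apply: cvg_at_right_filter; exact: der_cts (dH _ i0).
  - move=> x; rewrite in_itv /= andbT => ix.
    by rewrite derive1E; have [_ ->] := dH x (lt_trans i0 ix).
have H0 : H n.+1%:R^-1 @[n --> \oo] --> prim (g b) 0.
  have -> : prim (g b) 0 = H 0 by rewrite /H /g ppow0// mul0r add0r.
  have cH : {for 0, continuous H}.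
    apply: cvgD; first exact: cts_g.
    exact: der_cts (dg 0 (lexx _)).
  by apply: (@cvg_comp _ _ _ (fun n => n.+1%:R^-1) H _ (nbhs (0 : R)) _ _ cH); exact: cvg_harmonic.
have cL : (\int[lebesgue_measure]_(x in I n) (f x)%:E @[n --> \oo] --> L%:E)%E.
  under eq_fun do rewrite IE.
  apply/cvg_EFin; first exact: nearW.
  have c1 : prim (g b) 0 + L - H n.+1%:R^-1 @[n --> \oo] --> prim (g b) 0 + L - prim (g b) 0.
    by apply: cvgB => //; exact: cvg_cst.
  by rewrite addrAC subrr add0r in c1.
have fL : (\int[lebesgue_measure]_(x in `]0%R, +oo[) (f x)%:E = L%:E)%E.
  by rewrite -(cvg_lim _ cI)// (cvg_lim _ cL).
move: fL; under eq_integral do rewrite EFinM.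
rewrite ge0_integralZl//=; [|exact: mE|..].
(* An infinite integral is impossible, as its product with b > 0 is the finite L. *)
- rewrite /Gamma /Rintegral; case: (integral _ _ _) => [r| |] //.
  + by rewrite -EFinM => -[->].
  + by rewrite gt0_muley.
  + by rewrite gt0_muleNy.
- by move=> x _; rewrite lee_fin mulr_ge0 ?powR_ge0 ?expR_ge0.
- by rewrite lee_fin ltW.
Unshelve. all: by end_near.
Qed.
End gamma.

Section besselJ_Phi.
Context {R : realType}.
Implicit Types (a b x nu : R).

Lemma Gamma_gt0 b : 0 < b -> 0 < Gamma b.
Proof. by move=> b0; have [L L0 [_ bL]] := Gamma_mulr b0; rewrite -(pmulr_rgt0 _ b0) bL. Qed.

Lemma GammaS b : 0 < b -> Gamma (b + 1) = b * Gamma b.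
Proof. by move=> b0; have [L L0 [-> ->]] := Gamma_mulr b0. Qed.

Lemma Gamma_poch b k : 0 < b -> Gamma (k%:R + b) = poch b k * Gamma b.
Proof.
move=> b0; elim: k => [|k ih]; first by rewrite add0r /poch big_ord0 mul1r.
have bk : 0 < k%:R + b by rewrite ltr_wpDl.
by rewrite -natr1 -addrA [1 + b]addrC addrA GammaS// ih pochS mulrCA mulrA [k%:R + b]addrC.
Qed.

Lemma besselJE nu x : 0 < nu + 1 -> 0 < x ->
  besselJ nu x = (x / 2) `^ nu / Gamma (nu + 1) * Phi nu (x ^+ 2 / 4).
Proof.
move=> n1 x0; rewrite /besselJ; apply/cvg_lim => //.
have x2 : 0 < x / 2 by rewrite divr_gt0.
have -> : (fun n => \sum_(0 <= k < n) (-1) ^+ k * (x / 2) `^ (2 * k%:R + nu) /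
    (k`!%:R * Gamma (k%:R + nu + 1))) =
    (fun n => (x / 2) `^ nu / Gamma (nu + 1) * pseries (bcoef nu) (x ^+ 2 / 4) n).
  apply/funext => n; rewrite /pseries /series /= mulr_sumr; apply: eq_bigr => k _.
  rewrite -addrA Gamma_poch// /bcoef powRD; last by rewrite (gt_eqF x2) implybT.
  have -> : (x / 2) `^ (2 * k%:R) = (x ^+ 2 / 4) ^+ k.
    rewrite -natrM powR_mulrn ?(ltW x2)// exprM; congr (_ ^+ _); by field.
  have g0 := Gamma_gt0 n1; have q0 := poch_gt0 k n1.
  have f0 : 0 < k`!%:R :> R by rewrite ltr0n fact_gt0.
  move: (Gamma (nu + 1)) (poch (nu + 1) k) g0 q0 => G q g0 q0.
  by field; rewrite (gt_eqF g0) (gt_eqF q0) (gt_eqF f0).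
by apply: cvg_mull; exact: cvg_Phi.
Qed.

Lemma besselJ_bu_eq0 nu x : 0 < nu + 1 -> 0 < x -> (besselJ nu x = 0 <-> bu nu x = 0).
Proof.
move=> n1 x0; rewrite besselJE// /bu.
have c0 : (x / 2) `^ nu / Gamma (nu + 1) != 0.
  by rewrite gt_eqF// divr_gt0 ?powR_gt0 ?divr_gt0 ?Gamma_gt0.
have c1 : x `^ (nu + 1 / 2) != 0 by rewrite gt_eqF// powR_gt0.
split=> /eqP; first by rewrite mulf_eq0 (negbTE c0) /= => /eqP ->; rewrite mulr0.
by rewrite mulf_eq0 (negbTE c1) /= => /eqP ->; rewrite mulr0.
Qed.

(** At a zero of J_nu one has u = 0, and u' keeps only its term of order nu + 1; so E(s_j) is a
    constant multiple of s_j J_(nu+1)(s_j)^2. This rewrites the norming constant of psi_j in terms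
    of the energy. *)
Lemma psiE nu (s : nat -> R) : 0 < nu + 1 -> (forall j, 0 < s j) -> (forall j, besselJ nu (s j) = 0) ->
  exists2 kappa : nat -> R, forall j, kappa j ^+ 2 = 2 * s j `^ (2 * nu + 1) / bE nu (s j) &
    forall j x, 0 < x -> psi nu s j x = kappa j * Phi nu ((s j * x) ^+ 2 / 4).
Proof.
move=> n1 s0 sz; have n2 : 0 < nu + 1 + 1 by rewrite addr_gt0.
exists (fun j => Num.sqrt 2 / `|besselJ (nu + 1) (s j)| * ((s j / 2) `^ nu / Gamma (nu + 1))) => [j|j x x0].
  have sj := s0 j; have sj2 : 0 < s j / 2 by rewrite divr_gt0.
  have g0 := Gamma_gt0 n1.
  have Pz : Phi nu (s j ^+ 2 / 4) = 0.
    have /(besselJ_bu_eq0 n1 sj)/eqP := sz j.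
    by rewrite /bu mulf_eq0 gt_eqF ?powR_gt0//= => /eqP.
  have e0 := bE_gt0 n1 sj.
  have EE : bE nu (s j) = (s j `^ (nu + 1 / 2)) ^+ 2 *
      (s j / (2 * (nu + 1)) * Phi (nu + 1) (s j ^+ 2 / 4)) ^+ 2.
    by rewrite /bE /energy /bu /bu1 Pz; ring.
  rewrite besselJE// GammaS//.
  have P2 : (s j / 2) `^ (nu + 1) = (s j / 2) `^ nu * (s j / 2).
    by rewrite powRD ?(gt_eqF sj2) ?implybT// powRr1 ?ltW.
  have P3 : s j `^ (2 * nu + 1) = (s j `^ (nu + 1 / 2)) ^+ 2.
    by rewrite -powR_mulrn ?powR_ge0// -powRrM; congr (_ `^ _); field.
  rewrite P2 P3 EE exprMn exprMn exprVn real_normK ?num_real// sqr_sqrtr//.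
  rewrite EE in e0.
  have q1 : Phi (nu + 1) (s j ^+ 2 / 4) != 0.
    by apply: contraTneq e0 => ->; rewrite mulr0 expr0n mulr0 ltxx.
  have q2 : (s j / 2) `^ nu != 0 by rewrite gt_eqF// powR_gt0.
  have q3 : s j `^ (nu + 1 / 2) != 0 by rewrite gt_eqF// powR_gt0.
  move: (Gamma (nu + 1)) (Phi (nu + 1) (s j ^+ 2 / 4)) ((s j / 2) `^ nu) (s j `^ (nu + 1 / 2)) g0 q1 q2 q3 => G A B C g0 A0 B0 C0.
  by field; rewrite A0 B0 C0 (gt_eqF g0) (gt_eqF n1) (gt_eqF sj).
rewrite /psi [besselJ nu (s j * x)]besselJE//; last by rewrite mulr_gt0.
have -> : s j * x / 2 = s j / 2 * x by ring.
rewrite powRM ?(ltW x0)//; last by rewrite ltW// divr_gt0.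
rewrite powRN; have xn : x `^ nu != 0 by rewrite gt_eqF// powR_gt0.
have g0 := Gamma_gt0 n1.
move: (Gamma (nu + 1)) g0 (_ / `|_|) (Phi _ _) => G g0 A B.
by field; rewrite xn (gt_eqF g0).
Qed.

End besselJ_Phi.

(** * Lower bound for the kernel *)

Section log_growth.
Context {R : realType}.
Implicit Types (x y r : R).

(* u_a^2 exceeds half the energy by the derivative of a bounded function, up to O(1/x^2). *)
Lemma sqr_bu_log (a : R) : 0 < a + 1 -> exists m C (H h : R -> R), [/\ 0 < m,
  forall x, 1 <= x -> is_derive x 1 H (h x) /\ {for x, continuous h},
  forall x, 1 <= x -> h x <= bu a x ^+ 2 / x &
  forall T, 2 <= T -> m * ln T - C <= H T - H 2].
Proof.
move=> a1; have [m m0 hm] := bE_lower a1; have [M M0 hM] := bE_upper a1.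
pose k : R := 1 / 4 - a ^+ 2.
pose D := M * (1 + `|k|).
have D0 : 0 <= D by rewrite mulr_ge0 ?addr_ge0// ltW.
(* Up to O(1 / x^2) the derivative of q is (u'^2 - u^2) / x, so u^2 / x plus half of it is E / (2
   x), at least m / (2 x). The term D / x of H pays for the remainder. *)
pose q x := bu a x * bu1 a x / x.
pose q1 x := (bu1 a x ^+ 2 - (1 + k / x ^+ 2) * bu a x ^+ 2) / x - bu a x * bu1 a x / x ^+ 2.
pose H x := m / 2 * ln x - q x / 2 + D / x.
pose h x := m / 2 / x - q1 x / 2 - D / x ^+ 2.
have bq x : 1 <= x -> `|q x| <= M.
  move=> x1; have x0 : 0 < x by lra.
  rewrite /q normrM (ger0_norm (x := x^-1)); last by rewrite invr_ge0 ltW.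
  rewrite ler_pdivrMr//; apply: le_trans (mul_le_energy _ _ _) _.
  by apply: le_trans (hM x x1) _; rewrite ler_peMr// ltW.
have dH x : 1 <= x -> is_derive x 1 H (h x).
  move=> x1; have x0 : 0 < x by lra.
  have xn : x != 0 by rewrite gt_eqF.
  have dq := derM (derM (is_derive_bu a1 x0) (is_derive_bu1 a1 x0)) (derV xn (derI x)).
  have := derD (derB (derZ (m / 2) (is_derive1_ln x0)) (derM dq (derC x 2^-1))) (derZ D (derV xn (derI x))).
  by move=> /der_eq; apply; rewrite /h /q1 /k; field.
have ch x : 1 <= x -> {for x, continuous h}.
  move=> x1; have x0 : 0 < x by lra.
  have xn : x != 0 by rewrite gt_eqF.
  have x2 : x ^+ 2 != 0 by rewrite expf_neq0.
  have db := is_derive_bu a1 x0; have db1 := is_derive_bu1 a1 x0.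
  have dV := derV xn (derI x); have dV2 := @derV _ (fun t => t ^+ 2) x _ x2 (derX 2 (derI x)).
  have d1 := derM (derC x (m / 2)) dV.
  have d2 := derM (derB (derX 2 db1) (derM (derD (derC x 1) (derM (derC x k) dV2)) (derX 2 db))) dV.
  have d3 := derM (derM db db1) dV2.
  exact: der_cts (derB (derB d1 (derM (derB d2 d3) (derC x 2^-1))) (derM (derC x D) dV2)).
exists (m / 2), (M + D - m / 2 * - ln 2), H, h; split.
- by rewrite divr_gt0.
- by move=> x x1; split; [exact: dH|exact: ch].
- move=> x x1; have x0 : 0 < x by lra.
  have E : bu a x ^+ 2 / x - h x = (bE a x - m) / 2 / x +
      (D - bu a x * bu1 a x / 2 - k / 2 * (bu a x ^+ 2 / x)) / x ^+ 2.
    by rewrite /h /q1 /bE /energy; field; rewrite gt_eqF.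
  rewrite -subr_ge0 E; apply: addr_ge0.
    by rewrite !divr_ge0 ?subr_ge0 ?hm// ltW.
  rewrite divr_ge0 ?sqr_ge0//.
  have t1 : bu a x * bu1 a x <= M.
    by apply: le_trans (ler_norm _) _; apply: le_trans (mul_le_energy _ _ _) _; exact: hM.
  have t2 : `|k * (bu a x ^+ 2 / x)| <= `|k| * M.
    rewrite normrM ler_wpM2l// ger0_norm; last by rewrite divr_ge0 ?sqr_ge0// ltW.
    rewrite ler_pdivrMr//; apply: le_trans (sqr_le_energy _ (bu1 a) _) _.
    by apply: le_trans (hM x x1) _; rewrite ler_peMr// ltW.
  move: t2; rewrite ler_norml => /andP[_ t2]; rewrite /D.
  have t3 : 0 <= `|k| * M by rewrite mulr_ge0// ltW.
  lra.
- move=> T T2; have T1 : 1 <= T by lra.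
  have := bq T T1; have h2 := bq 2 (ler1n R 2); rewrite ler_norml => /andP[_ qT].
  move: h2; rewrite ler_norml => /andP[q2 _].
  have : 0 <= D / T by rewrite divr_ge0//; lra.
  rewrite /H; have : D / 2 <= D by lra.
  lra.
Qed.

End log_growth.

Section kernel_lower.
Context {R : realType}.
Variables (nu d : R) (s : nat -> R).
Hypothesis hnu : - 1 / 2 < nu.
Hypothesis d0 : 0 < d.
Hypothesis hs : bessel_zeros nu s.
Implicit Types (x y r T : R).

Let nu1 : 0 < nu + 1. Proof. by move: hnu; lra. Qed.

(** The terms with s_j >= r vanish, so for r <= s n this finite sum is the whole kernel. *)
Definition brkernel r n x y : R :=
  \sum_(j < n) (Num.max (1 - s j ^+ 2 / r ^+ 2) 0) `^ d * psi nu s j y * psi nu s j x.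

Lemma brkernelE r n x y : 0 < r -> 0 < x -> 0 < y ->
  brkernel r n x y = 2 * r `^ (2 * nu + 1) * \sum_(j < n) (bE nu (s j))^-1 *
    (wt nu d (s j / r) * Phi nu ((s j / r) ^+ 2 * ((r * x) ^+ 2 / 4)) *
       Phi nu ((s j / r) ^+ 2 * ((r * y) ^+ 2 / 4))).
Proof.
move=> r0 x0 y0; have [s0 sS sz sall] := hs.
have [kap kap2 psiK] := psiE nu1 s0 sz.
rewrite mulr_sumr; apply: eq_bigr => j _.
rewrite !psiK//.
have t2 u : (s j / r) ^+ 2 * ((r * u) ^+ 2 / 4) = (s j * u) ^+ 2 / 4.
  by field; rewrite gt_eqF.
rewrite !t2 /wt [ppow (2 * nu + 1) _]ppowE; last by rewrite divr_ge0 ?ltW.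
have rV : r^-1 `^ (2 * nu + 1) = (r `^ (2 * nu + 1))^-1.
  by rewrite -(powR_inv1 (ltW r0)) -powRrM mulN1r powRN.
rewrite powRM ?invr_ge0 ?(ltW (s0 _)) ?(ltW r0)// rV.
rewrite /ppow expr_div_n.
have rp : r `^ (2 * nu + 1) != 0 by rewrite gt_eqF// powR_gt0.
transitivity (Num.max (1 - s j ^+ 2 / r ^+ 2) 0 `^ d * kap j ^+ 2 *
   Phi nu ((s j * y) ^+ 2 / 4) * Phi nu ((s j * x) ^+ 2 / 4)); first by ring.
have e0 := bE_gt0 nu1 (s0 j).
rewrite kap2; move: (Num.max _ _ `^ d) (Phi _ _) (Phi _ _) (r `^ _) (s j `^ _) (bE _ _) rp e0 => A B C D E F D0 F0.
by field; rewrite D0 gt_eqF.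
Qed.

Let a := nu + d + 1.

Let a1 : 0 < a + 1. Proof. by rewrite /a; move: hnu d0; lra. Qed.

(* The antiderivative [G] is the one of [sqr_bu_log], rescaled and minus a multiple of
   [ln] that absorbs the error terms. *)
Lemma kernel_lower : exists c eps eta, [/\ 0 < c, 0 < eps, 0 < eta <= 1 / 4 &
  \forall r \near +oo, exists n (G g : R -> R), [/\ r <= s n,
    2 <= r `^ eta,
    forall y, 2 / r <= y <= r `^ eta / r -> is_derive y 1 G (g y) /\ {for y, continuous g},
    forall x y, 0 < x <= eps / r -> 2 / r <= y <= r `^ eta / r ->
      g y <= y `^ (- (nu + 1 / 2 - d)) * bu a (r * y) * brkernel r n x y * y `^ (2 * nu + 1) &
    c * r `^ (nu + 1 / 2 - d) * ln r <= G (r `^ eta / r) - G (2 / r)]].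
Proof.
have [s0 sS sz sall] := hs.
have sz' j : bu nu (s j) = 0 by apply/(besselJ_bu_eq0 nu1 (s0 j)).
have sall' x : 0 < x -> bu nu x = 0 -> exists j, s j = x.
  by move=> x0 /(besselJ_bu_eq0 nu1 x0); exact: sall.
have [Gz [lam [C1 [_ lam0 C10 hK]]]] := kernel_sum_int hnu d0 s0 sS sz' sall'.
have [C2 [e1 [C20 e10 hS]]] := Sint_main hnu d0.
have [m [CH [H [h [m0 dH hle HT]]]]] := sqr_bu_log a1.
have [V V0 hV] := bu_bounded a1.
have b0 := beta_gt0 hnu d0; set b := beta nu d 0 in b0.
(* With q = nu + d + 3/2 = a + 1/2 this gives T^(2 + q) = r^(1/4) for T = r^eta. The relative error
   (sqrt r + w) / (r N) is then at most 2 r^(-1/2) T^(2 + q) = 2 r^(-1/4). *)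
pose eta : R := 1 / (4 * (a + 5 / 2)).
have a52 : 1 < a + 5 / 2 by move: a1; lra.
have eta0 : 0 < eta by rewrite divr_gt0// mulr_gt0//; lra.
have eta1 : eta <= 1 / 4 by rewrite /eta ler_pdivrMr ?mulr_gt0//; lra.
(* The main term contributes at least 4 Q ln T up to a constant. The error in z and the error of the
   Riemann sum take Q ln T each, the constant is at most Q ln T for large r, and the last Q ln T is
   the claimed bound. *)
pose Q := lam * b * m / 4.
have Q0 : 0 < Q by rewrite /Q !divr_gt0 ?mulr_gt0.
pose z1 := Num.min (Num.min e1 1) (Q / (lam * C2 * V)).
have z10 : 0 < z1 by rewrite !lt_min e10 ltr01 divr_gt0 ?mulr_gt0.
have [z1e z11 z1Q] : [/\ z1 <= e1, z1 <= 1 & z1 <= Q / (lam * C2 * V)].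
  by split; rewrite /z1 !ge_min lexx ?orbT.
pose eps := Num.min z1 1.
have eps0 : 0 < eps by rewrite lt_min z10 ltr01.
exists (2 * Q * eta), eps, eta; split => //.
- by rewrite mulr_gt0// mulr_gt0.
- by rewrite eta0.
pose W := 2 * V * C1 / Q.
have W0 : 0 < W by rewrite divr_gt0 ?mulr_gt0.
near=> r.
have r1 : 1 <= r by near: r; apply: nbhs_pinfty_ge; exact: num_real.
have r0 : 0 < r by lra.
have pow_ge p u : 0 < p -> 0 <= u -> u `^ p^-1 <= r -> u <= r `^ p.
  move=> p0 u0 ur; have -> : u = (u `^ p^-1) `^ p.
    by rewrite -powRrM mulVf ?gt_eqF// powRr1.
  by apply: ge0_ler_powR => //; rewrite ?nnegrE ?powR_ge0// ltW.
set T := r `^ eta.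
have T2 : 2 <= T.
  apply: pow_ge => //; near: r; apply: nbhs_pinfty_ge; exact: num_real.
have T0 : 0 < T by clear -hs d0 nu1 a1 T2; lra.
have lT : CH * 4 / m <= ln T.
  rewrite ln_powR [leRHS]mulrC -ler_pdivrMr// -[leLHS]expRK ler_ln ?posrE ?expR_gt0//.
have W4 : W <= r `^ (1 / 4).
  apply: pow_ge; [lra|exact: ltW|].
  near: r; apply: nbhs_pinfty_ge; exact: num_real.
have theta : V * C1 * (2 / r `^ (1 / 4)) <= Q.
  rewrite mulrA ler_pdivrMr ?powR_gt0 //.
  have := ler_wpM2l (ltW Q0) W4; have -> : Q * W = 2 * V * C1 by rewrite /W mulrC divfK// gt_eqF.
  by lra.
have [n [rn _ hKn]] := hK r r1.
pose B0 : R := 2 * r `^ (nu + 3 / 2 - d).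
have B00 : 0 < B0 by rewrite mulr_gt0 ?powR_gt0.
pose G y := B0 / r * (lam * b * H (r * y) - 2 * Q * ln (r * y)).
pose g y := B0 * (lam * b * h (r * y) - 2 * Q / (r * y)).
have Yb y : 2 / r <= y <= T / r -> 2 <= r * y <= T.
  by rewrite ler_pdivrMr// ler_pdivlMr// mulrC.
exists n, G, g; split; [exact: rn|exact: T2| | | ].
- move=> y /Yb /andP[Y2 YT]; have Y1 : 1 <= r * y by clear -hs d0 nu1 a1 Y2; lra.
  have Y0 : 0 < r * y by clear -hs d0 nu1 a1 Y2; lra.
  have [dHY chY] := dH _ Y1.
  have dY := derM (derC y r) (derI y).
  split.
    have d1 := @der_comp _ H (fun t => r * t) y _ _ dHY dY.
    have d2 := @der_comp _ (@ln R) (fun t => r * t) y _ _ (is_derive1_ln Y0) dY.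
    apply: der_eq (derZ (B0 / r) (derB (derZ (lam * b) d1) (derZ (2 * Q) d2))) _.
    rewrite /g; move: (h _) => hh; field.
    by rewrite (gt_eqF r0) /= gt_eqF// -(pmulr_rgt0 _ r0).
  have cY : {for y, continuous (fun t => r * t)} by exact: der_cts dY.
  have Yn : r * y != 0 by rewrite gt_eqF.
  have ci : {for y, continuous (fun t => (r * t)^-1)} by exact: der_cts (derV Yn dY).
  have c1 : {for y, continuous (fun t => h (r * t))}.
    by apply: (@continuous_comp _ _ _ (fun t => r * t) h y).
  apply: cvgM; first exact: cvg_cst.
  apply: cvgB; apply: cvgM => //; exact: cvg_cst.
- move=> x y /andP[x0 xe] yb; have /andP[Y2 YT] := Yb y yb.
  have y0 : 0 < y by case/andP: yb => + _; apply: lt_le_trans; rewrite divr_gt0.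
  rewrite brkernelE//; set z := (r * x) ^+ 2 / 4; set Y := r * y in Y2 YT *.
  have Y0 : 0 < Y by clear -hs d0 nu1 a1 Y2; lra.
  have Y1 : 1 <= Y by clear -hs d0 nu1 a1 Y2; lra.
  set w := Y ^+ 2 / 4.
  have w1 : 1 <= w by rewrite /w; clear -hs d0 nu1 a1 Y2; nra.
  have rxe : 0 <= r * x <= eps.
    by rewrite mulr_ge0 ?(ltW r0) ?(ltW x0)//= mulrC -ler_pdivlMr.
  have eps1 : eps <= 1 by rewrite /eps ge_min lexx orbT.
  have epsz : eps <= z1 by rewrite /eps ge_min lexx.
  have zz1 : 0 <= z <= z1.
    by rewrite /z; case/andP: rxe => q1 q2; rewrite divr_ge0 ?sqr_ge0//=; clear -hs d0 nu1 a1 q1 q2 eps1 epsz; nra.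
  have /andP[z0 zz1'] := zz1.
  have hk := hKn z w; rewrite z0 (le_trans zz1')//= in hk; have {}hk := hk isT w1.
  have hs' := hS z Y; rewrite z0 (le_trans zz1')//= in hs'; have {}hs' := hs' isT Y2.
  rewrite -/w in hs'; rewrite -/b in hs'.
  set S := \sum_(j < n) _ in hk *; set I := Sint nu d z w in hk hs'.
  set q := nu + d + 3 / 2 in hs'; set N := Y `^ (- q) in hs'.
  have N0 : 0 < N by exact: powR_gt0.
  set v := bu a Y.
  have vN : Phi (nu + d + 1) w = v * N.
    rewrite /v /bu -/a -/w /N powRN mulrAC (_ : a + 1 / 2 = q); last by rewrite /a /q; field.
    by rewrite mulfV ?mul1r// gt_eqF// powR_gt0.
  rewrite vN in hs'.
  have vV : `|v| <= V by exact: hV.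
  have sq0 := sqrtr_ge0 r.
  (* The main term of S is a multiple of v N, whose sign oscillates. The factor v of the test
     function turns it into a multiple of v^2 N before anything is estimated. *)
  have hvS : v * S >= lam * r * (b * v ^+ 2 * N - V * (C2 * z * N)) - V * (C1 * (Num.sqrt r + w)).
    have A1 : `|v * (S - lam * r * I)| <= V * (C1 * (Num.sqrt r + w)).
      by rewrite normrM; apply: ler_pM.
    have A2 : `|v * (I - b * (v * N))| <= V * (C2 * z * N).
      by rewrite normrM; apply: ler_pM.
    move: A1 A2; rewrite !ler_norml => /andP[A1 _] /andP[A2 _].
    have lr : 0 <= lam * r by rewrite mulr_ge0// ltW.
    have := ler_wpM2l lr A2; clear -hs d0 nu1 a1 A1; lra.
  pose U := B0 / Y.
  have U0 : 0 < U by rewrite divr_gt0.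
  have yE : y `^ (- (nu + 1 / 2 - d)) * y `^ (2 * nu + 1) * (2 * r `^ (2 * nu + 1)) = U / (r * N).
    rewrite -powRD ?(gt_eqF y0) ?implybT// /U /B0 /N.
    have -> : y = Y * r^-1 by rewrite /Y mulrC mulKf// gt_eqF.
    have rV c : r^-1 `^ c = r `^ (- c).
      by rewrite -(powR_inv1 (ltW r0)) -powRrM mulN1r.
    rewrite powRM ?(ltW Y0) ?invr_ge0 ?(ltW r0)// rV.
    set e := - (nu + 1 / 2 - d) + (2 * nu + 1).
    have -> : Y `^ e = Y `^ q / Y.
      rewrite -{3}(powRr1 (ltW Y0)) -powRB ?(gt_eqF Y0) ?implybT//; congr (_ `^ _).
      by rewrite /e /q; field.
    have -> : r `^ (2 * nu + 1) = r `^ (nu + 3 / 2 - d) * r `^ e / r.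
      rewrite -{4}(powRr1 (ltW r0)) -powRD ?(gt_eqF r0) ?implybT//.
      rewrite -powRB ?(gt_eqF r0) ?implybT//; congr (_ `^ _).
      by rewrite /e; field.
    rewrite !powRN.
    have p1 : r `^ e != 0 by rewrite gt_eqF// powR_gt0.
    have p2 : Y `^ q != 0 by rewrite gt_eqF// powR_gt0.
    move: (Y `^ q) (r `^ e) (r `^ _) p1 p2 => P1 P2 P3 P10 P20.
    by field; rewrite P10 P20 (gt_eqF r0) gt_eqF.
  have -> : y `^ (- (nu + 1 / 2 - d)) * v * (2 * r `^ (2 * nu + 1) * S) * y `^ (2 * nu + 1) =
      U / (r * N) * (v * S) by rewrite -yE; ring.
  have rN0 : 0 < r * N by rewrite mulr_gt0.
  apply: (@le_trans _ _ (U / (r * N) * (lam * r * (b * v ^+ 2 * N - V * (C2 * z * N)) -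
      V * (C1 * (Num.sqrt r + w))))); last first.
    by rewrite ler_wpM2l// ltW// divr_gt0.
  have -> : U / (r * N) * (lam * r * (b * v ^+ 2 * N - V * (C2 * z * N)) -
      V * (C1 * (Num.sqrt r + w))) =
      U * (lam * b * v ^+ 2 - lam * C2 * V * z - V * C1 * ((Num.sqrt r + w) / (r * N))).
    by field; rewrite (gt_eqF r0) (gt_eqF N0).
  have -> : g y = U * (lam * b * (h Y * Y) - 2 * Q).
    by rewrite /g /U -/Y; move: (h Y) => hY; field; rewrite gt_eqF.
  rewrite ler_pM2l//.
  have k1 : lam * b * (h Y * Y) <= lam * b * v ^+ 2.
    by rewrite ler_wpM2l ?mulr_ge0 ?(ltW lam0) ?(ltW b0)// -ler_pdivlMr//; exact: hle.
  have k2 : lam * C2 * V * z <= Q.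
    have lcv : 0 < lam * C2 * V by rewrite !mulr_gt0.
    rewrite mulrC -ler_pdivlMr//; exact: le_trans zz1' z1Q.
  have k3 : V * C1 * ((Num.sqrt r + w) / (r * N)) <= Q.
    apply: le_trans theta; rewrite ler_wpM2l ?mulr_ge0 ?(ltW V0) ?(ltW C10)//.
    have sr : 1 <= Num.sqrt r by rewrite -[leLHS]sqrtr1 ler_sqrt.
    have srr : r = Num.sqrt r * Num.sqrt r by rewrite -expr2 sqr_sqrtr// ltW.
    have s1 : Num.sqrt r + w <= 2 * (Num.sqrt r * T ^+ 2).
      have w2 : w <= T ^+ 2 by rewrite /w; clear -hs d0 nu1 a1 Y2 YT; nra.
      have T21 : 1 <= T ^+ 2 by clear -hs d0 nu1 a1 T2; nra.
      clear -hs d0 nu1 a1 sr w2 T21; nra.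
    have iN : N^-1 <= T `^ q.
      rewrite /N powRN invrK; apply: ge0_ler_powR => //; rewrite ?nnegrE ?(ltW Y0) ?(ltW T0)//.
      by rewrite /q; move: hnu d0; clear -hs d0 nu1 a1; lra.
    have TT : T ^+ 2 * T `^ q = r `^ (1 / 4).
      rewrite -powR_mulrn ?(ltW T0)// -powRD ?(gt_eqF T0) ?implybT// /T -powRrM; congr (_ `^ _).
      by rewrite /eta /q /a; field; rewrite gt_eqF//; move: a52; rewrite /a; clear -hs d0 nu1 a1; lra.
    have sq4 : Num.sqrt r = r `^ (1 / 4) * r `^ (1 / 4).
      rewrite -powR12_sqrt ?(ltW r0)// -powRD ?(gt_eqF r0) ?implybT//; congr (_ `^ _); by field.
    rewrite invfM mulrA.
    apply: (@le_trans _ _ (2 * (Num.sqrt r * T ^+ 2) / r * T `^ q)).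
      apply: ler_pM; rewrite ?invr_ge0 ?(ltW N0) ?divr_ge0 ?addr_ge0 ?(ltW r0)//.
        by apply: le_trans w1.
      by rewrite ler_wpM2r ?invr_ge0 ?(ltW r0).
    have -> : 2 * (Num.sqrt r * T ^+ 2) / r * T `^ q = 2 * Num.sqrt r / r * (T ^+ 2 * T `^ q) by ring.
    rewrite TT {2}srr sq4; have r4 : r `^ (1 / 4) != 0 by rewrite gt_eqF// powR_gt0.
    move: (r `^ (1 / 4)) r4 => P P0.
    by rewrite le_eqVlt; apply/orP; left; apply/eqP; field.
  move: k1 k2 k3; clear -hs d0 nu1 a1; lra.
- rewrite /G.
  have -> : r * (T / r) = T by rewrite mulrC divfK ?gt_eqF.
  have -> : r * (2 / r) = 2 by rewrite mulrC divfK ?gt_eqF.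
  have -> : 2 * Q * eta * r `^ (nu + 1 / 2 - d) * ln r = B0 / r * (Q * ln T).
    rewrite /T ln_powR /B0.
    have -> : r `^ (nu + 3 / 2 - d) = r * r `^ (nu + 1 / 2 - d).
      rewrite -{2}(powRr1 (ltW r0)) -powRD ?(gt_eqF r0) ?implybT//; congr (_ `^ _); by field.
    by field; rewrite gt_eqF.
  rewrite -mulrBr ler_wpM2l ?divr_ge0 ?(ltW B00) ?(ltW r0)//.
  have := HT T T2 => hT.
  have lb : 0 < lam * b by rewrite mulr_gt0.
  have := ler_wpM2l (ltW lb) hT.
  have l2 : 0 <= ln (2 : R) by rewrite ln_ge0// ler1n.
  have Ql2 : 0 <= Q * ln 2 by rewrite mulr_ge0// ltW.
  have : lam * b * CH <= Q * ln T.
    have -> : Q * ln T = lam * b * (m / 4 * ln T) by rewrite /Q; ring.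
    rewrite ler_wpM2l ?(ltW lb)//; move: lT; rewrite ler_pdivrMr//; clear -hs d0 nu1 a1; lra.
  have QE : 4 * Q = lam * b * m by rewrite /Q; field.
  have : 4 * Q * ln T = lam * b * (m * ln T) by rewrite QE; ring.
  clear -hs d0 nu1 a1 l2 Ql2; lra.
Unshelve. all: by end_near.
Qed.

End kernel_lower.

(** * The test function *)

Section mu_nu_integral.
Context {R : realType}.
Variable nu : R.
Local Notation leb := (@lebesgue_measure R).
Local Notation rho := (fun x : R => (mu_density nu x)%:E).
Local Open Scope ereal_scope.

Lemma mu_density_ge0 (x : R) : (0 <= mu_density nu x)%R.
Proof. by rewrite /mu_density mulr_ge0// powR_ge0. Qed.

Lemma measurable_mu_density : measurable_fun setT (mu_density nu).
Proof.
apply: measurable_funM; last exact: measurable_powR.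
by apply: measurable_indic; exact: measurable_itv.
Qed.

Let mrho : measurable_fun setT rho.
Proof. by apply/measurable_EFinP; exact: measurable_mu_density. Qed.

Import HBNNSimple.

Let integral_mu_nu_indic E : measurable E ->
  \int[mu_nu nu]_x (\1_E x)%:E = \int[leb]_x ((\1_E x)%:E * rho x).
Proof.
move=> mE; rewrite integral_indic//= setIT /mu_nu integral_mkcond.
apply: eq_integral => x _; rewrite patchE indicE.
by case: ifPn => _; rewrite ?mul1e ?mul0e.
Qed.

Let integral_mu_nu_nnsfun (f : {nnsfun R >-> R}) :
  \int[mu_nu nu]_x (f x)%:E = \int[leb]_x ((f x)%:E * rho x).
Proof.
under [LHS]eq_integral do rewrite fimfunE -fsumEFin//.
rewrite [LHS]ge0_integral_fsum//; last 2 first.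
  - by move=> r; exact/measurable_EFinP/measurableT_comp.
  - by move=> n x _; rewrite EFinM nnfun_muleindic_ge0.
under [RHS]eq_integral.
  move=> x xD; rewrite fimfunE -fsumEFin// muleC ge0_mule_fsumr; last first.
    by move=> r; rewrite EFinM nnfun_muleindic_ge0.
  over.
rewrite [RHS]ge0_integral_fsum//; last 2 first.
  - move=> r; apply: emeasurable_funM => //.
    apply/measurable_EFinP; apply: measurable_funM => //; apply: measurable_indic.
    exact: (@measurable_sfunP _ _ R R f _ (measurable_set1 r)).
  - move=> n x _; rewrite mule_ge0//; first by rewrite lee_fin mu_density_ge0.
    by rewrite EFinM nnfun_muleindic_ge0.
apply: eq_fsbigr => r _.
rewrite !integralZl_indic_nnsfun//= integral_mu_nu_indic//.
have [r0|r0] := leP 0%R r.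
  rewrite -ge0_integralZl//; last 2 first.
    - apply: emeasurable_funM => //; apply/measurable_EFinP.
      by apply: measurable_indic; exact: (@measurable_sfunP _ _ R R f _ (measurable_set1 r)).
    - by move=> x _; rewrite mule_ge0// lee_fin mu_density_ge0.
  by apply: eq_integral => x _; rewrite EFinM [RHS]muleC muleA.
rewrite preimage_nnfun0//.
rewrite !integral0_eq ?mule0//; move=> x _; rewrite indicE in_set0 ?mulr0 ?mule0 ?mul0e//.
Qed.

Lemma ge0_integral_mu_nu (f : R -> \bar R) : measurable_fun setT f -> (forall x, 0 <= f x) ->
  \int[mu_nu nu]_x f x = \int[leb]_x (f x * rho x).
Proof.
move=> mf f0.
pose f_ := nnsfun_approx measurableT mf.
transitivity (lim (\int[mu_nu nu]_x (f_ n x)%:E @[n --> \oo])).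
  rewrite -monotone_convergence//=.
  - apply: eq_integral => ? /[!inE] xD; apply/esym/cvg_lim => //=.
    exact: cvg_nnsfun_approx.
  - by move=> n; exact/measurable_EFinP/measurable_funTS.
  - by move=> n ? _; rewrite lee_fin.
  - by move=> ? _ ? ? mn; rewrite lee_fin; exact/lefP/nd_nnsfun_approx.
transitivity (lim (\int[leb]_x ((f_ n x)%:E * rho x) @[n --> \oo])).
  by apply: congr_lim; apply/funext => n /=; exact: integral_mu_nu_nnsfun.
rewrite -monotone_convergence//=.
- apply: eq_integral => x /[!inE] xD; apply/cvg_lim => //.
  by apply: cvgeZr => //; exact: cvg_nnsfun_approx.
- move=> n; apply: emeasurable_funM => //; apply/measurable_EFinP.
  exact: (@measurable_funPT _ _ R R (f_ n)).
- by move=> n x _; rewrite mule_ge0// lee_fin ?mu_density_ge0.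
- move=> x _ m n mn; apply: lee_wpmul2r; first by rewrite lee_fin mu_density_ge0.
  by rewrite lee_fin; have /lefP := nd_nnsfun_approx measurableT mf mn; exact.
Qed.

Lemma integral_mu_nu (D : set R) (f : R -> \bar R) : measurable D -> measurable_fun D f ->
  \int[mu_nu nu]_(x in D) f x = \int[leb]_(x in D) (f x * rho x).
Proof.
move=> mD mf; rewrite integral_mkcond [RHS]integral_mkcond.
have mfD : measurable_fun setT (f \_ D) by apply/(measurable_restrictT f).
rewrite integralE [RHS]integralE ge0_integral_mu_nu//; last exact: measurable_funepos.
rewrite ge0_integral_mu_nu//; last exact: measurable_funeneg.
have rho0 x : 0 <= rho x by rewrite lee_fin mu_density_ge0.
have E x : ((fun x => f x * rho x) \_ D) x = (f \_ D) x * rho x.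
  by rewrite !patchE; case: ifPn; rewrite ?mul0e.
congr (_ - _); apply: eq_integral => x _.
  by rewrite !funeposE E muleC [in RHS]muleC maxe_pMr// mule0.
by rewrite !funenegE E muleC [in RHS]muleC -muleN maxe_pMr// mule0.
Qed.

End mu_nu_integral.

Section test_function.
Context {R : realType}.
Variables (nu d : R) (s : nat -> R).
Hypothesis hnu : - 1 / 2 < nu.
Hypothesis d0 : 0 < d.
Hypothesis hs : bessel_zeros nu s.
Variables (r al be : R).
Hypothesis r0 : 0 < r.
Hypothesis al0 : 0 < al.
Hypothesis be1 : be < 1.

Local Notation leb := (@lebesgue_measure R).

Let nu1 : 0 < nu + 1. Proof. by move: hnu; lra. Qed.
Let a := nu + d + 1.
Let a1 : 0 < a + 1. Proof. by rewrite /a; move: hnu d0; lra. Qed.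

Definition core (y : R) : R := y `^ (- (nu + 1 / 2 - d)) * bu (nu + d + 1) (r * y).

Definition test (k y : R) : R := k * (\1_(`[al, be]%classic : set R) y * core y).

Lemma measurable_Phi (b : R) : 0 < b + 1 -> measurable_fun setT (Phi b).
Proof. by move=> b1; apply: continuous_measurable_fun => x; exact: cts_Phi. Qed.

Lemma measurable_test k : measurable_fun setT (test k).
Proof.
have mr : measurable_fun setT (fun y : R => r * y) by exact: measurable_funM.
apply: measurable_funM => //; apply: measurable_funM.
  by apply: measurable_indic; exact: measurable_itv.
apply: measurable_funM; first exact: measurable_powR.
apply: measurable_funM.
  by apply: (measurableT_comp (measurable_powR _)).
apply: (measurableT_comp (measurable_Phi a1)).
by apply: measurable_funM => //; exact: measurable_funX.
Qed.

Let psi_fun : exists kappa : nat -> R, forall j (x : R), 0 < x ->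
  psi nu s j x = kappa j * Phi nu ((s j * x) ^+ 2 / 4).
Proof.
by have [s0 sS sz sall] := hs; have [kap _ psiK] := psiE nu1 s0 sz; exists kap.
Qed.

Let mpsi (j : nat) : measurable_fun (`]0%R, 1%R[%classic : set R) (psi nu s j).
Proof.
have [kap psiK] := psi_fun.
apply: (@eq_measurable_fun _ _ _ _ _ (fun x => kap j * Phi nu ((s j * x) ^+ 2 / 4))).
  by move=> x; rewrite inE /= in_itv /= => /andP[x0 _]; rewrite psiK.
apply: measurable_funTS; apply: measurable_funM => //.
apply: (measurableT_comp (measurable_Phi nu1)).
by apply: measurable_funM => //; apply: measurable_funX; exact: measurable_funM.
Qed.

Let phi (j : nat) (y : R) : R := core y * psi nu s j y * y `^ (2 * nu + 1).

Let in_ab (y : R) : `[al, be]%classic y -> 0 < y < 1.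
Proof.
by rewrite /= in_itv /= => /andP[ay yb]; rewrite (lt_le_trans al0 ay) (le_lt_trans yb be1).
Qed.

Lemma cts_core (y : R) : 0 < y -> {for y, continuous core}.
Proof.
move=> y0; apply: cvgM; first exact: der_cts (der_powR _ y0).
have ry : 0 < r * y by rewrite mulr_gt0.
exact: der_cts (der_comp (is_derive_bu a1 ry) (derM (derC y r) (derI y))).
Qed.

Lemma cts_psi j (y : R) : 0 < y -> {for y, continuous (psi nu s j)}.
Proof.
move=> y0; have [kap psiK] := psi_fun.
have d1 : is_derive y 1 (fun t => (s j * t) ^+ 2 / 4) _ :=
  derM (derX 2 (derM (derC y (s j)) (derI y))) (derC y 4^-1).
have dP := derM (derC y (kap j)) (der_comp (is_derive_Phi _ nu1) d1).
apply: (@der_cts _ _ y).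
apply: (@near_eq_is_derive _ R R _ _ y 1 _ _ dP).
near=> z; rewrite psiK//; near: z; exact: lt_nbhsr.
Unshelve. all: by end_near.
Qed.

Let cts_phi j y : 0 < y -> {for y, continuous (phi j)}.
Proof.
move=> y0; apply: cvgM; last exact: der_cts (der_powR _ y0).
by apply: cvgM; [exact: cts_core|exact: cts_psi].
Qed.

Let within_ab (f : R -> R) : (forall y : R, 0 < y -> {for y, continuous f}) ->
  {within `[al, be], continuous f}.
Proof.
move=> cf; apply: continuous_in_subspaceT => y; rewrite inE => /in_ab /andP[y0 _].
exact: cf.
Qed.

Let int_ab (f : R -> R) : (forall y : R, 0 < y -> {for y, continuous f}) ->
  leb.-integrable `[al, be] (EFin \o f).
Proof.
move=> cf; apply: continuous_compact_integrable; first exact: segment_compact.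
exact: within_ab.
Qed.

Let mab : measurable (`[al, be]%classic : set R).
Proof. exact: measurable_itv. Qed.

Lemma measurable_test_psi k j :
  measurable_fun (`]0%R, 1%R[%classic : set R) (fun x => (test k x * psi nu s j x)%:E).
Proof.
apply/measurable_EFinP; apply: measurable_funM; last exact: mpsi.
exact: measurable_funTS (measurable_test k).
Qed.

Lemma coef_test k j : coef nu s (test k) j = k * Rintegral leb `[al, be] (phi j).
Proof.
have mt := measurable_test_psi k j.
rewrite -RintegralZl//; last by apply: int_ab; exact: cts_phi.
rewrite /coef /Rintegral integral_mu_nu//; congr fine.
rewrite [LHS]integral_mkcond [RHS]integral_mkcond; apply: eq_integral => y _.
rewrite !patchE /test indicE; case: ifPn => y01; case: ifPn => yab //; last first.
- by move: yab; rewrite inE => /in_ab y01'; move: y01; rewrite notin_setE /= in_itv /= y01'.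
- by rewrite mul0r mulr0 mul0r mul0e.
rewrite -EFinM; congr EFin.
by rewrite /mu_density indicE y01 /phi !mul1r; ring.
Qed.

Let sum_int n (c : nat -> R) :
  \sum_(j < n) c j * Rintegral leb `[al, be] (phi j) =
  Rintegral leb `[al, be] (fun y => \sum_(j < n) c j * phi j y) /\
  (forall y : R, 0 < y -> {for y, continuous (fun y => \sum_(j < n) c j * phi j y)}).
Proof.
elim: n => [|n [ih cn]].
  have -> : (fun y => \sum_(j < 0) c j * phi j y) = (fun=> 0).
    by apply/funext => y; rewrite big_ord0.
  by rewrite big_ord0 Rintegral_cst// mul0r; split => // y y0; exact: cvg_cst.
have E : (fun y => \sum_(j < n.+1) c j * phi j y) = (fun y => \sum_(j < n) c j * phi j y + c n * phi n y).
  by apply/funext => y; rewrite big_ord_recr.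
have cc y : 0 < y -> {for y, continuous (fun y => c n * phi n y)}.
  by move=> y0; apply: cvgM; [exact: cvg_cst|exact: cts_phi].
split; rewrite E; last by move=> y y0; apply: cvgD; [exact: cn|exact: cc].
rewrite big_ord_recr /= ih -RintegralZl//; last by apply: int_ab; exact: cts_phi.
by rewrite RintegralD//; [exact: int_ab|exact: int_ab].
Qed.

Lemma bochner_riesz_test k n x : r <= s n ->
  bochner_riesz nu s d r (test k) x =
  k * \sum_(j < n) (Num.max (1 - s j ^+ 2 / r ^+ 2) 0) `^ d * psi nu s j x * Rintegral leb `[al, be] (phi j).
Proof.
move=> rn; have [s0 sS sz sall] := hs.
rewrite /bochner_riesz; apply/cvg_lim => //.
(* For j >= n the multiplier is 0^d = 0, as d > 0, so the partial sums are constant from n on. *)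
apply: cvg_near_cst; exists n => // N /= nN.
rewrite (big_cat_nat (n := n))//= [X in _ + X]big1_seq ?addr0; last first.
  move=> j /andP[_]; rewrite mem_index_iota => /andP[nj _].
  rewrite max_r ?powR0 ?mul0r ?gt_eqF//.
  have rs : r <= s j by apply: (le_trans rn); exact: (zeros_mono sS).
  rewrite subr_le0 ler_pdivlMr ?exprn_gt0// mul1r.
  by rewrite lerXn2r ?nnegrE ?(ltW r0) ?(ltW (s0 _)).
rewrite big_mkord mulr_sumr; apply: eq_bigr => j _.
by rewrite coef_test; ring.
Qed.

(** Once the finite sum is taken inside the integral, it is enough to have a minorant g of the
    integrand with a known antiderivative G. *)
Lemma bochner_riesz_test_ge k n x (G g : R -> R) : al < be -> 0 <= k -> r <= s n ->
  (forall y : R, al <= y <= be -> is_derive y 1 G (g y) /\ {for y, continuous g}) ->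
  (forall y : R, al <= y <= be -> g y <= core y * brkernel nu d s r n x y * y `^ (2 * nu + 1)) ->
  k * (G be - G al) <= bochner_riesz nu s d r (test k) x.
Proof.
move=> ab k0 rn dG gle; rewrite (@bochner_riesz_test k n x rn) ler_wpM2l//.
have [-> cS] := sum_int n (fun j => (Num.max (1 - s j ^+ 2 / r ^+ 2) 0) `^ d * psi nu s j x).
have wg : {within `[al, be], continuous g}.
  apply: continuous_in_subspaceT => y; rewrite inE /= in_itv /= => /dG[_]; exact.
have ig : leb.-integrable `[al, be] (EFin \o g).
  by apply: continuous_compact_integrable; first exact: segment_compact.
have -> : G be - G al = Rintegral leb `[al, be] g.
  rewrite /Rintegral (@continuous_FTC2 _ g G al be ab wg).
  - by rewrite -EFinB.
  - split.
    + move=> y; rewrite in_itv /= => /andP[ay yb].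
      by have [|[]] := dG y; rewrite ?(ltW ay) ?(ltW yb).
    + apply: cvg_at_right_filter; have [|dg _] := dG al; first by rewrite lexx ltW.
      exact: der_cts dg.
    + apply: cvg_at_left_filter; have [|dg _] := dG be; first by rewrite lexx ltW.
      exact: der_cts dg.
  - move=> y; rewrite in_itv /= => /andP[ay yb].
    by rewrite derive1E; have [|[_ ->]] := dG y; rewrite ?(ltW ay) ?(ltW yb).
apply: le_Rintegral => //; first exact: int_ab.
move=> y; rewrite /= in_itv /= => hy; apply: le_trans (gle y hy) _.
rewrite /brkernel mulr_sumr mulr_suml le_eqVlt; apply/orP; left; apply/eqP.
by apply: eq_bigr => j _; rewrite /phi; ring.
Qed.

End test_function.

(** * Measures of intervals and norms of the test function *)

Section mu_nu_bounds.
Context {R : realType}.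
Variable nu : R.
Hypothesis hnu : - 1 / 2 < nu.
Local Open Scope ereal_scope.

(** Stated for arbitrary sets because it is applied to superlevel sets of [bochner_riesz], whose
    measurability is not established. The integral of a nonnegative function is a supremum over
    simple functions below it, and this supremum is monotone in the set. *)
Lemma mu_nu_mono (A B : set R) : A `<=` B -> mu_nu nu A <= mu_nu nu B.
Proof.
move=> AB; rewrite /mu_nu integral_mkcond [leRHS]integral_mkcond.
have r0 x : 0 <= (mu_density nu x)%:E by rewrite lee_fin mu_density_ge0.
rewrite !ge0_integralTE; [|by move=> x; apply: erestrict_ge0..].
apply: le_ereal_sup => _ [h hA <-]; exists h => // x; apply: le_trans (hA x) _.
rewrite !patchE; case: ifPn => [xA|_]; last by case: ifPn.
by rewrite mem_set//; apply: AB; rewrite -inE.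
Qed.

(** Since 2 nu + 1 > 0, the density is smallest at the left end of the interval, whose length is
    again e / 2. *)
Lemma mu_nu_itv_ge (e : R) : (0 < e < 1)%R ->
  ((e / 2) `^ (2 * nu + 2))%:E <= mu_nu nu (`[(e / 2)%R, e]%classic).
Proof.
move=> /andP[e0 e1]; have e2 : (0 < e / 2)%R by rewrite divr_gt0.
rewrite /mu_nu.
apply: (@le_trans _ _ (\int[lebesgue_measure]_(x in `[(e / 2)%R, e]) (cst ((e / 2) `^ (2 * nu + 1))%:E x))).
  rewrite integral_cst//= lebesgue_measure_itv /= lte_fin ifT; last by lra.
  rewrite -EFinB -EFinM lee_fin le_eqVlt; apply/orP; left; apply/eqP.
  have -> : (e - e / 2 = (e / 2) `^ 1 :> R)%R by rewrite powRr1; lra.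
  rewrite -powRD; last by rewrite (gt_eqF e2) implybT.
  by congr (_ `^ _)%R; ring.
apply: ge0_le_integral => //=.
- by move=> x _; rewrite lee_fin powR_ge0.
- by apply/measurable_EFinP; apply: measurable_funTS; exact: measurable_mu_density.
- move=> x; rewrite /= in_itv /= => /andP[ex xe].
  rewrite lee_fin /mu_density indicE mem_set; last first.
    by rewrite /= in_itv /=; apply/andP; split; lra.
  rewrite mul1r; apply: ge0_ler_powR => //; rewrite ?nnegrE; move: hnu; lra.
Qed.

Lemma mu_nu_setT_gt0 : 0 < mu_nu nu setT.
Proof.
have h : (0 < (1 / 2 : R) < 1)%R by lra.
apply: (lt_le_trans _ (mu_nu_mono (@subsetT _ _))).
apply: lt_le_trans (mu_nu_itv_ge h).
by rewrite lte_fin powR_gt0//; lra.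
Qed.

End mu_nu_bounds.

Section test_norm.
Context {R : realType}.
Variables (nu d : R) (s : nat -> R).
Hypothesis hnu : - 1 / 2 < nu.
Hypothesis d0 : 0 < d.
Hypothesis hs : bessel_zeros nu s.
Variables (r al be V : R).
Hypothesis r0 : 0 < r.
Hypothesis al0 : 0 < al.
Hypothesis ab : al < be.
Hypothesis be1 : be < 1.
Hypothesis V0 : 0 < V.
Hypothesis hV : forall y, al <= y <= be -> `|bu (nu + d + 1) (r * y)| <= V.

Local Notation f := (test nu d r al be).
Local Notation mu := (mu_nu nu).

Lemma testZ k y : f k y = k * f 1 y.
Proof. by rewrite /test mul1r. Qed.

(** A vanishing norm would annihilate all the coefficients. Nonvanishing thus follows from the lower
    bound for the operator, with no lower estimate of the norm of the test function. *)
Lemma test_Lnorm_neq0 (p : \bar R) x : (0 < p)%E ->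
  bochner_riesz nu s d r (f 1) x != 0 -> 'N[mu]_p[EFin \o f 1]%E != 0%E.
Proof.
move=> p0; apply: contraNneq => N0; apply/eqP.
have mf : measurable_fun setT (EFin \o f 1).
  by apply/measurable_EFinP; exact: measurable_test.
have f0 := Lnorm_eq0_eq0 mf p0 N0.
have c0 j : coef nu s (f 1) j = 0.
  rewrite /coef /Rintegral (ae_eq_integral (cst 0%E)) ?integral0//.
  - exact: measurable_test_psi.
  - apply: filterS f0 => y /= fy _; have [->] := fy I.
    by rewrite mul0r.
rewrite /bochner_riesz; apply/cvg_lim => //; apply: cvg_near_cst; apply: nearW => n.
by rewrite big1// => j _; rewrite c0 mulr0 mul0r.
Qed.

(** The relation between p and the exponent of [core] makes |f|^p times the density at most V^p / y,
    whose integral is V^p ln(be / al). The factor k is the power -1/p of the true integral. *)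
Lemma test_normalize_fin p : 0 < p -> (nu + 1 / 2 - d) * p = 2 * nu + 2 ->
  'N[mu]_(p%:E)[EFin \o f 1]%E != 0%E ->
  exists2 k, V^-1 * (ln (be / al)) `^ (- p^-1) <= k &
   0 < k /\ 'N[mu]_(p%:E)[EFin \o f k]%E = 1%E.
Proof.
move=> p0 ep.
have NE k : 'N[mu]_(p%:E)[EFin \o f k]%E = ((\int[mu]_x (`|f k x| `^ p)%:E) `^ p^-1)%E.
  by rewrite unlock.
have mfp k : measurable_fun setT (fun x => (`|f k x| `^ p)%:E).
  apply/measurable_EFinP; apply: (measurableT_comp (measurable_powR _)).
  by apply: measurableT_comp => //; exact: measurable_test.
pose I := (\int[mu]_x (`|f 1 x| `^ p)%:E)%E.
have I0 : (0 <= I)%E by apply: integral_ge0 => x _; rewrite lee_fin powR_ge0.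
have L0 : 0 < ln (be / al) by rewrite ln_gt0// ltr_pdivlMr// mul1r.
have ci : {within `[al, be], continuous (fun x => V `^ p * x^-1)}.
  apply: continuous_in_subspaceT => x; rewrite inE /= in_itv /= => /andP[ax _].
  have xn : x != 0 by rewrite gt_eqF// (lt_le_trans al0 ax).
  exact: der_cts (derZ _ (derV xn (derI x))).
have IV : (I <= (V `^ p * ln (be / al))%:E)%E.
  rewrite /I integral_mu_nu//.
  apply: (@le_trans _ _ (\int[lebesgue_measure]_(x in `[al, be]) (V `^ p * x^-1)%:E)%E).
    rewrite [leRHS]integral_mkcond; apply: ge0_le_integral => //=.
    - by move=> x _; rewrite mule_ge0// lee_fin ?powR_ge0 ?mu_density_ge0.
    - apply: emeasurable_funM; first exact: mfp.
      by apply/measurable_EFinP; exact: measurable_mu_density.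
    - have mm := measurable_int _ (continuous_compact_integrable (@segment_compact _ al be) ci).
      exact: ((measurable_restrictT _ (measurable_itv _)).1 mm).
    - move=> x _; rewrite patchE; case: ifPn => [|xab]; last first.
        by rewrite /test indicE (negbTE xab) mul0r mulr0 normr0 powR0 ?mul0e// gt_eqF.
      rewrite inE /= => xab; move: (xab); rewrite in_itv /= => /andP[ax xb].
      have x0 : 0 < x by exact: lt_le_trans ax.
      rewrite -EFinM lee_fin /test indicE mem_set// mul1r mul1r /core /mu_density indicE mem_set; last first.
        by rewrite /= in_itv /= x0 (le_lt_trans xb).
      rewrite normrM powRM// (ger0_norm (powR_ge0 _ _)) -powRrM.
      rewrite [true%:R * _]mul1r mulrAC -powRD; last by rewrite (gt_eqF x0) implybT.
      have -> : - (nu + 1 / 2 - d) * p + (2 * nu + 1) = -1 by rewrite mulNr ep; ring.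
      rewrite powR_inv1 ?(ltW x0)// mulrC ler_wpM2r ?invr_ge0 ?(ltW x0)//.
      apply: ge0_ler_powR; rewrite ?nnegrE ?(ltW p0) ?(ltW V0)//.
      by apply: hV; rewrite ax xb.
  rewrite (@continuous_FTC2 _ (fun x => V `^ p * x^-1) (fun x => V `^ p * ln x))//.
  - by rewrite -EFinB lee_fin -mulrBr -ln_div ?posrE // (lt_trans al0).
  - have dl (x : R) : 0 < x -> is_derive x 1 (fun x => V `^ p * ln x) (V `^ p * x^-1).
      by move=> x0; exact: derZ (is_derive1_ln x0).
    have b0 : 0 < be by exact: lt_trans ab.
    split.
    + move=> x; rewrite in_itv /= => /andP[ax _].
      by have [] := dl x (lt_trans al0 ax).
    + by apply: cvg_at_right_filter; exact: der_cts (dl _ al0).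
    + by apply: cvg_at_left_filter; exact: der_cts (dl _ b0).
  - move=> x; rewrite in_itv /= => /andP[ax _].
    have x0 : 0 < x by exact: lt_trans ax.
    by rewrite derive1E; have [_ ->] := derZ (V `^ p) (is_derive1_ln x0).
have [J JE] : exists J, I = J%:E.
  by move: IV I0; case: (I) => [J _ _| |] //; exists J.
rewrite NE -/I JE poweR_EFin => N0.
have J0 : 0 < J.
  move: I0; rewrite JE lee_fin le_eqVlt => /predU1P[J0|//].
  by move: N0; rewrite -J0 powR0 ?eqxx// invr_neq0// gt_eqF.
rewrite JE lee_fin in IV.
exists (J `^ (- p^-1)).
  rewrite !powRN -invfM lef_pV2 ?posrE ?mulr_gt0 ?powR_gt0//.
  have -> : V * ln (be / al) `^ p^-1 = (V `^ p * ln (be / al)) `^ p^-1.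
    by rewrite powRM ?powR_ge0 ?(ltW L0)// -powRrM mulfV ?gt_eqF// powRr1 ?ltW.
  apply: ge0_ler_powR; rewrite ?nnegrE ?invr_ge0 ?(ltW p0) ?(ltW J0)//.
  by rewrite mulr_ge0 ?powR_ge0// ltW.
have k0 : 0 < J `^ (- p^-1) by rewrite powR_gt0.
split => //; rewrite NE.
have -> : (\int[mu]_x (`|f (J `^ (- p^-1)) x| `^ p)%:E = ((J `^ (- p^-1)) `^ p)%:E * I)%E.
  rewrite /I -ge0_integralZl//.
  - apply: eq_integral => x _; rewrite -EFinM testZ normrM powRM//.
    by rewrite (ger0_norm (ltW k0)).
  - by rewrite lee_fin powR_ge0.
rewrite JE -EFinM -powRrM mulNr mulVf ?gt_eqF// powR_inv1 ?(ltW J0)//.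
by rewrite mulVf ?gt_eqF// poweR1r.
Qed.

Lemma test_normalize_infty : nu + 1 / 2 - d = 0 ->
  'N[mu]_(+oo%E)[EFin \o f 1]%E != 0%E ->
  exists2 k, V^-1 <= k & 0 < k /\ 'N[mu]_(+oo%E)[EFin \o f k]%E = 1%E.
Proof.
move=> e0; have mu0 := mu_nu_setT_gt0 hnu.
(* At p = +oo the norm is the essential supremum only if the whole space has positive measure. *)
have NE k : 'N[mu]_(+oo%E)[EFin \o f k]%E = ess_sup mu (fun x => `|f k x|%:E).
  by rewrite unlock mu0.
rewrite !NE => N0.
have NV : (ess_sup mu (fun x => `|f 1 x|%:E) <= V%:E)%E.
  apply/ess_supP; apply: nearW => x; rewrite lee_fin /test mul1r indicE.
  case: (boolP (x \in _)) => [|_]; last by rewrite mul0r normr0 ltW.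
  rewrite inE /= in_itv /= => hx; rewrite mul1r /core e0 oppr0 powRr0 mul1r.
  exact: hV.
have N1 : (0 <= ess_sup mu (fun x => `|f 1 x|%:E))%E.
  by apply: ess_sup_gee => //; apply: nearW => x; rewrite lee_fin.
case E : (ess_sup mu (fun x => `|f 1 x|%:E)) => [m| |]; rewrite E in N0 NV N1 => //.
rewrite lee_fin in NV; rewrite lee_fin in N1.
have m0 : 0 < m by rewrite lt_def N1 andbT; apply: contraNneq N0 => ->.
exists m^-1; first by rewrite lef_pV2 ?posrE.
have im0 : 0 < m^-1 by rewrite invr_gt0.
split => //; rewrite NE.
have -> : (fun x => `|f m^-1 x|%:E) = (cst m^-1%:E \* (fun x => `|f 1 x|%:E))%E.
  apply/funext => x; rewrite /= -EFinM; congr EFin.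
  by rewrite testZ normrM (ger0_norm (ltW im0)).
by rewrite ess_sup_pZl// E -EFinM mulVf// gt_eqF.
Qed.

End test_norm.

(** * The test function on its interval, and the two estimates *)

Section extremizer.
Context {R : realType}.
Variables (nu d : R) (s : nat -> R).
Hypothesis hnu : - 1 / 2 < nu.
Hypothesis d0 : 0 < d.
Hypothesis hs : bessel_zeros nu s.

Local Notation e0 := (nu + 1 / 2 - d).

(** Serves both cases of the theorem; at the endpoint delta = nu + 1/2 the power of r is 1 and only
    the logarithm is left. *)
Lemma test_function_ge : exists c eps eta V, [/\ 0 < c, 0 < eps, 0 < V &
  \forall r \near +oo, let al := 2 / r in let be := r `^ eta / r in
   [/\ 1 < r, [/\ 0 < al, al < be & be < 1],
    forall y, al <= y <= be -> `|bu (nu + d + 1) (r * y)| <= V,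
    ln (be / al) <= ln r &
    eps / r < 1 /\ forall k x, 0 <= k -> 0 < x <= eps / r ->
      k * (c * r `^ e0 * ln r) <= bochner_riesz nu s d r (test nu d r al be k) x]].
Proof.
have [c [eps [eta [c0 eps0 /andP[eta0 eta1] hK]]]] := kernel_lower hnu d0 hs.
have a1 : 0 < nu + d + 1 + 1 by move: hnu d0; lra.
have [V V0 hV] := bu_bounded a1.
exists c, eps, eta, V; split => //; near=> r => /=.
have r1 : 1 < r by near: r; apply: nbhs_pinfty_gt; exact: num_real.
have r0 : 0 < r by lra.
have re : eps < r by near: r; apply: nbhs_pinfty_gt; exact: num_real.
have [n [G [g [rn T2 dG hg hG]]]] : exists n (G g : R -> R), [/\ r <= s n,
    2 <= r `^ eta,
    forall y, 2 / r <= y <= r `^ eta / r -> is_derive y 1 G (g y) /\ {for y, continuous g},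
    forall x y, 0 < x <= eps / r -> 2 / r <= y <= r `^ eta / r ->
      g y <= y `^ (- e0) * bu (nu + d + 1) (r * y) * brkernel nu d s r n x y * y `^ (2 * nu + 1) &
    c * r `^ e0 * ln r <= G (r `^ eta / r) - G (2 / r)] by near: r.
have lr : 0 < ln r by rewrite ln_gt0.
have crl : 0 < c * r `^ e0 * ln r by rewrite !mulr_gt0 ?powR_gt0.
have T2' : 2 < r `^ eta.
  (* If r^eta were 2, the ends of the interval would coincide and the difference of the values of G
     would be 0, against its positive lower bound. *)
  rewrite lt_def T2 andbT; apply: contraTneq crl => T; move: hG; rewrite T subrr -leNgt.
  exact.
have al0 : 0 < 2 / r by rewrite divr_gt0.
have albe : 2 / r < r `^ eta / r by rewrite ltr_pM2r ?invr_gt0.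
have be1 : r `^ eta / r < 1.
  rewrite ltr_pdivrMr// mul1r /powR gt_eqF// -[ltRHS]lnK ?posrE// ltr_expR.
  by rewrite gtr_pMl//; lra.
have Tr : r `^ eta <= r.
  by rewrite -[leRHS](powRr1 (ltW r0)) ler_powR ?(ltW r1)//; lra.
split; [exact: r1|by split| | |].
- move=> y /andP[ay _]; apply: hV.
  by move: ay; rewrite ler_pdivrMr// mulrC; lra.
- rewrite ler_ln ?posrE ?divr_gt0 ?powR_gt0//.
  have -> : r `^ eta / r / (2 / r) = r `^ eta / 2 by field; rewrite gt_eqF.
  by lra.
- split => [|k x k0 hx]; first by rewrite ltr_pdivrMr// mul1r.
  apply: le_trans (ler_wpM2l k0 hG) _.
  apply: (bochner_riesz_test_ge hnu d0 hs r0 al0 be1 albe k0 rn dG) => y hy.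
  exact: hg.
Unshelve. all: by end_near.
Qed.

End extremizer.

Theorem theorem6 (R : realType) (nu delta : R) (s : nat -> R) :
  -1 / 2 < nu -> 0 < delta -> bessel_zeros nu s ->
  let p0 := 4 * (nu + 1) / (2 * nu + 3 + 2 * delta) in
  let p1 := 4 * (nu + 1) / (2 * nu + 1 - 2 * delta) in
  (delta < nu + 1 / 2 ->
     exists2 C : R, 0 < C &
       \forall r \near +oo,
         ((C * (ln r) `^ p0^-1)%:E <=
          ereal_sup [set weak_Lnorm (mu_nu nu) p1 (bochner_riesz nu s delta r f)
                    | f in [set f : R -> R | measurable_fun setT f /\
                                'N[mu_nu nu]_(p1%:E)[EFin \o f] = 1%E]])%E) /\
  (delta = nu + 1 / 2 ->
     exists2 C : R, 0 < C &
       \forall r \near +oo,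
         ((C * ln r)%:E <=
          ereal_sup [set 'N[mu_nu nu]_(+oo%E)[EFin \o bochner_riesz nu s delta r f]
                    | f in [set f : R -> R | measurable_fun setT f /\
                                'N[mu_nu nu]_(+oo%E)[EFin \o f] = 1%E]])%E).
Proof.
move=> hnu d0 hs p0 p1.
have [c [eps [eta [V [c0 eps0 V0 hT]]]]] := test_function_ge hnu d0 hs.
split=> hd.
  set e0 := nu + 1 / 2 - delta.
  have e00 : 0 < e0 by rewrite /e0; lra.
  have n1 : 0 < nu + 1 by move: hnu; lra.
  have D1 : 0 < 2 * nu + 1 - 2 * delta by lra.
  have D0 : 0 < 2 * nu + 3 + 2 * delta by move: hnu d0; lra.
  have p10 : 0 < p1 by rewrite divr_gt0 ?mulr_gt0.
  have ep : e0 * p1 = 2 * nu + 2 by rewrite /e0 /p1; field; rewrite gt_eqF.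
  have pp : 1 - p1^-1 = p0^-1.
    by rewrite /p1 /p0; field; rewrite !gt_eqF.
  exists (c / 2 * (eps / 2) `^ e0 / V); first by rewrite !mulr_gt0 ?powR_gt0 ?invr_gt0 ?divr_gt0.
  near=> r.
  have := near hT r; case=> //; cbv zeta.
  set al := 2 / r; set be := r `^ eta / r.
  move=> r1 [al0 ab be1] hV lnr [er1 hB].
  have r0 : 0 < r by lra.
  have lr : 0 < ln r by rewrite ln_gt0.
  have er0 : 0 < eps / r by rewrite divr_gt0.
  have B1 : bochner_riesz nu s delta r (test nu delta r al be 1) (eps / r) != 0.
    rewrite gt_eqF//; apply: lt_le_trans (hB 1 (eps / r) ler01 _); last by rewrite er0 lexx.
    by rewrite mul1r !mulr_gt0 ?powR_gt0.
  have N0 := test_Lnorm_neq0 hnu d0 hs (p := p1%:E) p10 B1.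
  have [k kV [k0 Nk]] := test_normalize_fin hnu d0 al0 ab be1 V0 hV p10 ep N0.
  apply: (@le_trans _ _ (weak_Lnorm (mu_nu nu) p1 (bochner_riesz nu s delta r (test nu delta r al be k)))); last first.
    apply: ereal_sup_ubound; exists (test nu delta r al be k) => //; split => //.
    exact: measurable_test.
  (* Half of the lower bound for B_R f near 0, so that the strict inequality of the superlevel set
     holds there. *)
  pose l := k * (c * r `^ e0 * ln r) / 2.
  have l0 : 0 < l by rewrite /l !mulr_gt0 ?powR_gt0 ?invr_gt0.
  apply: (@le_trans _ _ (l%:E * (mu_nu nu [set x : R | l < `|bochner_riesz nu s delta r (test nu delta r al be k) x|]%R) `^ p1^-1)%E); last first.
    by apply: ereal_sup_ubound; exists l => //=; rewrite in_itv /= l0.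
  have sub : `[eps / r / 2, eps / r]%classic `<=`
      [set x : R | l < `|bochner_riesz nu s delta r (test nu delta r al be k) x|].
    move=> x; rewrite /= in_itv /= => /andP[x1 x2].
    have x0 : 0 < x by apply: lt_le_trans x1; rewrite divr_gt0.
    apply: lt_le_trans (ler_norm _); apply: lt_le_trans (hB k x (ltW k0) _); last by rewrite x0.
    have : 0 < l by [].
    by rewrite /l; lra.
  have mu_ge : (((eps / r / 2) `^ (2 * nu + 2))%:E <= mu_nu nu
      [set x : R | l < `|bochner_riesz nu s delta r (test nu delta r al be k) x|]%R)%E.
    apply: le_trans (mu_nu_mono nu sub); apply: mu_nu_itv_ge => //.
    by rewrite er0.
  (* Since e0 p1 = 2 nu + 2, the bound on the measure raised to the power 1 / p1 is (eps / 2r)^e0,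
     which cancels the factor r^e0 of l. *)
  apply: (@le_trans _ _ (l * (eps / r / 2) `^ e0)%:E).
    rewrite lee_fin.
    have -> : (eps / r / 2) `^ e0 = (eps / 2) `^ e0 * (r `^ e0)^-1.
      have -> : eps / r / 2 = eps / 2 * r^-1 by ring.
      rewrite powRM ?invr_ge0 ?(ltW r0)//; last by rewrite divr_ge0 ?ltW.
      by rewrite -(powR_inv1 (ltW r0)) -powRrM mulN1r powRN.
    have re : r `^ e0 != 0 by rewrite gt_eqF ?powR_gt0.
    have -> : l * ((eps / 2) `^ e0 / r `^ e0) = c / 2 * (eps / 2) `^ e0 * (k * ln r).
      by rewrite /l; move: ((eps / 2) `^ e0) (r `^ e0) re => A B B0; field.
    have -> : c / 2 * (eps / 2) `^ e0 / V * ln r `^ p0^-1 =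
        c / 2 * (eps / 2) `^ e0 * (V^-1 * ln r `^ p0^-1) by ring.
    apply: ler_wpM2l; first by rewrite mulr_ge0 ?powR_ge0// divr_ge0// (ltW c0).
    rewrite -pp powRB; last by rewrite (gt_eqF lr) implybT.
    rewrite powRr1 ?(ltW lr)//.
    have -> : V^-1 * (ln r / ln r `^ p1^-1) = V^-1 * ln r `^ (- p1^-1) * ln r.
      by rewrite powRN; ring.
    rewrite ler_wpM2r ?(ltW lr)//; apply: le_trans kV.
    rewrite ler_wpM2l ?invr_ge0 ?(ltW V0)//.
    have L0 : 0 < ln (be / al) by rewrite ln_gt0// ltr_pdivlMr// mul1r.
    rewrite !powRN lef_pV2 ?posrE ?powR_gt0//.
    by apply: ge0_ler_powR; rewrite ?nnegrE ?invr_ge0 ?(ltW p10) ?(ltW lr) ?(ltW L0).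
  rewrite EFinM lee_pmul2l//.
  have -> : (eps / r / 2) `^ e0 = ((eps / r / 2) `^ (2 * nu + 2)) `^ p1^-1.
    by rewrite -powRrM -ep mulfK// gt_eqF.
  rewrite -poweR_EFin; apply: gt0_ler_poweR => //.
  - by rewrite invr_ge0 ltW.
  - by rewrite in_itv /= leey lee_fin powR_ge0.
  - by rewrite in_itv /= leey measure_ge0.
have e0 : nu + 1 / 2 - delta = 0 by rewrite hd subrr.
exists (c / V); first by rewrite divr_gt0.
near=> r.
have := near hT r; case=> //; cbv zeta.
set al := 2 / r; set be := r `^ eta / r.
move=> r1 [al0 ab be1] hV lnr [er1 hB].
have r0 : 0 < r by lra.
have lr : 0 < ln r by rewrite ln_gt0.
have er0 : 0 < eps / r by rewrite divr_gt0.
have B1 : bochner_riesz nu s delta r (test nu delta r al be 1) (eps / r) != 0.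
  rewrite gt_eqF//; apply: lt_le_trans (hB 1 (eps / r) ler01 _); last by rewrite er0 lexx.
  by rewrite mul1r !mulr_gt0 ?powR_gt0.
have N0 := test_Lnorm_neq0 hnu d0 hs (p := +oo%E) (ltry 0) B1.
have [k kV [k0 Nk]] := test_normalize_infty hnu V0 hV e0 N0.
apply: (@le_trans _ _ 'N[mu_nu nu]_(+oo%E)[EFin \o bochner_riesz nu s delta r (test nu delta r al be k)]%E); last first.
  apply: ereal_sup_ubound; exists (test nu delta r al be k) => //; split => //.
  exact: measurable_test.
rewrite unlock (mu_nu_setT_gt0 hnu) leNgt; apply/negP => lt.
(* If the essential supremum were below the bound, the exceptional null set N would contain the
   whole interval [eps / 2r, eps / r], which has positive measure. *)
have /ess_supP[N [mN N0' subN]] := lexx (ess_sup (mu_nu nu) (abse \o (EFin \o bochner_riesz nu s delta r (test nu delta r al be k)))).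
have sub : `[eps / r / 2, eps / r]%classic `<=` N.
  move=> x; rewrite /= in_itv /= => /andP[x1 x2].
  have x0 : 0 < x by apply: lt_le_trans x1; rewrite divr_gt0.
  apply: subN => /= hx; have := le_lt_trans hx lt; rewrite lte_fin ltNge => /negP; apply.
  apply: le_trans (ler_norm _); apply: le_trans (hB k x (ltW k0) _); last by rewrite x0.
  rewrite e0 powRr0 mulr1 [leLHS](_ : _ = V^-1 * (c * ln r)); last by ring.
  by rewrite ler_wpM2r// mulr_ge0// ltW.
have := mu_nu_mono nu sub; rewrite N0'; apply/negP; rewrite -ltNge.
apply: lt_le_trans (mu_nu_itv_ge hnu _); last by rewrite er0.
by rewrite lte_fin powR_gt0// divr_gt0.
Unshelve. all: by end_near.
Qed.
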